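(* Fix $p\in(1,\infty)$. Assume that $I\subseteq\mathbb{N}$ is such that the symmetric difference of $I$ and $\{\lfloor n^p\rfloor:n\in\mathbb{N}\}$ is finite and that $h:=\dim_{\mathrm H}F_I\in(1/(p+1),1/p)$. Put $\theta_1=\frac{(h+hp-1)p}{(1+p)(2ph-1)}$. Then $$\dim_{\mathrm A}^\theta F_I=\begin{cases}h+\frac{\theta}{p(1-\theta)}(1-ph),&0\le\theta\le\theta_1,\\ \frac{1}{(1+p)(1-\theta)},&\theta_1<\theta<\frac{p}{1+p},\\ 1,&\frac{p}{1+p}\le\theta\le1.\end{cases}$$ In particular, $\theta\mapsto\dim_{\mathrm A}^\theta F_I$ has two phase transitions (i.e. exactly two points of non-differentiability in $(0,1)$), and for all $\theta\in(0,\theta_1)$, $$\max\{h,\overline{\dim}_{\mathrm A}^\theta P\}<\dim_{\mathrm A}^\theta F_I<\max_{\phi\in[\theta,1]}\frac{(\phi^{-1}-1)\,\overline{\dim}_{\mathrm A}^\phi P+(\theta^{-1}-\phi^{-1})\,\overline{\dim}_{\mathrm B}F_I}{\theta^{-1}-1},$$ where $P$ is any set containing exactly one point of $S(X)$ for each map $S$ of the iterated function system associated with $I$ (and contained in the union of the sets $S(X)$).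
   Context: $\mathbb{N}=\{1,2,3,\dots\}$; $\dim_{\mathrm H}$ and $\overline{\dim}_{\mathrm B}$ are Hausdorff and upper box dimension. For non-empty $I\subseteq\mathbb{N}$, $$F_I=\left\{z\in(0,1)\setminus\mathbb{Q}:\ z=\cfrac{1}{b_1+\cfrac{1}{b_2+\cfrac{1}{\ddots}}},\ b_n\in I\text{ for all }n\in\mathbb{N}\right\}.$$ The iterated function system on $X=[0,1]$ associated with $I$ (whose limit set is $F_I$) is: if $1\notin I$, $\{S_b(x)=1/(b+x):b\in I\}$; if $1\in I$, $\{S_b(x)=1/(b+x):b\in I,\,b\ne1\}\cup\{S_{1b}(x)=\frac{1}{b+\frac{1}{1+x}}:b\in I\}$. Dimensions: $B(x,R)$ is the open ball and $N_r(E)$ the smallest number of balls of radius $r$ needed to cover $E$. For non-empty bounded $E\subset\mathbb{R}$ and $\theta\in(0,1)$, the Assouad spectrum is $\dim_{\mathrm A}^\theta E=\inf\{\alpha:\exists C>0\ \forall x\in E\ \forall\,0<R\le1,\ N_{R^{1/\theta}}(B(x,R)\cap E)\le CR^{\alpha(1-1/\theta)}\}$ and the upper Assouad spectrum is $\overline{\dim}_{\mathrm A}^\theta E=\inf\{\alpha:\exists C>0\ \forall x\in E\ \forall\,0<r\le R^{1/\theta}\le R\le1,\ N_r(B(x,R)\cap E)\le C(R/r)^\alpha\}$. Conventions: $\dim_{\mathrm A}^0E=\overline{\dim}_{\mathrm B}E$, and $\dim_{\mathrm A}^1E=\overline{\dim}_{\mathrm A}^1E=\dim_{\mathrm{qA}}E:=\lim_{\theta\to1^-}\dim_{\mathrm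 A}^\theta E$. *)

(* Defs.v *)
From HB Require Import structures.
From mathcomp Require Import all_boot all_order all_algebra.
From mathcomp Require Import all_classical all_reals all_analysis.

Set Implicit Arguments.
Unset Strict Implicit.
Unset Printing Implicit Defensive.

Import Order.TTheory GRing.Theory Num.Theory.
Import numFieldNormedType.Exports.

Local Open Scope classical_set_scope.
Local Open Scope ring_scope.

Section Dimensions.
Context {R : realType}.
Implicit Types (E U : set R) (r s d theta alpha : R).

Definition diameter U : \bar R :=
  ereal_sup (0%E |` [set `|xy.1 - xy.2|%:E | xy in U `*` U]).

(* The empty set contributes 0 also for s = 0, so that the case s = 0 below is
   counting measure (a plain [diameter U `^ 0] would be 1). *)
Definition hausdorff_gauge s U : \bar R :=
  if U == set0 then 0%E else poweR (diameter U) s.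

Definition hausdorff_premeasure s d E : \bar R :=
  ereal_inf [set (\sum_(i <oo) hausdorff_gauge s (U i))%E | U in
    [set U : nat -> set R | E `<=` \bigcup_i U i /\
                            forall i, (diameter (U i) <= d%:E)%E]].

Definition hausdorff_measure s E : \bar R :=
  ereal_sup [set hausdorff_premeasure s d E | d in [set d | 0 < d]].

Definition hausdorff_dim E : \bar R :=
  ereal_inf [set s%:E | s in [set s | 0 <= s /\ hausdorff_measure s E = 0%E]].

(* Smallest number of open balls of radius r, with centres anywhere on the
   line, covering E; it is +oo if no finite family covers E. *)
Definition covering_number r E : \bar R :=
  ereal_inf [set n%:R%:E | n in
    [set n : nat | exists c : 'I_n -> R, E `<=` \bigcup_i ball (c i) r]].

Definition upper_box_dim E : \bar R :=
  limf_esup (fun r => (lne (covering_number r E) * ((- ln r)^-1)%:E)%E) 0^'+.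

Definition assouad_spectrum_open theta E : \bar R :=
  ereal_inf [set alpha%:E | alpha in [set alpha |
    exists2 C : R, 0 < C &
    forall x, E x -> forall rho : R, 0 < rho -> rho <= 1 ->
      (covering_number (rho `^ theta^-1) (ball x rho `&` E)
        <= (C * rho `^ (alpha * (1 - theta^-1)))%:E)%E]].

Definition upper_assouad_spectrum_open theta E : \bar R :=
  ereal_inf [set alpha%:E | alpha in [set alpha |
    exists2 C : R, 0 < C &
    forall x, E x -> forall r rho : R,
      0 < r -> r <= rho `^ theta^-1 -> rho `^ theta^-1 <= rho -> rho <= 1 ->
      (covering_number r (ball x rho `&` E)
        <= (C * (rho / r) `^ alpha)%:E)%E]].

Definition quasi_assouad_dim E : \bar R :=
  lim (assouad_spectrum_open theta E @[theta --> 1^'-]).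

(* Meaningful for 0 <= theta <= 1. *)
Definition assouad_spectrum theta E : \bar R :=
  if theta == 0 then upper_box_dim E
  else if theta == 1 then quasi_assouad_dim E
  else assouad_spectrum_open theta E.

(* Meaningful for 0 < theta <= 1. *)
Definition upper_assouad_spectrum theta E : \bar R :=
  if theta == 1 then quasi_assouad_dim E
  else upper_assouad_spectrum_open theta E.

End Dimensions.

Section ContinuedFractions.
Context {R : realType}.
Implicit Types (I : set nat) (b : nat -> nat) (x z : R).

(* 1 / (b 0 + 1 / (b 1 + ... + 1 / b n.-1)); the partial quotient b_n of the
   mathematical notation, n >= 1, is b n.-1 here. *)
Fixpoint cf_convergent b n : R :=
  if n is n'.+1 then ((b 0%N)%:R + cf_convergent (fun k => b k.+1) n')^-1
  else 0.

Definition cf_set I : set R :=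
  [set z | [/\ 0 < z, z < 1, irrational z &
    exists2 b : nat -> nat, forall n, I (b n) &
      cf_convergent b n @[n --> \oo] --> z]].

Definition cf_map (b : nat) x : R := (b%:R + x)^-1.

Definition cf_map1 (b : nat) x : R := (b%:R + (1 + x)^-1)^-1.

Definition cf_ifs I : set (R -> R) :=
  if 1%N \in I then (cf_map @` (I `\ 1%N)) `|` (cf_map1 @` I)
  else cf_map @` I.

Definition ifs_section (Phi : set (R -> R)) (P : set R) : Prop :=
  P `<=` \bigcup_(S in Phi) (S @` `[0, 1]) /\
  forall S, Phi S -> exists! y, (P `&` (S @` `[0, 1])) y.

End ContinuedFractions.

Definition floor_powers {R : realType} (p : R) : set nat :=
  [set m | exists2 n, (0 < n)%N & m%:Z = Num.floor (n%:R `^ p)].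

Definition is_max {R : realType} (A : set (\bar R)) (M : \bar R) : Prop :=
  A M /\ ubound A M.

(* The quantity maximised over phi in the general upper bound for the Assouad
   spectrum of a limit set F at theta. *)
Definition spectrum_bound {R : realType} (P F : set R) (theta phi : R)
    : \bar R :=
  (((phi^-1 - 1)%:E * upper_assouad_spectrum phi P +
    (theta^-1 - phi^-1)%:E * upper_box_dim F) * ((theta^-1 - 1)^-1)%:E)%E.

(* Main.v *)
Require Import Defs.
From HB Require Import structures.
From mathcomp Require Import all_boot all_order all_algebra.
From mathcomp Require Import all_classical all_reals all_analysis.
From mathcomp Require Import ring lra zify.

(** Let q(w) be the denominator of the convergent of a word w, so that the
    cylinder of w has length between q(w)^-2 / 2 and q(w)^-2. A mass distribution
    argument (a finite family of words of one length with large
    sum of q(w)^(-2s) generates a self-similar set of dimension at least s) shows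
    that for s > h the sums of q(w)^(-2s) over the words of any fixed length are at
    most 4^s. Stopping each expansion when q(w)^2 first exceeds 1/r then gives
    N_r(F) <= C r^(-s), the digits beyond the stopping time being handled by the
    counting function of I.

    For a ball of radius rho and r = rho^(1/theta), the same stopping at scale rho
    leaves, up to logarithms, boundedly many cylinders; blown up, each of them is a piece
    of F near 0, where the first-level cylinders that meet it are counted in
    dyadic annuli. The resulting bound
      (rho / r)^s rho^(s - 1/p) + r^(-1/(p+1))
    is sharp: the first term is attained by the copies of F with first digit of
    order 1/rho, which are r-separated, and the second since the first-level
    cylinders are as dense near 0 as the points n^(-p). The same
    density computes the spectra of P, and the general upper bound is then
    maximised at phi = p/(1+p). *)

Set Implicit Arguments.
Unset Strict Implicit.
Unset Printing Implicit Defensive.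

Import Order.TTheory GRing.Theory Num.Theory.
Import numFieldNormedType.Exports.

Local Open Scope classical_set_scope.
Local Open Scope ring_scope.

(** * Coverings *)

(** The blow-up explains the shape of the bound. After stopping at radius rho, the next digit b
    satisfies 4 q^2 rho b^2 >= 1, so the blown-up piece lies within 2 sqrt(d) of 0, where d = q^2
    rho, while its diameter is at most 8 d. In the annulus y ~ T the digits are of order 1/T: the
    piece meets about 1 + min(d, T) T^(-1-1/p) first-level cylinders, each of length about T^2 and
    hence of cost 1 + (T^2 / r)^s, with r also blown up. The mixed term of the product is largest at
    T = d and gives d^(2s-1/p) r^(-s). Since s < 1/p, undoing the blow-up is worst for the empty
    word, where q = 1. Word sums are controlled only length by length. The number of lengths at a
    given scale is logarithmic and costs an arbitrarily small power, harmless because the spectra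
    are infima of exponents. No limit measure is constructed in the mass distribution argument:
    compactness reduces a cover to finitely many sets, and on these an atomic measure of a high
    enough level can be tested. *)

Section Covering.
Context {R : realType}.
Implicit Types (E A : set R) (r C L : R).

(** The relation N_r(E) <= C for a real C, so that bounds can be added and multiplied without
    rounding and without extended reals. *)
Definition coverable E r C :=
  exists2 l : seq R, (size l)%:R <= C &
    forall x, E x -> exists2 c, c \in l & `|c - x| < r.

(** An infimum of natural numbers is attained by the least one; if no finite family covers, the
    infimum is +oo and exceeds every real [C]. *)
Lemma covering_number_le E r C :
  (covering_number r E <= C%:E)%E <-> coverable E r C.
Proof.
split=> [hC|[l lC hl]]; last first.
  apply: (@le_trans _ _ ((size l)%:R%:E)); last by rewrite lee_fin.
  apply: ereal_inf_lbound; exists (size l) => //=.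
  exists (fun i => nth 0 l i) => x Ex; have [c cl xc] := hl x Ex.
  have ci : (index c l < size l)%N by rewrite index_mem.
  exists (Ordinal ci) => //=.
  by rewrite /ball /= nth_index.
set S := [set n : nat | exists c : 'I_n -> R, E `<=` \bigcup_i ball (c i) r].
have [[n0 Sn0]|S0] := pselect (exists n, S n); last first.
  have e0 : [set n%:R%:E | n in S] = set0 :> set (\bar R).
    by rewrite -subset0 => y [n Sn _]; apply: S0; exists n.
  by move: hC; rewrite /covering_number -/S e0 ereal_inf0 leye_eq.
have exS : exists n, `[< S n >] by exists n0; apply/asboolP.
case: (ex_minnP exS) => n /asboolP[c hc] hmin.
exists [seq c i | i <- enum 'I_n].
  rewrite size_map size_enum_ord -lee_fin; apply: le_trans hC.
  apply: le_ereal_inf_tmp => _ /= [m Sm <-].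
  by rewrite lee_fin ler_nat; apply: hmin; apply/asboolP.
move=> x /hc[i _ xi]; exists (c i) => //.
by apply: map_f; rewrite mem_enum.
Qed.

Lemma coverable_sub E A r C : A `<=` E -> coverable E r C -> coverable A r C.
Proof. by move=> AE [l lC hl]; exists l => // x /AE/hl. Qed.

Lemma coverable_le E r C C' : C <= C' -> coverable E r C -> coverable E r C'.
Proof. by move=> CC' [l lC hl]; exists l => //; exact: le_trans CC'. Qed.

(** Any point of a class of diameter less than r is the centre of a ball that contains the class.
    The default 0 of [xget] is only chosen for empty classes. *)
Lemma coverable_classes (T : eqType) (l : seq T) (Rel : T -> R -> Prop) E r :
  (forall x, E x -> exists2 c, c \in l & Rel c x) ->
  (forall c x y, c \in l -> E x -> E y -> Rel c x -> Rel c y -> `|x - y| < r) ->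
  coverable E r (size l)%:R.
Proof.
move=> hl hd.
pose rep c := xget 0 [set x | E x /\ Rel c x].
exists (map rep l); first by rewrite size_map.
move=> x Ex; have [c cl cx] := hl x Ex.
exists (rep c); first exact: map_f.
have [Er Rr] : [set x | E x /\ Rel c x] (rep c) by apply: (@xgetPex _ 0); exists x.
exact: (hd c).
Qed.

Lemma coverable_union (T : eqType) (l : seq T) (A : T -> set R) (C : T -> R) E r :
  (forall x, E x -> exists2 c, c \in l & A c x) ->
  (forall c, c \in l -> coverable (A c) r (C c)) ->
  coverable E r (\sum_(c <- l) C c).
Proof.
elim: l E => [|a l IH] E hl hc.
  by rewrite big_nil; exists [::] => // x /hl[].
rewrite big_cons.
have [l1 l1C h1] := hc a (mem_head _ _).
have [|c cl|l2 l2C h2] := IH [set x | E x /\ ~ A a x].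
- move=> x [Ex nAx]; have [c] := hl x Ex; rewrite inE => /orP[/eqP->//|cl Ac].
  by exists c.
- by apply: hc; rewrite inE cl orbT.
exists (l1 ++ l2); first by rewrite size_cat natrD lerD.
move=> x Ex; have [/h1|nA] := pselect (A a x).
  by move=> [c cl xc]; exists c => //; rewrite mem_cat cl.
have [c cl xc] := h2 x (conj Ex nA).
by exists c => //; rewrite mem_cat cl orbT.
Qed.

Lemma coverable_union_le (T : eqType) (l : seq T) (A : T -> set R) (M C : R) E r :
  (size l)%:R <= M -> 0 <= C ->
  (forall x, E x -> exists2 c, c \in l & A c x) ->
  (forall c, c \in l -> coverable (A c) r C) ->
  coverable E r (M * C).
Proof.
move=> lM C0 hl hc; apply: (@coverable_le _ _ (\sum_(c <- l) C)).
  by rewrite big_const_seq count_predT iter_addr_0 -mulr_natl ler_wpM2r.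
exact: coverable_union hc.
Qed.

Lemma coverable_cup E A B r C D :
  (forall x, E x -> A x \/ B x) -> coverable A r C -> coverable B r D ->
  coverable E r (C + D).
Proof.
move=> h [l1 l1C h1] [l2 l2C h2]; exists (l1 ++ l2).
  by rewrite size_cat natrD lerD.
move=> x /h[/h1|/h2][c cl xc]; exists c => //; rewrite mem_cat cl ?orbT //.
Qed.

Lemma coverable_itv a L r : 0 < r -> 0 <= L ->
  coverable [set x | a <= x <= a + L] r (L / r + 1).
Proof.
move=> r0 L0; pose m := (Num.truncn (L / r)).+1.
exists [seq a + r * i%:R | i <- iota 0 m].
  rewrite size_map size_iota /m -natr1 lerD2r.
  by rewrite truncn_le // divr_ge0 // ltW.
move=> x /andP[ax xL]; pose j := Num.truncn ((x - a) / r).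
have xa0 : 0 <= (x - a) / r by rewrite divr_ge0 ?subr_ge0 // ltW.
exists (a + r * j%:R).
  apply: (map_f (fun i => a + r * i%:R));
    rewrite mem_iota /= add0n ltnS le_truncn // ler_pM2r ?invr_gt0 //.
  lra.
have /andP[j1 j2] := truncn_itv xa0.
move: j1 j2; rewrite -/j ler_pdivlMr // ltr_pdivrMr // -natr1 => j1 j2.
rewrite ltr_norml; apply/andP; split; nra.
Qed.

Lemma coverable_diam E D r : 0 < r -> 0 <= D ->
  (forall x y, E x -> E y -> `|x - y| <= D) -> coverable E r (2 * D / r + 1).
Proof.
move=> r0 D0 h; have [[y Ey]|E0] := pselect (exists y, E y); last first.
  exists [::] => /=; last by move=> x Ex; case: E0; exists x.
  by rewrite addr_ge0 // divr_ge0 ?mulr_ge0 // ltW.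
apply: coverable_sub (coverable_itv (y - D) r0 _); last by rewrite mulr_ge0.
move=> x Ex /=; have := h x y Ex Ey; rewrite ler_norml => /andP[]; lra.
Qed.

(** The given centres may lie outside [E], where [f] is not controlled. The classes cut out by the
    balls are mapped instead, which doubles the radius. *)
Lemma coverable_image E (f : R -> R) L r C : 0 < L ->
  (forall x y, E x -> E y -> `|f x - f y| <= L * `|x - y|) ->
  coverable E r C -> coverable (f @` E) (2 * L * r) C.
Proof.
move=> L0 hf [l lC hl]; apply: (coverable_le lC).
apply: (@coverable_classes _ _ (fun c y => exists2 x, E x & y = f x /\ `|c - x| < r)).
  by move=> _ [x Ex <-]; have [c cl xc] := hl x Ex; exists c => //; exists x.
move=> c _ _ cl _ _ [x Ex [-> cx]] [y Ey [-> cy]].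
apply: (le_lt_trans (hf x y Ex Ey)).
rewrite -mulrA [2 * _]mulrC -mulrA ltr_pM2l //.
have := ler_distD c x y; rewrite (distrC x c); lra.
Qed.

Lemma coverable_preimage E (f : R -> R) L r C : 0 < L ->
  (forall x y, E x -> E y -> L * `|x - y| <= `|f x - f y|) ->
  coverable (f @` E) r C -> coverable E (2 * r / L) C.
Proof.
move=> L0 hf [l lC hl]; apply: (coverable_le lC).
apply: (@coverable_classes _ _ (fun c x => `|c - f x| < r)).
  by move=> x Ex; apply: hl; exists x.
move=> c x y cl Ex Ey cx cy.
rewrite ltr_pdivlMr // mulrC; apply: le_lt_trans (hf x y Ex Ey) _.
have := ler_distD c (f x) (f y); rewrite (distrC (f x) c); lra.
Qed.

(** A ball of radius r cannot meet two pieces at distance at least 2 r, so the centres split into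
    disjoint groups, one for each piece. *)
Lemma coverable_separated (T : eqType) (l : seq T) (A : T -> set R) (C : T -> R) E r N :
  uniq l ->
  (forall c, c \in l -> A c `<=` E) ->
  (forall c c' x y, c \in l -> c' \in l -> A c x -> A c' y -> `|x - y| < 2 * r -> c = c') ->
  (forall c N', c \in l -> coverable (A c) r N' -> C c <= N') ->
  coverable E r N -> \sum_(c <- l) C c <= N.
Proof.
move=> ul AE sep hC [L LN hL]; apply: le_trans LN.
have {hL AE} : forall c x, c \in l -> A c x -> exists2 d, d \in L & `|d - x| < r.
  by move=> c x cl /(AE _ cl)/hL.
elim: l L ul sep hC => [|a l IH] L /= ul sep hC hL; first by rewrite big_nil.
have {ul}/andP[al ul] := ul.
pose P c := `[< exists2 x, A a x & `|c - x| < r >].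
rewrite big_cons -(count_predC P) natrD -!size_filter lerD //.
  apply: hC; first exact: mem_head.
  exists [seq c <- L | P c] => // x Ax; have [c cL xc] := hL a x (mem_head _ _) Ax.
  by exists c => //; rewrite mem_filter cL andbT; apply/asboolP; exists x.
have hl c : c \in l -> c \in a :: l by rewrite inE orbC => ->.
apply: IH => //.
- by move=> c c' x y /hl cl /hl cl'; exact: sep.
- by move=> c N' /hl cl; exact: hC.
move=> b x bl Ab; have [c cL xc] := hL b x (hl _ bl) Ab.
exists c => //; rewrite mem_filter cL andbT /=; apply/asboolPn => -[y Ay cy].
suff ab : a = b by rewrite ab bl in al.
apply: (sep a b y x (mem_head _ _) (hl _ bl)) => //.
by have := ler_distD c y x; rewrite (distrC y c); lra.
Qed.

Lemma coverable_points (T : eqType) (l : seq T) (f : T -> R) E r N :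
  uniq l -> (forall c, c \in l -> E (f c)) ->
  (forall c c', c \in l -> c' \in l -> `|f c - f c'| < 2 * r -> c = c') ->
  coverable E r N -> (size l)%:R <= N.
Proof.
move=> ul fE sep hN.
have -> : (size l)%:R = \sum_(c <- l) (1 : R).
  by rewrite big_const_seq count_predT iter_addr_0.
apply: (@coverable_separated _ l (fun c => [set f c]) (fun=> 1) E r) => //.
- by move=> c cl _ ->; exact: fE.
- by move=> c c' x y cl cl' -> ->; exact: sep.
move=> c N' cl [L LN hL]; apply: le_trans LN.
have [d dL _] := hL (f c) erefl.
by rewrite ler1n; case: L dL {hL}.
Qed.

End Covering.

(** * Continued fractions *)

Section ContinuedFractionMaps.
Context {R : realType}.
Implicit Types (w : seq nat) (x y z : R).

Definition cf_word w x : R := foldr cf_map x w.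

Definition pos_word w := all (leq 1) w.

(* [cf_mx w] lists (p', p, q', q) with [cf_word w x = (p' x + p) / (q' x + q)]. *)
Fixpoint cf_mx w : nat * nat * nat * nat :=
  if w is b :: w' then
    let: (p', p, q', q) := cf_mx w' in (q', q, p' + b * q', p + b * q)%N
  else (1, 0, 0, 1)%N.

(** The denominator q(w) of the convergent [cf_word w 0]; for non-empty [w], [cont' w] is that of
    [w] without its last digit. *)
Definition cont w : nat := (cf_mx w).2.
Definition cont' w : nat := (cf_mx w).1.2.

Lemma cont_cons_le b w : (b * cont w <= cont (b :: w))%N.
Proof. by rewrite /cont /=; case: (cf_mx w) => [[[p' p] q'] q] /=; lia. Qed.

Lemma cont_cons2 a b w : cont (a :: b :: w) = (cont w + a * cont (b :: w))%N.
Proof. by rewrite /cont /=; case: (cf_mx w) => [[[p' p] q'] q]. Qed.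

Lemma cont_gt0 w : pos_word w -> (0 < cont w)%N.
Proof.
elim: w => // b w IH /= /andP[b0 /IH w0]; apply: leq_trans (cont_cons_le _ _).
by rewrite muln_gt0 b0.
Qed.

(** The second inequality serves the induction: a new first digit b turns q' into p' + b q', and p'
    alone may exceed p. *)
Lemma cont'_le w : pos_word w ->
  let: (p', p, q', q) := cf_mx w in
  ((q' <= q) && (p' + q' <= p + q))%N.
Proof.
elim: w => // b w IH /= /andP[b0 /IH].
by case: (cf_mx w) => [[[p' p] q'] q] /=; nia.
Qed.

Lemma cont'_le_cont w : pos_word w -> (cont' w <= cont w)%N.
Proof.
move=> /cont'_le; rewrite /cont /cont'.
by case: (cf_mx w) => [[[p' p] q'] q] /= /andP[].
Qed.

Lemma cont_rcons w b : cont (rcons w b) = (cont' w + b * cont w)%N /\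
  (cf_mx (rcons w b)).1.1.2 = ((cf_mx w).1.1.1 + b * (cf_mx w).1.1.2)%N.
Proof.
rewrite /cont /cont'; elim: w => [|a w [IH1 IH2]] /=; first by rewrite !add0n !muln1 muln0.
move: IH1 IH2; case: (cf_mx (rcons w b)) => [[[p'1 p1] q'1] q1] /=.
by case: (cf_mx w) => [[[p' p] q'] q] /= -> ->; split; ring.
Qed.

Lemma cont_rcons_le w b : pos_word w -> (0 < b)%N ->
  (cont (rcons w b) <= 2 * cont w * b)%N.
Proof.
by move=> /cont'_le_cont w0 b0; rewrite (cont_rcons w b).1; nia.
Qed.

(** Two further digits at least double q, since q(abw) >= q(w) + q(bw) >= 2 q(w). The predecessor
    allows for a single digit 1, where q = 1. *)
Lemma cont_ge w : pos_word w -> (2 ^ (size w).-1 <= cont w ^ 2)%N.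
Proof.
have [n] := ubnP (size w); elim: n w => // n IH [|a [|b w]] //=.
  by move=> _ /andP[a0 _]; rewrite /cont /= add0n muln1 expn_gt0 a0.
rewrite ltnS => wn /andP[a0 /andP[b0 w0]].
have := cont_cons_le b w; have := cont_gt0 w0.
have := IH (w) (ltnW wn) w0; rewrite cont_cons2.
case: w wn w0 => [|c w] wn w0 /=.
  by rewrite /cont /= !add0n !muln1 => _ _ _; nia.
rewrite (expnS 2 (size w).+1) (expnS 2 (size w)) -!mulnn;
  move: (2 ^ size w)%N (cont (c :: w)) (cont (b :: c :: w)) => P k K.
move=> Pk k0 bk.
have h : (2 * k <= k + a * K)%N by nia.
by apply: leq_trans (leq_mul h h); nia.
Qed.

Lemma cf_word_mx w x : pos_word w -> 0 <= x ->
  let: (p', p, q', q) := cf_mx w in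
  cf_word w x = (p'%:R * x + p%:R) / (q'%:R * x + q%:R) /\ 0 < q'%:R * x + q%:R.
Proof.
move=> w0 x0; elim: w w0 => [_|b w IH /= /andP[b0 /[dup] w0 /IH]] /=.
  by rewrite mul1r mul0r addr0 add0r divr1.
have := cont_gt0 w0; rewrite /cont.
case: (cf_mx w) => [[[p' p] q'] q] /= q0 [-> d0].
have d1 : 0 < (p' + b * q')%N%:R * x + (p + b * q)%N%:R.
  by rewrite ltr_wpDl // ?mulr_ge0 // ltr0n addn_gt0 muln_gt0 b0 q0 orbT.
split=> //; rewrite /cf_map.
have d2 : (p'%:R * x + p%:R) / (q'%:R * x + q%:R) + b%:R =
   ((p' + b * q')%N%:R * x + (p + b * q)%N%:R) / (q'%:R * x + q%:R).
  by rewrite !natrD !natrM; field; rewrite gt_eqF.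
by rewrite addrC d2 invfM invrK mulrC.
Qed.

Lemma cf_mx_det w :
  let: (p', p, q', q) := cf_mx w in
  `|p'%:R * q%:R - p%:R * q'%:R : R| = 1.
Proof.
elim: w => [|b w] /=; first by rewrite mulr1 mulr0 subr0 normr1.
case: (cf_mx w) => [[[p' p] q'] q] det; apply: (etrans _ det).
by rewrite -normrN; congr `|_|; rewrite !natrD !natrM; ring.
Qed.

Lemma cf_word_dist w x y : pos_word w -> 0 <= x -> 0 <= y ->
  `|cf_word w x - cf_word w y| =
    `|x - y| / (((cont' w)%:R * x + (cont w)%:R) * ((cont' w)%:R * y + (cont w)%:R)).
Proof.
move=> w0 x0 y0; have := cf_mx_det w; have := cf_word_mx w0 x0.
have := cf_word_mx w0 y0; rewrite /cont /cont'.
case: (cf_mx w) => [[[p' p] q'] q] /= [-> dy] [-> dx] det.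
have -> : (p'%:R * x + p%:R) / (q'%:R * x + q%:R) -
          (p'%:R * y + p%:R) / (q'%:R * y + q%:R) =
  (p'%:R * q%:R - p%:R * q'%:R) * (x - y) /
   ((q'%:R * x + q%:R) * (q'%:R * y + q%:R)).
  by field; rewrite !gt_eqF.
rewrite normrM normrM det mul1r; congr (_ * _).
by rewrite gtr0_norm // invr_gt0 mulr_gt0.
Qed.

Lemma cf_word_dist_le w x y : pos_word w -> 0 <= x -> 0 <= y ->
  `|cf_word w x - cf_word w y| <= ((cont w)%:R ^+ 2)^-1 * `|x - y|.
Proof.
move=> w0 x0 y0; rewrite cf_word_dist // mulrC ler_wpM2r //.
have q0 : (0 : R) < (cont w)%:R by rewrite ltr0n cont_gt0.
rewrite lef_pV2 ?posrE ?exprn_gt0 ?mulr_gt0 ?ltr_wpDl ?mulr_ge0 //.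
by rewrite expr2; apply: ler_pM; rewrite ?lerDr ?mulr_ge0.
Qed.

(** The factor 4 comes from q' x + q <= 2 q on [0, 1]; it is the origin of the constant 4^s in the
    word sums. *)
Lemma cf_word_dist_ge w x y : pos_word w -> 0 <= x <= 1 -> 0 <= y <= 1 ->
  (4 * (cont w)%:R ^+ 2)^-1 * `|x - y| <= `|cf_word w x - cf_word w y|.
Proof.
move=> w0 /andP[x0 x1] /andP[y0 y1]; rewrite cf_word_dist // [leRHS]mulrC ler_wpM2r //.
have q0 : (0 : R) < (cont w)%:R by rewrite ltr0n cont_gt0.
have qq : ((cont' w)%:R : R) <= (cont w)%:R by rewrite ler_nat cont'_le_cont.
have q0' : (0 : R) <= (cont' w)%:R by [].
rewrite lef_pV2 ?posrE ?(mulr_gt0, exprn_gt0) ?ltr_wpDl ?mulr_ge0 //.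
have -> : 4 * (cont w)%:R ^+ 2 = (2 * (cont w)%:R) * (2 * (cont w)%:R) :> R by ring.
by rewrite ler_pM ?addr_ge0 ?mulr_ge0 //; nra.
Qed.

Lemma cf_word_ge0 w x : 0 <= x -> 0 <= cf_word w x.
Proof. by move=> x0; elim: w => // b w IH /=; rewrite invr_ge0 addr_ge0. Qed.

Lemma cf_word_gt0 w x : 0 < x -> 0 < cf_word w x.
Proof. by move=> x0; elim: w => // b w IH /=; rewrite invr_gt0 ltr_wpDl. Qed.

Lemma cf_map_le1 (b : nat) x : (0 < b)%N -> 0 <= x -> cf_map b x <= 1.
Proof.
move=> b0 x0; rewrite /cf_map invf_le1; last by rewrite ltr_wpDr // ltr0n.
by rewrite ler_wpDr // ler1n.
Qed.

Lemma cf_map_lt1 (b : nat) x : (0 < b)%N -> 0 < x -> cf_map b x < 1.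
Proof.
move=> b0 x0; rewrite /cf_map invf_lt1; last by rewrite ltr_wpDl.
by rewrite ltr_pwDr // ler1n.
Qed.

Lemma cf_word_le1 w x : pos_word w -> 0 <= x <= 1 -> cf_word w x <= 1.
Proof.
case: w => [_ /andP[]//|b w /= /andP[b0 w0] /andP[x0 _]].
by rewrite cf_map_le1 // cf_word_ge0.
Qed.

Lemma cf_word_lt1 w x : pos_word w -> 0 < x < 1 -> cf_word w x < 1.
Proof.
case: w => [_ /andP[]//|b w /= /andP[b0 w0] /andP[x0 _]].
by rewrite cf_map_lt1 // cf_word_gt0.
Qed.

(** The digit is the integer part of the reciprocal. The open interval excludes the endpoints that
    neighbouring cylinders share. *)
Lemma cf_map_inj (a b : nat) x y : 0 < x < 1 -> 0 < y < 1 ->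
  cf_map a x = cf_map b y -> a = b /\ x = y.
Proof.
move=> x01 y01 /invr_inj e.
suff ab : a = b by split=> //; move: e; rewrite ab => /addrI.
have lem (c d : nat) u v : 0 < u < 1 -> 0 < v < 1 -> c%:R + u = d%:R + v :> R -> (c <= d)%N.
  move=> u01 v01 h; rewrite -ltnS -(ltr_nat R) -natr1; lra.
by apply/eqP; rewrite eqn_leq (lem a b x y) // (lem b a y x).
Qed.

Lemma cf_word_inj w w' x y : pos_word w -> pos_word w' -> size w = size w' ->
  0 < x < 1 -> 0 < y < 1 -> cf_word w x = cf_word w' y -> w = w' /\ x = y.
Proof.
elim: w w' => [|b w IH] [|b' w'] //= /andP[b0 w0] /andP[b0' w0'] [sw] x01 y01.
have h u v : pos_word u -> 0 < v < 1 -> 0 < cf_word u v < 1.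
  by move=> u0 /[dup] v01 /andP[v0 _]; rewrite cf_word_gt0 // cf_word_lt1.
by move=> /(cf_map_inj (h _ _ w0 x01) (h _ _ w0' y01))[-> /(IH w')[]// -> ->].
Qed.

Lemma cf_map_dist_le (b : nat) x y : (0 < b)%N -> 0 <= x -> 0 <= y ->
  `|cf_map b x - cf_map b y| <= (b%:R ^+ 2)^-1 * `|x - y|.
Proof.
move=> b0 x0 y0; have := @cf_word_dist_le [:: b] x y; rewrite /pos_word /= b0.
by move=> /(_ erefl x0 y0); rewrite /cont /= add0n muln1.
Qed.

Lemma cf_map_dist_ge (b : nat) x y : (0 < b)%N -> 0 <= x <= 1 -> 0 <= y <= 1 ->
  (4 * b%:R ^+ 2)^-1 * `|x - y| <= `|cf_map b x - cf_map b y|.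
Proof.
move=> b0 x0 y0; have := @cf_word_dist_ge [:: b] x y; rewrite /pos_word /= b0.
by move=> /(_ erefl x0 y0); rewrite /cont /= add0n muln1.
Qed.

Lemma cf_word_continuous w x : pos_word w -> 0 <= x ->
  {for x, continuous (cf_word w : R -> R)}.
Proof.
move=> + x0; elim: w => [_|b w IH /= /andP[b0 /IH cw]] /=; first exact: cvg_id.
apply: (@cvgV R R (nbhs x) _ (fun y => b%:R + cf_word w y)).
  by rewrite gt_eqF // ltr_wpDr ?cf_word_ge0 // ltr0n.
exact: (cvgD (cvg_cst (b%:R : R)) cw).
Qed.

End ContinuedFractionMaps.

(** * F as the largest set stable under removal of the first digit *)

Section SelfSimilarity.
Context {R : realType}.
Variable I : set nat.
Hypothesis I_pos : forall b, I b -> (0 < b)%N.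
Implicit Types (G : set R) (b : nat -> nat) (x y z : R).
Local Notation F := (cf_set I : set R).

Lemma cf_convergentS b n :
  cf_convergent b n.+1 = cf_map (b 0%N) (cf_convergent (fun k => b k.+1) n) :> R.
Proof. by []. Qed.

Lemma cf_convergent_word b n :
  cf_convergent b n = cf_word [seq b k | k <- iota 0 n] 0 :> R.
Proof.
elim: n b => // n IH b; rewrite cf_convergentS IH /=; congr cf_map; congr cf_word.
by rewrite (iotaDl 1) -map_comp.
Qed.

Lemma cf_convergent_itv b n : (forall k, 0 < b k)%N -> 0 <= (cf_convergent b n : R) <= 1.
Proof.
move=> b0; rewrite cf_convergent_word cf_word_ge0 // cf_word_le1 ?lexx ?ler01 //.
by apply/allP => _ /mapP[k _ ->]; exact: b0.
Qed.

Lemma cf_set_itv z : F z -> 0 < z < 1.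
Proof. by move=> [-> ->]. Qed.

Lemma rational_cf_map (b : nat) z : rational (cf_map b z) <-> rational z.
Proof.
split=> -[q _ qz].
  exists (q^-1 - b%:R) => //=.
  by rewrite rmorphB fmorphV /= ratr_nat qz /cf_map invrK addrC addKr.
by exists (b%:R + q)^-1 => //=; rewrite fmorphV rmorphD /= ratr_nat qz.
Qed.

(** The tail 1/z - b is the limit of the shifted convergents. Limits only place it in [0, 1];
    irrationality excludes the endpoints. *)
Lemma cf_set_unfold z : F z -> exists b : nat, exists z', [/\ I b, F z' & z = cf_map b z'].
Proof.
move=> [z0 z1 iz [b Ib cz]]; set z' := z^-1 - (b 0%N)%:R.
have zE : z = cf_map (b 0%N) z' by rewrite /cf_map /z' addrC subrK invrK.
have iz' : irrational z' by move=> rz'; apply: iz; rewrite zE; apply/rational_cf_map.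
have b0 k : (0 < b k)%N by exact: I_pos.
have cz' : (cf_convergent (fun k => b k.+1) n : R) @[n --> \oo] --> z'.
  have : (cf_convergent b n.+1 : R) @[n --> \oo] --> z.
    by rewrite (cvg_shiftS (cf_convergent b)).
  move=> /(cvgV (lt0r_neq0 z0)) h.
  have hh := cvgB h (cvg_cst ((b 0%N)%:R : R)).
  suff <- : (fun n => (cf_convergent b n.+1)^-1 - (b 0%N)%:R : R) =
      cf_convergent (fun k => b k.+1) by exact: hh.
  by apply/funext => n; rewrite cf_convergentS /cf_map invrK addrC addKr.
have z'01 : 0 <= z' <= 1.
  apply/andP; split.
    apply: (cvgr_to_ge cz'); apply: nearW => n.
    by have /andP[] := cf_convergent_itv n (fun k => b0 k.+1).
  apply: (cvgr_to_le cz'); apply: nearW => n.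
  by have /andP[] := cf_convergent_itv n (fun k => b0 k.+1).
exists (b 0%N), z'; split => //; split => //; last by exists (fun k => b k.+1).
- rewrite lt_neqAle; case/andP: z'01 => -> _; rewrite andbT eq_sym.
  by apply/eqP => z'0; apply: iz'; exists 0 => //=; rewrite rmorph0.
- rewrite lt_neqAle; case/andP: z'01 => _ ->; rewrite andbT.
  by apply/eqP => z'0; apply: iz'; exists 1 => //=; rewrite rmorph1.
Qed.

Lemma cf_set_map (b : nat) z : I b -> F z -> F (cf_map b z).
Proof.
move=> Ib [z0 z1 iz [c Ic cz]]; have b0 := I_pos Ib.
have d0 : b%:R + z != 0 by rewrite gt_eqF // ltr_wpDl.
split.
- by rewrite invr_gt0 ltr_wpDl.
- exact: cf_map_lt1.
- by move=> /rational_cf_map.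
exists (fun k => if k is k'.+1 then c k' else b); first by case.
rewrite -cvg_shiftS /=.
exact: (cvgV d0 (cvgD (cvg_cst (b%:R : R)) cz)).
Qed.

(* A rational point of [G] would start an infinite descent of denominators,
   since [x = m/n] and [x = 1/(b + y)] force [y = (n - b m)/m]. *)
Lemma cf_set_coind G :
  (forall x, G x -> 0 <= x <= 1) ->
  (forall x, G x -> exists (b : nat) y, [/\ I b, G y & x = cf_map b y]) -> G `<=` F.
Proof.
move=> G01 Gstep.
have G01' x : G x -> 0 < x < 1.
  have Gp y : G y -> 0 < y.
    move=> /Gstep[b [z [/I_pos b0 /G01/andP[z0 _] ->]]].
    by rewrite invr_gt0 ltr_wpDr // ltr0n.
  move=> /[dup] /Gp -> /Gstep[b [y [/I_pos b0 /Gp y0 ->]]] /=.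
  exact: cf_map_lt1.
have Girr x : G x -> irrational x.
  move=> Gx /rationalP[m [n e]].
  have n0 : (0 < n)%N.
    rewrite lt0n; apply/eqP => n0; move: e (G01' x Gx).
    by rewrite n0 invr0 mulr0 => ->; rewrite ltxx.
  have {e} : x * n%:R = m%:~R by rewrite e divfK // pnatr_eq0 -lt0n.
  have [N] := ubnP n; elim: N n m x n0 Gx => // N IH n m x n0 Gx nN e.
  have x01 := G01' x Gx.
  have n0' : (0 : R) < n%:R by rewrite ltr0n.
  have m0 : 0 < m by rewrite -(ltr0z R) -e mulr_gt0 //; case/andP: x01.
  have [k km] : exists k, m = Posz k by exists `|m|%N; rewrite gtz0_abs.
  move: m0 e; rewrite {}km => k0; rewrite -pmulrn => e.
  have kn : (k < n)%N by rewrite -(ltr_nat R) -e gtr_pMl //; case/andP: x01.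
  have [b [y [Ib Gy xE]]] := Gstep x Gx.
  apply: (IH k (n%:Z - (b * k)%N%:Z) y) => //; first by apply: leq_trans kn _; rewrite -ltnS.
  have /andP[y0 _] := G01' y Gy.
  have d0 : b%:R + y != 0 by rewrite gt_eqF // ltr_wpDl.
  rewrite mulrzBr -!pmulrn natrM -e xE /cf_map.
  by apply: (mulfI d0); field.
move=> z Gz; have [z0 z1] := andP (G01' z Gz); split; [by []|by []|exact: Girr|].
(* Dependent choice of a digit and a tail in [G]; the old digit [s.1] is not read, so the initial 0
   in [st] is a placeholder. *)
have step (s : nat * {x | G x}) : {t : nat * {x | G x} |
    I t.1 /\ sval s.2 = cf_map t.1 (sval t.2)}.
  have [b h] := cid (Gstep _ (svalP s.2)); have [y [Ib Gy e]] := cid h.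
  by exists (b, exist _ y Gy).
pose st n := iter n.+1 (fun s => sval (step s)) (0%N, exist _ z Gz).
pose b n := (st n).1; pose y n := sval (st n).2.
have Ib n : I (b n) by have [] := svalP (step (iter n (fun s => sval (step s)) (0%N,
  exist _ z Gz))).
have zy n : z = cf_word [seq b k | k <- iota 0 n.+1] (y n).
  elim: n => [|n IH]; first by have [_] := svalP (step (0%N, exist _ z Gz)).
  rewrite -addn1 iotaD map_cat /cf_word foldr_cat -/(cf_word _ _) IH; congr cf_word.
  by have [_] := svalP (step (st n)).
exists b => //; rewrite -cvg_shiftS.
apply/cvgrPdist_lt => e e0.
near=> n.
have pw : pos_word [seq b k | k <- iota 0 n.+1].
  by apply/allP => _ /mapP[k _ ->]; exact: I_pos.
have /andP[y0 y1] := G01' (y n) (svalP (st n).2).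
change (is_true (`|z - cf_convergent b n.+1| < e)); rewrite cf_convergent_word {1}(zy n).
apply: le_lt_trans (cf_word_dist_le pw (ltW y0) (lexx 0)) _.
rewrite subr0 gtr0_norm //.
apply: (@le_lt_trans _ _ (2 ^+ n)^-1); last first.
  rewrite -[ltLHS]mul1r; near: n; exact: near_infty_natSinv_expn_lt (PosNum e0).
have c0 : (0 : R) < (cont [seq b k | k <- iota 0 n.+1])%:R by rewrite ltr0n cont_gt0.
rewrite -[leRHS]mulr1; apply: ler_pM; rewrite ?invr_ge0 ?exprn_ge0 //.
- exact: ltW.
- rewrite lef_pV2 ?posrE ?exprn_gt0 // -!natrX ler_nat.
  by have := cont_ge pw; rewrite size_map size_iota.
- exact: ltW.
Unshelve. all: by end_near. Qed.

End SelfSimilarity.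

(** * Hausdorff dimension *)

Section Hausdorff.
Context {R : realType}.
Implicit Types (E U : set R) (s t r : R).

Lemma diameter_ge0 U : (0 <= diameter U)%E.
Proof. by apply: ereal_sup_ubound; left. Qed.

Lemma diameter_le U (D : R) : 0 <= D -> (forall x y, U x -> U y -> `|x - y| <= D) ->
  (diameter U <= D%:E)%E.
Proof.
move=> D0 h; apply: ge_ereal_sup => _ [->|[[x y] /= [Ux Uy] <-]]; rewrite lee_fin //.
exact: h.
Qed.

Lemma diameterP U x y : U x -> U y -> (`|x - y|%:E <= diameter U)%E.
Proof. by move=> Ux Uy; apply: ereal_sup_ubound; right; exists (x, y). Qed.

Lemma hausdorff_gauge_ge0 s U : (0 <= hausdorff_gauge s U)%E.
Proof. by rewrite /hausdorff_gauge; case: ifP => // _; exact: poweR_ge0. Qed.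

Lemma hausdorff_premeasure_ge0 s d E : (0 <= hausdorff_premeasure s d E)%E.
Proof.
apply: le_ereal_inf_tmp => _ [U _ <-]; apply: nneseries_ge0 => i _ _.
exact: hausdorff_gauge_ge0.
Qed.

Lemma hausdorff_premeasure_coverable s d r N E : 0 < r -> 0 < s -> 2 * r <= d ->
  coverable E r N -> (hausdorff_premeasure s d E <= (N * (2 * r) `^ s)%:E)%E.
Proof.
move=> r0 s0 rd [l lN hl].
pose U i := if (i < size l)%N then ball (nth 0 l i) r else set0.
have dU i : (diameter (U i) <= (2 * r)%:E)%E.
  apply: diameter_le; first by rewrite mulr_ge0 // ltW.
  move=> x y; rewrite /U; case: ifP => // _.
  rewrite /ball /= => cx cy; have := ler_distD (nth 0 l i) x y.
  by rewrite (distrC x (nth 0 l i)); lra.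
apply: (@le_trans _ _ (\sum_(i <oo) hausdorff_gauge s (U i))%E).
  apply: ereal_inf_lbound; exists U => //; split=> [x Ex|i]; last first.
    by apply: le_trans (dU i) _; rewrite lee_fin.
  have [c cl xc] := hl x Ex; exists (index c l) => //.
  by rewrite /U index_mem cl /ball /= nth_index.
apply: lime_le; first by apply: is_cvg_nneseries => i _ _; exact: hausdorff_gauge_ge0.
apply: nearW => n.
have g0 : 0 <= (2 * r) `^ s by exact: powR_ge0.
apply: (@le_trans _ _ ((minn n (size l))%:R * (2 * r) `^ s)%:E); last first.
  rewrite lee_fin ler_wpM2r //; apply: le_trans lN.
  by rewrite ler_nat geq_minr.
elim: n => [|n IH]; first by rewrite big_geq // min0n mul0r.
rewrite big_nat_recr //=; apply: le_trans (leeD IH (lexx _)) _.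
rewrite /hausdorff_gauge; case: eqP => [_|U0].
  by rewrite adde0 lee_fin ler_wpM2r // ler_nat; lia.
have nl : (n < size l)%N by apply: contra_notT U0 => /negbTE nl; rewrite /U nl.
apply: (@le_trans _ _ (((minn n (size l))%:R * (2 * r) `^ s)%:E + ((2 * r) `^ s)%:E)%E).
  apply: leeD => //; rewrite -poweR_EFin.
  by apply: gt0_ler_poweR; rewrite ?in_itv /= ?leey ?andbT ?diameter_ge0 ?lee_fin ?mulr_ge0 //
    ltW.
rewrite -EFinD lee_fin (minn_idPl (ltnW nl)) (minn_idPl nl).
by rewrite -[n.+1%:R]natr1 (mulrDl n%:R 1) mul1r.
Qed.

Lemma hausdorff_dim_le s E : 0 <= s ->
  (forall d e, 0 < d -> 0 < e -> (hausdorff_premeasure s d E <= e%:E)%E) ->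
  (hausdorff_dim E <= s%:E)%E.
Proof.
move=> s0 h; apply: ereal_inf_lbound; exists s => //; split=> //.
apply/eqP; rewrite eq_le; apply/andP; split.
  apply: ge_ereal_sup => _ [d d0 <-]; apply/lee_addgt0Pr => e e0.
  by rewrite add0e; exact: h.
apply: le_trans (hausdorff_premeasure_ge0 s 1 E) _.
by apply: ereal_sup_ubound; exists 1 => //=.
Qed.

Lemma coverable_lower E h t : hausdorff_dim E = h%:E -> 0 < t -> t < h ->
  exists2 c : R, 0 < c & forall r N, 0 < r -> r <= 1 -> coverable E r N ->
    c * r `^ (- t) <= N.
Proof.
move=> hE t0 th; apply: contrapT => hc.
pose t' := (t + h) / 2.
have tt' : t < t' by rewrite /t'; lra.
suff : (hausdorff_dim E <= t'%:E)%E by rewrite hE lee_fin /t'; lra.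
have t'0 : 0 < t' by exact: lt_trans tt'.
apply: hausdorff_dim_le; first exact: ltW.
move=> d e d0 e0.
(* The first entry forces r < d / 2 as soon as N >= 1, because then 1 < c r^(-t); the second brings
   the sum of the gauges below e. *)
pose c := Num.min ((d / 2) `^ t) (e / 2 `^ t').
have c0 : 0 < c by rewrite lt_min powR_gt0 ?divr_gt0 ?powR_gt0.
have : exists r N, [/\ 0 < r, r <= 1, coverable E r N & N < c * r `^ (-t)].
  apply: contrapT => hn; apply: hc; exists c => // r N r0 r1 cN.
  by rewrite leNgt; apply/negP => Nc; apply: hn; exists r, N.
move=> [r [N [r0 r1 cN Nc]]].
have [N1|N1] := ltP N 1.
  apply: le_trans (hausdorff_premeasure_coverable (r := d / 2) (N := 0) _ t'0 _ _) _.
  - lra.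
  - lra.
  (* N < 1 means that the list of centres is empty, hence so is [E]. *)
  - have [l lN hl] := cN; exists [::] => // x /hl[y]; move: lN; case: l {hl} => //= a l.
    by move=> /le_lt_trans/(_ N1); rewrite ltrn1.
  - by rewrite mul0r lee_fin ltW.
have rd : r < d / 2.
  rewrite ltNge; apply/negP => dr.
  have : (d / 2) `^ t <= r `^ t.
    by apply: ge0_ler_powR => //; rewrite ?nnegrE; lra.
  apply/negP; rewrite -ltNge.
  have : 1 < c * r `^ (- t) by exact: le_lt_trans N1 Nc.
  rewrite powRN ltr_pdivlMr ?powR_gt0 // mul1r => /lt_le_trans; apply.
  by rewrite /c ge_min lexx.
apply: le_trans (hausdorff_premeasure_coverable r0 t'0 _ cN) _; first by lra.
rewrite lee_fin powRM ?(ltW r0) //.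
apply: (@le_trans _ _ (c * r `^ (- t) * (2 `^ t' * r `^ t'))).
  by rewrite ler_wpM2r ?mulr_ge0 ?powR_ge0 // ltW.
rewrite (_ : _ * _ * _ = (c * 2 `^ t') * (r `^ (-t) * r `^ t')); last by ring.
rewrite -powRD; last by rewrite (gt_eqF r0) implybT.
have ce : c * 2 `^ t' <= e by rewrite -ler_pdivlMr ?powR_gt0 // /c ge_min lexx orbT.
have r1' : r `^ (- t + t') <= 1.
  rewrite -[leRHS](powRr0 r); apply: ger_powR; rewrite ?r0 //; lra.
rewrite -[leRHS]mulr1; apply: ler_pM => //; last exact: powR_ge0.
by rewrite mulr_ge0 ?powR_ge0 // ltW.
Qed.

End Hausdorff.

Lemma compact_nondecreasing_cover (T : ptopologicalType) (A : set T) (O : nat -> set T) :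
  compact A -> (forall k, open (O k)) -> (forall j k, (j <= k)%N -> O j `<=` O k) ->
  A `<=` \bigcup_k O k -> exists k, A `<=` O k.
Proof.
rewrite compact_cover => cA oO nO /(cA _ setT O (fun k _ => oO k))[D _ AD].
exists (\max_(k <- finmap.enum_fset D) k)%N => x /AD[k kD Okx]; apply: (nO k) => //.
by rewrite (big_rem k kD) /= leq_maxl.
Qed.

Lemma powRV (R : realType) (x s : R) : 0 <= x -> x^-1 `^ s = (x `^ s)^-1.
Proof. by move=> x0; rewrite -(powR_inv1 x0) -powRrM mulN1r powRN. Qed.

(** * Mass distribution on the limit set of a finite family of words of one length *)

Section MassDistribution.
Context {R : realType}.
Implicit Types (V : set R) (w : seq nat) (x y z s : R).

Definition wt w : R := ((cont w)%:R ^+ 2)^-1.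

Lemma wt_gt0 w : pos_word w -> 0 < wt w.
Proof. by move=> w0; rewrite invr_gt0 exprn_gt0 // ltr0n cont_gt0. Qed.

Variables (W : seq (seq nat)) (n M : nat) (s : R).
Hypothesis W_uniq : uniq W.
Hypothesis W_size : forall w, w \in W -> size w = n.+1.
Hypothesis W_digits : forall w b, w \in W -> b \in w -> (0 < b <= M)%N.
Hypothesis M_gt0 : (0 < M)%N.
Hypothesis s0 : 0 < s.
Let Z := \sum_(w <- W) wt w `^ s.
Hypothesis Z_big : 4 `^ s <= Z.

Let W_pos w : w \in W -> pos_word w.
Proof. by move=> wW; apply/allP => b /(W_digits wW)/andP[]. Qed.

(** [core] is an interval that every digit in 1..M maps into itself and that stays away from 0 and
    1; so the images of [core] under distinct words of one length are at positive distance. *)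
Let a : R := (M.+1%:R)^-1.
Let core := `[a, (1 + a)^-1]%classic.

Let a0 : 0 < a. Proof. by rewrite invr_gt0. Qed.

Let core01 x : core x -> 0 < x < 1.
Proof.
rewrite /core /= in_itv /= => /andP[ax xa]; rewrite (lt_le_trans a0) //=.
by apply: le_lt_trans xa _; rewrite invf_lt1 ?addr_gt0 // ltrDl.
Qed.

Let core01W x : core x -> 0 <= x <= 1.
Proof. by move=> /core01/andP[x0 x1]; rewrite !ltW. Qed.

Let core_map (b : nat) x : (0 < b <= M)%N -> core x -> core (cf_map b x).
Proof.
move=> /andP[b0 bM] /[dup] /core01/andP[x0 x1]; rewrite /core /= !in_itv /= => /andP[ax _].
have b1 : (1 : R) <= b%:R by rewrite ler1n.
have bM' : (b%:R : R) <= M%:R by rewrite ler_nat.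
have a1 := a0; apply/andP; split; rewrite /cf_map.
  by rewrite /a lef_pV2 ?posrE // -?natr1; lra.
by rewrite lef_pV2 ?posrE; lra.
Qed.

Let core_word w x : (forall b, b \in w -> (0 < b <= M)%N) -> core x -> core (cf_word w x).
Proof.
elim: w => //= b w IH wM cx; apply: core_map; first by apply: wM; rewrite mem_head.
by apply: IH => // c cw; apply: wM; rewrite inE cw orbT.
Qed.

Lemma core_separated m : exists2 d : R, 0 < d &
  forall w w' x y, size w = m -> size w' = m ->
   (forall b, b \in w -> (0 < b <= M)%N) -> (forall b, b \in w' -> (0 < b <= M)%N) ->
   core x -> core y -> `|cf_word w x - cf_word w' y| < d -> w = w'.
Proof.
elim: m => [|m [d d0 IH]].
  by exists 1 => // w w' x y /size0nil -> /size0nil ->.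
have e0 : 0 < 1 + a - (1 + a)^-1.
  have : (1 + a)^-1 < 1 by rewrite invf_lt1 ?addr_gt0 // ltrDl.
  by move: a0; lra.
have M0 : 0 < M.+1%:R ^+ 2 :> R by rewrite exprn_gt0.
(* The first entry treats distinct first digits: the values b + u and b' + v differ by at least 1
   minus the length of [core], and their product is at most (M + 1)^2. The second treats equal first
   digits, where the distance shrinks at most by the factor 4 (M + 1)^2. *)
exists (Num.min ((1 + a - (1 + a)^-1) / M.+1%:R ^+ 2) (d / (4 * M.+1%:R ^+ 2))).
  by rewrite lt_min !divr_gt0 // mulr_gt0.
move=> [|b w] [|b' w'] //= x y [sw] [sw'] wM wM' cx cy; rewrite lt_min => /andP[h1 h2].
have wM1 c : c \in w -> (0 < c <= M)%N by move=> cw; apply: wM; rewrite inE cw orbT.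
have wM1' c : c \in w' -> (0 < c <= M)%N by move=> cw; apply: wM'; rewrite inE cw orbT.
have /andP[b0 bM] := wM b (mem_head _ _); have /andP[b0' bM'] := wM' b' (mem_head _ _).
move: (core_word wM1 cx) (core_word wM1' cy) h1 h2.
set u := cf_word w x; set v := cf_word w' y => cu cv h1 h2.
have [bb'|bb'] := eqVneq b b'; last first.
  exfalso; move: h1; apply/negP; rewrite -leNgt.
  have /andP[u0 u1] := core01 cu; have /andP[v0 v1] := core01 cv.
  have bR : 1 <= (b%:R : R) <= M%:R by apply/andP; rewrite ler1n (ler_nat R b M).
  have bR' : 1 <= (b'%:R : R) <= M%:R by apply/andP; rewrite ler1n (ler_nat R b' M).
  have -> : cf_map b u - cf_map b' v = ((b'%:R - b%:R) + (v - u)) / ((b%:R + u) * (b'%:R + v)).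
    by rewrite /cf_map; field; rewrite !gt_eqF //; lra.
  rewrite normrM; apply: ler_pM; [exact: ltW|by rewrite invr_ge0 ltW|..].
    have h : 1 <= `|b'%:R - b%:R| :> R.
      have : (1 : R) <= `|b'%:Z - b%:Z|%:~R
        by rewrite ler1z -gtz0_ge1 normr_gt0 subr_eq0 eq_sym eqz_nat.
      by rewrite intr_norm rmorphB /= -!pmulrn.
    have := ler_normB (b'%:R - b%:R + (v - u)) (v - u); rewrite addrK.
    have : `|v - u| <= (1 + a)^-1 - a.
      move: cu cv; rewrite /core /= !in_itv /= => /andP[? ?] /andP[? ?].
      by rewrite ler_norml; apply/andP; split; lra.
    by lra.
  rewrite ger0_norm ?invr_ge0 ?mulr_ge0 //; try lra.
  rewrite lef_pV2 ?posrE // -?natr1; first by rewrite expr2 ler_pM //; lra.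
  by apply: mulr_gt0; lra.
rewrite -bb' in h2 *; congr (_ :: _).
apply: (IH w w' x y) => //; rewrite -/u -/v.
have h := cf_map_dist_ge b0 (core01W cu) (core01W cv).
have b2 : 0 < 4 * b%:R ^+ 2 :> R by rewrite mulr_gt0 // exprn_gt0 // ltr0n.
apply: (@lt_le_trans _ _ (d / (4 * M.+1%:R ^+ 2) * (4 * b%:R ^+ 2))).
  by rewrite -ltr_pdivrMr // mulrC; exact: le_lt_trans h h2.
rewrite mulrAC ler_pdivrMr ?mulr_gt0 //; apply: ler_wpM2l; first exact: ltW.
apply: ler_wpM2l => //; rewrite -!natrX ler_nat leq_exp2r //.
exact: leqW.
Qed.

Let core_a : core a.
Proof.
have a2 : 2 <= a^-1 by rewrite /a invrK ler_nat.
rewrite /core /= in_itv /= lexx /= -[leLHS]invrK lef_pV2 ?posrE ?invr_gt0 ?addr_gt0 //.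
have : a <= 1 by rewrite /a invf_le1 // ler1n.
by lra.
Qed.

Let Z0 : 0 < Z.
Proof. by apply: lt_le_trans Z_big; exact: powR_gt0. Qed.

(** The k-th iterate, starting from the Dirac mass at [a], of the operator whose fixed point is the
    self-similar measure with weights [wt w] ^ s / Z. *)
Fixpoint mass k V : R :=
  if k is k'.+1 then
    \sum_(w <- W) wt w `^ s / Z * mass k' (cf_word w @^-1` V)
  else `[< V a >]%:R.

Lemma mass_core k V : mass k V != 0 -> exists2 x, core x & V x.
Proof.
elim: k V => [|k IH] V /=.
  by case: asboolP => [Va _|]; [exists a|rewrite eqxx].
move=> h; have [w wW mw] : exists2 w, w \in W & mass k (cf_word w @^-1` V) != 0.
  apply: contrapT => hn; move/eqP: h; apply.
  rewrite big_seq; apply: big1 => w wW; have [->|mw] := eqVneq (mass k (cf_word w @^-1` V)) 0.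
    by rewrite mulr0.
  by case: hn; exists w.
have [x cx Vx] := IH _ mw; exists (cf_word w x) => //.
by apply: core_word => // b; exact: W_digits.
Qed.

Lemma mass_full k : mass k setT = 1.
Proof.
elim: k => [|k IH] /=; first by case: asboolP.
under eq_bigr => w _ do rewrite preimage_setT IH mulr1.
by rewrite -mulr_suml divff // gt_eqF.
Qed.

Lemma mass_union (l : seq nat) (U : nat -> set R) k V :
  (forall x, core x -> V x -> exists2 i, i \in l & U i x) ->
  mass k V <= \sum_(i <- l) mass k (U i).
Proof.
elim: k V U => [|k IH] V U h /=.
  case: asboolP => [/(h _ core_a)[i il Ui]|_]; last by rewrite sumr_ge0.
  by rewrite (big_rem i il) /= asboolT // lerDl sumr_ge0.
rewrite exchange_big /= big_seq [leRHS]big_seq; apply: ler_sum => w wW.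
rewrite -mulr_sumr ler_wpM2l ?divr_ge0 ?powR_ge0 ?(ltW Z0) //.
by apply: IH => x cx Vx; apply: h => //; apply: core_word => // b; exact: W_digits.
Qed.

Lemma mass_mono k V V' : V `<=` V' -> mass k V <= mass k V'.
Proof.
move=> VV'; have := @mass_union [:: 0%N] (fun=> V') k V; rewrite big_seq1; apply.
by move=> x _ /VV' Vx; exists 0%N.
Qed.

Lemma mass_le1 k V : mass k V <= 1.
Proof. by rewrite -(mass_full k); exact: mass_mono. Qed.

(* A set of diameter less than the separation of the first-level cylinders meets
   only one of them, and [4 ^ s <= Z] absorbs the distortion of the rescaling. *)
Lemma mass_diam : exists e C : R, [/\ 0 < e, 0 < C & forall k V d, 0 < d -> e <= 4 ^+ k * d ->
  (forall x y, core x -> core y -> V x -> V y -> `|x - y| <= d) -> mass k V <= C * d `^ s].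
Proof.
(* The measure of level k is atomic, so the bound is only asked for at scales d >= e / 4^k. *)
have [e e0 sep] := core_separated n.+1.
exists e, (e `^ (- s)); split; [by []|exact: powR_gt0|].
have large k V d : e <= d -> mass k V <= e `^ (- s) * d `^ s.
  move=> ed; apply: le_trans (mass_le1 _ _) _.
  rewrite powRN mulrC ler_pdivlMr ?powR_gt0 // mul1r.
  by apply: ge0_ler_powR => //; rewrite ?nnegrE;
    [exact: ltW|exact: ltW|exact: le_trans (ltW e0) ed].
elim=> [|k IH] V d d0 kd hV; first by apply: large; rewrite expr0 mul1r in kd.
have [ed|de] := leP e d; first exact: large.
have Cd0 : 0 <= e `^ (- s) * d `^ s by rewrite mulr_ge0 ?powR_ge0.
rewrite /=; have [[w wW mw]|nw] :=
    pselect (exists2 w, w \in W & mass k (cf_word w @^-1` V) != 0); last first.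
  rewrite big_seq big1 // => w wW; apply/eqP; rewrite mulf_eq0 orbC.
  by apply/orP; left; apply/negPn/negP => mw; apply: nw; exists w.
rewrite (big_rem w) //= big_seq big1 ?addr0 => [|w' w'W]; last first.
  have w'W' : w' \in W by exact: mem_rem w'W.
  apply/eqP; rewrite mulf_eq0 orbC; apply/orP; left.
  apply/negPn/negP => /mass_core[x' cx' Vx']; have [x cx Vx] := mass_core mw.
  suff ww' : w = w' by move: w'W; rewrite ww' mem_rem_uniqF.
  apply: (sep w w' x x') => //; [exact: W_size|exact: W_size|by move=> ?; exact: W_digits|
    by move=> ?; exact: W_digits|].
  apply: le_lt_trans de; apply: hV => //; apply: core_word => // b; exact: W_digits.
have w0 := wt_gt0 (W_pos wW).
have wt1 : wt w <= 1.
  rewrite invf_le1 ?exprn_gt0 ?ltr0n ?cont_gt0 ?W_pos //.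
  by rewrite exprn_ege1 // ler1n cont_gt0 ?W_pos.
have dd : d <= d / wt w by rewrite ler_pdivlMr // -[leRHS]mulr1 ler_wpM2l // ltW.
have wD b := @W_digits w b wW.
(* Pulling back by [w] enlarges distances by at most 4 / [wt w]; this factor 4 turns the scale
   condition for k + 1 into the one for k. *)
have h : mass k (cf_word w @^-1` V) <= e `^ (- s) * (4 * (d / wt w)) `^ s.
  apply: IH; first by rewrite mulr_gt0 // divr_gt0.
    by apply: le_trans kd _; rewrite exprSr -mulrA ler_wpM2l ?exprn_ge0 // ler_wpM2l.
  move=> x y cx cy Vx Vy; have := cf_word_dist_ge (W_pos wW) (core01W cx) (core01W cy).
  have := hV _ _ (core_word wD cx) (core_word wD cy) Vx Vy.
  move=> /[swap] /le_trans hd /hd; rewrite invfM -/(wt w) -mulrA => hh.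
  by rewrite mulrA ler_pdivlMr // mulrC; lra.
apply: le_trans (ler_wpM2l _ h) _; first by rewrite divr_ge0 ?powR_ge0 // ltW.
have dw0 : 0 <= d / wt w by rewrite ltW // divr_gt0.
rewrite (powRM _ _ dw0) // (powRM _ (ltW d0)) ?invr_ge0 ?(ltW w0) // powRV ?(ltW w0) //.
have ws0 : wt w `^ s != 0 by rewrite gt_eqF // powR_gt0.
have -> : wt w `^ s / Z * (e `^ (- s) * (4 `^ s * (d `^ s * (wt w `^ s)^-1))) =
   e `^ (- s) * d `^ s * (4 `^ s / Z) by field; rewrite ws0 gt_eqF.
by rewrite -[leRHS]mulr1 ler_wpM2l // ler_pdivrMr // mul1r.
Qed.

Fixpoint level_set k : set R :=
  if k is k'.+1 then \bigcup_(w in [set` W]) (cf_word w @` level_set k') else core.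

Lemma level_set_core k : level_set k `<=` core.
Proof.
elim: k => //= k IH _ [w wW [x /IH cx <-]].
by apply: core_word => // b; exact: W_digits.
Qed.

Lemma level_setS k : level_set k.+1 `<=` level_set k.
Proof.
elim: k => [|k IH] /=; first exact: (@level_set_core 1).
by move=> _ [w wW [x /IH kx <-]]; exists w => //; exists x.
Qed.

Lemma level_set_le j k : (j <= k)%N -> level_set k `<=` level_set j.
Proof.
by move=> /subnK<-; elim: (k - j)%N => // i IH x /level_setS/IH.
Qed.

Lemma level_set_compact k : compact (level_set k).
Proof.
elim: k => [|k IH] /=; first exact: segment_compact.
rewrite bigcup_seq big_seq; apply: bigsetU_compact => w wW.
apply: continuous_compact => //; apply: continuous_in_subspaceT => x.
by move=> /set_mem/level_set_core/core01/andP[/ltW x0 _]; exact: cf_word_continuous (W_pos wW) x0.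
Qed.

Lemma mass_level_set k V : level_set k `<=` V -> 1 <= mass k V.
Proof.
elim: k V => [|k IH] V /= h; first by rewrite asboolT //; exact: h.
apply: (@le_trans _ _ (\sum_(w <- W) wt w `^ s / Z)).
  by rewrite -mulr_suml divff // gt_eqF.
rewrite big_seq [leRHS]big_seq; apply: ler_sum => w wW.
rewrite -[leLHS]mulr1 ler_wpM2l ?divr_ge0 ?powR_ge0 ?(ltW Z0) //.
by apply: IH => x kx; apply: h; exists w => //; exists x.
Qed.

Variable I : set nat.
Hypothesis W_I : forall w b, w \in W -> b \in w -> I b.
Hypothesis I_pos : forall b, I b -> (0 < b)%N.

(** For each of the finitely many words, a point outside its part of the limit set already leaves at
    some level; the maximum of these levels shows that every limit point has a preimage in the limit
    set. *)
Lemma level_set_cf_set : \bigcap_k level_set k `<=` cf_set I.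
Proof.
set K := \bigcap_k level_set k.
have Kcore x : K x -> core x by move=> /(_ 0%N Logic.I).
have K_unfold x : K x -> exists2 w, w \in W & exists2 y, K y & x = cf_word w y.
  move=> Kx; apply: contrapT => hn.
  have hk w : exists k, w \in W -> ~ (cf_word w @` level_set k) x.
    have [wW|/negP wW] := boolP (w \in W); last by exists 0%N.
    apply: contrapT => hw; apply: hn; exists w => //.
    (* A word has at most one preimage of x, so the preimage found at level 0 lies in all levels. *)
    have ex k : exists2 y, level_set k y & cf_word w y = x.
      by apply: contrapT => hy; apply: hw; exists k => _ [y ky yx]; apply: hy; exists y.
    have [y cy yx] := ex 0%N; exists y => // k _.
    have [y' ky' y'x] := ex k.
    suff -> : y = y' by [].
    have cy' := level_set_core ky'.
    by have [] := cf_word_inj (W_pos wW) (W_pos wW) erefl (core01 cy) (core01 cy') (etrans yx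
      (esym y'x)).
  have [kk hkk] := choice hk.
  have [w wW [y ky yx]] := Kx (\max_(w <- W) kk w).+1 Logic.I.
  apply: (hkk w wW); exists y => //; apply: level_set_le ky.
  by rewrite (big_rem w) //= leq_maxl.
(* The limit set unfolds a whole word at a time, [cf_set_coind] one digit at a time; [G] adds the
   points whose current word is partly consumed. *)
pose G := [set x | exists u y, [/\ forall b, b \in u ->
  I b /\ (0 < b <= M)%N, K y & x = cf_word u y]].
apply: (@subset_trans _ G); first by move=> x Kx; exists [::], x.
apply: cf_set_coind => [//|_ [u [y [uI /Kcore cy ->]]]|_ [u [y [uI Ky ->]]]].
  by apply: core01W; apply: core_word => // b /uI[].
have step b v z : (forall c, c \in b :: v -> I c /\ (0 < c <= M)%N) -> K z ->
    exists (b' : nat) z', [/\ I b', G z' & cf_word (b :: v) z = cf_map b' z'].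
  move=> vI Kz; exists b, (cf_word v z); split=> //; first by have [] := vI b (mem_head _ _).
  by exists v, z; split=> // c cv; apply: vI; rewrite inE cv orbT.
case: u uI => [|b u] uI; last exact: step.
have [w wW [z Kz ->]] := K_unfold y Ky.
have := W_size wW; case: w wW => // b w wW _; apply: step => // c cw.
by split; [exact: W_I cw|exact: W_digits cw].
Qed.

(** A cover of small t-gauge is thickened to open sets. Finitely many of them contain some level
    set, which has full mass at all high levels, while [mass_diam] bounds their total mass by
    1/2. *)
Lemma hausdorff_measure_neq0 t : 0 <= t -> t < s -> hausdorff_measure t (cf_set I : set R) <> 0%E.
Proof.
move=> t0 ts H0; have [e [C [e0 C0 hC]]] := mass_diam.
(* Chosen so that C 2^s (eps + eps) = 1/2. *)
pose eps : R := (C * 2 `^ s * 4)^-1.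
have s2 : 0 < 2 `^ s :> R by exact: powR_gt0.
have eps0 : 0 < eps by rewrite invr_gt0 !mulr_gt0.
have [U [FU dU] Ueps] : exists2 U : nat -> set R, cf_set I `<=` \bigcup_i U i /\
    (forall i, (diameter (U i) <= 1%:E)%E) & (\sum_(i <oo) hausdorff_gauge t (U i) < eps%:E)%E.
  have : (hausdorff_premeasure t 1 (cf_set I) < eps%:E)%E.
    apply: le_lt_trans (_ : (_ <= 0)%E) _; last by rewrite lte_fin.
    by rewrite -H0; apply: ereal_sup_ubound; exists 1 => //=.
  by move=> /ereal_inf_lt[_ [U [FU dU] <-]] h; exists U.
have gauge_fin i : hausdorff_gauge t (U i) \is a fin_num.
  rewrite /hausdorff_gauge; case: ifP => // _; apply: fin_num_poweR.
  rewrite ge0_fin_numE ?diameter_ge0 //; exact: le_lt_trans (dU i) (ltry _).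
pose g i := fine (hausdorff_gauge t (U i)).
have gE i : hausdorff_gauge t (U i) = (g i)%:E by rewrite fineK.
have g0 i : 0 <= g i by rewrite -lee_fin -gE hausdorff_gauge_ge0.
pose d i := fine (diameter (U i)).
have dE i : diameter (U i) = (d i)%:E.
  rewrite fineK // ge0_fin_numE ?diameter_ge0 //; exact: le_lt_trans (dU i) (ltry _).
have d0 i : 0 <= d i by rewrite -lee_fin -dE diameter_ge0.
have d1 i : d i <= 1 by rewrite -lee_fin -dE.
(* Diameters are at most 1, so the exponent t may be raised to s. *)
have gd i : U i !=set0 -> d i `^ s <= g i.
  move=> /set0P U0; rewrite -lee_fin -gE /hausdorff_gauge (negbTE U0) dE poweR_EFin lee_fin.
  have [->|dn0] := eqVneq (d i) 0; first by rewrite powR0 ?powR_ge0 // gt_eqF.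
  by apply: ger_powR; [rewrite d1 andbT lt_neqAle eq_sym dn0 d0|exact: ltW].
(* Positive radii with (2 eta)^s = eps / 2^(i+1), so that thickening adds less than eps in total and
   even singletons acquire a positive scale. *)
pose eta i : R := (eps / 2 ^+ i.+1) `^ s^-1 / 2.
have eta0 i : 0 < eta i by rewrite divr_gt0 ?powR_gt0 ?divr_gt0 ?exprn_gt0.
have etas i : (2 * eta i) `^ s = eps / 2 ^+ i.+1.
  rewrite /eta mulrC divfK // -powRrM mulVf ?gt_eqF // powRr1 //.
  by rewrite divr_ge0 ?exprn_ge0 // ltW.
pose V i : set R := \bigcup_(x in U i) ball x (eta i).
(* These open sets increase and exhaust [core]: a point in all level sets belongs to F, hence to
   some [U i]. *)
pose O k := ~` level_set k `|` \bigcup_(i in `I_k) V i.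
have [k Ok] : exists k, core `<=` O k.
  apply: compact_nondecreasing_cover; first exact: segment_compact.
  - move=> k; apply: openU.
      by apply: closed_openC; apply: compact_closed => //; exact: level_set_compact.
    by apply: bigcup_open => i _; apply: bigcup_open => x _; exact: ball_open.
  - move=> j k jk x [nx|[i ij Vx]]; [left => /(level_set_le jk)//|right].
    by exists i => //; exact: leq_trans jk.
  - move=> x cx; have [/level_set_cf_set/FU[i _ Ux]|] := pselect ((\bigcap_k level_set k) x).
      exists i.+1 => //; right; exists i; first exact: ltnSn.
      by exists x => //; exact: ballxx.
    by move=> /existsNP[k /not_implyP[_ nk]]; exists k => //; left.
pose D i := d i + 2 * eta i.
have D0 i : 0 < D i by rewrite ltr_wpDl // mulr_gt0.
(* A level high enough for [mass_diam] to apply to each of the k thickened sets. *)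
have [j kj Dj] : exists2 j, (k <= j)%N & forall i, (i < k)%N -> e <= 4 ^+ j * D i.
  pose jj i := (Num.truncn (e / D i)).+1.
  exists (maxn k (\max_(i < k) jj i)) => [|i ik]; first exact: leq_maxl.
  rewrite -ler_pdivrMr //; apply: le_trans (ltW (truncnS_gt _)) _.
  rewrite -natrX ler_nat; apply: leq_trans (leq_trans (ltnW (ltn_expl (jj i) (isT : 1 < 4)%N)) _).
    exact: leqnn.
  rewrite leq_exp2l //; apply: leq_trans (leq_maxr _ _).
  exact: (@leq_bigmax _ (fun i : 'I_k => jj i) (Ordinal ik)).
have massV i : (i < k)%N -> mass j (V i) <= C * 2 `^ s * (g i + eps / 2 ^+ i.+1).
  move=> ik; have [U0|/set0P/negP] := pselect (U i !=set0); last first.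
    rewrite negbK => /eqP U0; rewrite (_ : V i = set0); last by rewrite /V U0 bigcup_set0.
    have -> : mass j set0 = 0.
      by apply/eqP/negPn/negP => h0; have [x _ []] := mass_core h0.
    apply: mulr_ge0; first exact: mulr_ge0 (ltW C0) (ltW s2).
    by rewrite addr_ge0 ?g0 // divr_ge0 ?exprn_ge0 // ltW.
  apply: le_trans (hC j (V i) (D i) (D0 i) (Dj i ik) _) _.
    move=> x y _ _ [x' Ux xx'] [y' Uy yy'].
    have := diameterP Ux Uy; rewrite dE lee_fin => dxy.
    have := ler_distD x' x y; have := ler_distD y' x' y; rewrite (distrC x x').
    move: xx' yy'; rewrite /ball /= /D; lra.
  rewrite -mulrA ler_wpM2l ?(ltW C0) // -etas.
  apply: le_trans (_ : _ <= 2 `^ s * (d i `^ s + (2 * eta i) `^ s)) _; last first.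
    by rewrite ler_wpM2l ?powR_ge0 // lerD2r gd.
  have e2 : 0 <= 2 * eta i by rewrite mulr_ge0 // ltW.
  have di0 := d0 i.
  have sge0 := ltW s0.
  rewrite /D; have [de|ed] := leP (d i) (2 * eta i).
    apply: (@le_trans _ _ ((2 * (2 * eta i)) `^ s)).
      by apply: ge0_ler_powR => //; rewrite ?nnegrE; lra.
    by rewrite powRM // ler_wpM2l ?powR_ge0 // lerDr powR_ge0.
  apply: (@le_trans _ _ ((2 * d i) `^ s)).
    by apply: ge0_ler_powR => //; rewrite ?nnegrE; lra.
  by rewrite powRM // ler_wpM2l ?powR_ge0 // lerDl powR_ge0.
have : 1 <= mass j (\bigcup_(i in `I_k) V i).
  apply: mass_level_set => x /[dup] /level_set_core cx /(level_set_le kj) kx.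
  by have [] := Ok x cx.
apply/negP; rewrite -ltNge.
apply: le_lt_trans (mass_union (l := iota 0 k) (U := V) j _) _.
  by move=> x _ [i ik Vx]; exists i => //; rewrite mem_iota.
apply: (@le_lt_trans _ _ (C * 2 `^ s * (eps + eps))); last first.
  have -> : C * 2 `^ s * (eps + eps) = 2^-1 by rewrite /eps; field; rewrite !gt_eqF.
  by rewrite invf_lt1 // ltr1n.
apply: (@le_trans _ _ (\sum_(i <- iota 0 k) C * 2 `^ s * (g i + eps / 2 ^+ i.+1))).
  rewrite big_seq [leRHS]big_seq; apply: ler_sum => i; rewrite mem_iota => /andP[_ ik].
  exact: massV.
rewrite -mulr_sumr ler_wpM2l ?mulr_ge0 ?(ltW C0) ?(ltW s2) // big_split lerD //=.
  rewrite -lee_fin; apply: le_trans (ltW Ueps).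
  have -> : iota 0 k = index_iota 0 k by rewrite /index_iota subn0.
  rewrite -sumEFin; under eq_bigr do rewrite -gE.
  by apply: nneseries_lim_ge => i _ _; exact: hausdorff_gauge_ge0.
rewrite -mulr_sumr -[leRHS]mulr1 ler_wpM2l ?(ltW eps0) //.
suff -> : \sum_(i <- iota 0 k) (2 ^+ i.+1)^-1 = 1 - (2 ^+ k)^-1 :> R.
  by rewrite gerBl invr_ge0 exprn_ge0.
elim: (k) => [|m IH]; first by rewrite big_nil expr0 invr1 subrr.
rewrite -addn1 iotaD big_cat IH big_seq1 /= add0n addn1 exprS.
by field; rewrite expf_neq0.
Qed.

End MassDistribution.

(** * Sums over words and the counting function of I *)

Section WordSums.
Context {R : realType}.
Variables (I : set nat) (h : R).
Hypothesis I_pos : forall b, I b -> (0 < b)%N.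
Hypothesis hE : hausdorff_dim (cf_set I : set R) = h%:E.

Lemma word_sum_le (s : R) n (W : seq (seq nat)) : h < s -> uniq W ->
  (forall w, w \in W -> size w = n) -> (forall w b, w \in W -> b \in w -> I b) ->
  \sum_(w <- W) wt w `^ s <= 4 `^ s.
Proof.
move=> hs W_uniq W_size W_I.
have [t [t0 Ht] ts] : exists2 t : R, 0 <= t /\ hausdorff_measure t (cf_set I) = 0%E & t < s.
  have : (hausdorff_dim (cf_set I : set R) < s%:E)%E by rewrite hE lte_fin.
  by move=> /ereal_inf_lt[_ [t tP <-]]; rewrite lte_fin => ts; exists t.
have s0 : 0 < s by exact: le_lt_trans t0 ts.
(* Length 0 generates no limit set; there the sum has at most one term, equal to 1. *)
case: n W_size => [|n] W_size.
  have wt1 : wt [::] = 1 :> R by rewrite /wt expr1n invr1.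
  have -> : \sum_(w <- W) wt w `^ s = (size W)%:R :> R.
    rewrite big_seq (eq_bigr (fun=> 1)) => [|w wW]; last first.
      by rewrite (size0nil (W_size w wW)) wt1 powR1.
    by rewrite -big_seq big_const_seq count_predT iter_addr_0.
  have sW : (size W <= 1)%N.
    rewrite -[1%N]/(size [:: Nil nat]); apply: uniq_leq_size => // w wW.
    by rewrite inE (size0nil (W_size w wW)).
  apply: (@le_trans _ _ 1); first by rewrite lern1.
  rewrite -[leLHS](powRr0 4); apply: ler_powR; [by rewrite ler1n|exact: ltW].
rewrite leNgt; apply/negP => Zbig.
pose M := (\max_(w <- W) \max_(b <- w) b)%N.
have WM w b : w \in W -> b \in w -> (0 < b <= M)%N.
  move=> wW bw; rewrite (I_pos (W_I _ _ wW bw)) /= /M (big_rem w wW) /=.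
  by apply: leq_trans (leq_maxl _ _); rewrite (big_rem b bw) /= leq_maxl.
have M0 : (0 < M)%N.
  have [w wW] : exists w, w \in W.
    case: (W) Zbig => [|w W' _]; last by exists w; exact: mem_head.
    by rewrite big_nil ltNge powR_ge0.
  have := W_size w wW; case: w wW => // b w wW _.
  by have /andP[b0 bM] := WM _ b wW (mem_head _ _); exact: leq_trans b0 bM.
exact: (hausdorff_measure_neq0 W_uniq W_size WM M0 s0 (ltW Zbig) W_I I_pos t0 ts Ht).

Qed.

End WordSums.

(** * Digits of I in an interval *)

Section Counting.
Context {R : realType}.

Lemma nat_itv_list (a b : R) : 0 <= a -> a <= b -> exists2 l : seq nat,
  (size l)%:R <= b - a + 2 & forall n : nat, a <= n%:R <= b -> n \in l.
Proof.
move=> a0 ab; have b0 := le_trans a0 ab.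
exists (iota (Num.truncn a) (Num.truncn b - Num.truncn a).+1).
  rewrite size_iota -natr1 natrB ?le_truncn //.
  have /andP[_ h1] := truncn_itv a0; have /andP[h2 _] := truncn_itv b0.
  by move: h1 h2; rewrite -natr1; lra.
move=> n /andP[an nb]; rewrite mem_iota.
have h1 : (Num.truncn a <= n)%N by rewrite truncn_le_nat (le_lt_trans an) // ltr_nat.
have h2 : (n <= Num.truncn b)%N by rewrite truncn_ge_nat.
by rewrite h1 /= addnS ltnS subnKC // (leq_trans h1).
Qed.

Lemma powR_sub_ge (p a b : R) : 1 < p -> 0 < a -> a <= b ->
  (b - a) * a `^ (p - 1) <= b `^ p - a `^ p.
Proof.
move=> p1 a0 ab; have b0 := lt_le_trans a0 ab; have p0 : 0 < p by lra.
rewrite -(mulr_powRB1 (ltW a0) p0) -(mulr_powRB1 (ltW b0) p0) mulrBl lerD2r.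
rewrite ler_wpM2l ?(ltW b0) //; apply: ge0_ler_powR; rewrite ?nnegrE ?(ltW a0) ?(ltW b0) //; lra.
Qed.

Variables (p : R) (I : set nat).
Hypothesis p1 : 1 < p.
Hypothesis I_fin : finite_set (I `+` floor_powers p).

Let p0 : 0 < p. Proof. exact: lt_trans p1. Qed.
Let pi0 : 0 < p^-1. Proof. by rewrite invr_gt0. Qed.
Let pi1 : p^-1 < 1. Proof. by rewrite invf_lt1. Qed.

Lemma floor_powers_cases : exists D : seq nat,
  (forall b, I b -> b \in D \/ exists2 n, (0 < n)%N & b%:Z = Num.floor (n%:R `^ p)) /\
  (forall b, b \notin D -> I b <-> floor_powers p b).
Proof.
have [D DE] := (finite_seqP _).1 I_fin.
have inD b : (I b /\ ~ floor_powers p b) \/ (floor_powers p b /\ ~ I b) -> b \in D.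
  move=> hb; have : [set` D] b by rewrite -DE; case: hb => -[h1 h2]; [left|right].
  by [].
exists D; split=> [b Ib|b /negP bD].
  have [[n n0 e]|nb] := pselect (floor_powers p b); first by right; exists n.
  by left; apply: inD; left.
split=> h; apply: contrapT => h'; apply: bD; apply: inD; [by left|by right].
Qed.

Let floor_root (b n : nat) : b%:Z = Num.floor (n%:R `^ p) ->
  b%:R `^ p^-1 <= (n%:R : R) /\ (n%:R : R) <= b.+1%:R `^ p^-1.
Proof.
move=> bn; have /andP[h1 h2] : (b%:R : R) <= n%:R `^ p < b.+1%:R.
  have := floor_itv (n%:R `^ p : R); rewrite -bn rmorphD /= -!pmulrn.
  by rewrite mulr1n natr1.
have root x : 0 <= x -> (x `^ p) `^ p^-1 = x :> R.
  by move=> x0; rewrite -powRrM mulfV ?gt_eqF // powRr1.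
by split; rewrite -[n%:R]root //; apply: ge0_ler_powR; rewrite ?nnegrE ?powR_ge0 // ltW.
Qed.

Lemma count_le : exists2 C : R, 0 < C & forall B, 1 <= B -> exists2 l : seq nat,
  (size l)%:R <= C * B `^ p^-1 & forall b, I b -> b%:R <= B -> b \in l.
Proof.
have [D [hD _]] := floor_powers_cases.
exists ((size D)%:R + 4) => [|B B1]; first by rewrite ltr_wpDl.
have B0 : 0 <= B by lra.
have [l lS hl] := nat_itv_list (lexx 0) (powR_ge0 (B + 1) p^-1).
exists (D ++ [seq `|Num.floor ((n%:R : R) `^ p)|%N | n <- l]).
  rewrite size_cat size_map natrD mulrDl.
  have B1' : 1 <= B `^ p^-1 by rewrite -[leLHS](powRr0 B); apply: ler_powR => //; exact: ltW.
  rewrite lerD // ?ler_peMr //; apply: le_trans lS _.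
  have : (B + 1) `^ p^-1 <= (2 * B) `^ p^-1.
    by apply: ge0_ler_powR; rewrite ?nnegrE ?(ltW pi0) //; lra.
  rewrite powRM //; have : 2 `^ p^-1 <= 2 :> R.
    by apply: ler1_powR; [lra|exact: ltW].
  by nra.
move=> b Ib bB; rewrite mem_cat; case: (hD b Ib) => [->//|[n n0 bn]].
apply/orP; right; apply/mapP; exists n; last by rewrite -bn.
apply: hl; rewrite ler0n /=; have [_ h] := floor_root bn.
apply: le_trans h _; rewrite -natr1.
by apply: ge0_ler_powR; rewrite ?nnegrE ?(ltW pi0) //; lra.
Qed.

(** Apart from the finite exceptional list [D], the digits come from integers n between B^(1/p) and
    (B + L + 1)^(1/p), an interval of length at most (L + 1) B^(1/p-1). *)
Lemma count_itv : exists2 C : R, 0 < C & forall B L, 1 <= B -> 0 <= L -> exists2 l : seq nat,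
  (size l)%:R <= C * (1 + L * B `^ (p^-1 - 1)) & forall b, I b -> B <= b%:R <= B + L -> b \in l.
Proof.
have [D [hD _]] := floor_powers_cases.
exists ((size D)%:R + 3) => [|B L B1 L0]; first by rewrite ltr_wpDl.
have B0 : 0 < B by lra.
pose a := B `^ p^-1; pose b := (B + L + 1) `^ p^-1.
have a0 : 0 < a by exact: powR_gt0.
have ab : a <= b.
  by apply: ge0_ler_powR; rewrite ?nnegrE ?(ltW pi0) //; lra.
have [l lS hl] := nat_itv_list (ltW a0) ab.
have BL0 : 0 <= L * B `^ (p^-1 - 1) by rewrite mulr_ge0 ?powR_ge0.
exists (D ++ [seq `|Num.floor ((n%:R : R) `^ p)|%N | n <- l]).
  rewrite size_cat size_map natrD mulrDl lerD //.
    by rewrite ler_peMr // lerDl.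
  apply: le_trans lS _.
  have root x : 0 <= x -> (x `^ p^-1) `^ p = x.
    by move=> x0; rewrite -powRrM mulVf ?gt_eqF // powRr1.
  have := powR_sub_ge p1 a0 ab; rewrite (root B) ?(root (B + L + 1)); [|lra..].
  have -> : B + L + 1 - B = L + 1 by ring.
  have aE : a `^ (p - 1) = (B `^ (p^-1 - 1))^-1.
    by rewrite -powRN /a -powRrM; congr (_ `^ _); field; rewrite gt_eqF.
  have Bp : 0 < B `^ (p^-1 - 1) by exact: powR_gt0.
  have Bp1 : B `^ (p^-1 - 1) <= 1.
    by rewrite -[leRHS](powRr0 B); apply: ler_powR => //; rewrite subr_le0 ltW.
  by rewrite aE ler_pdivrMr //; nra.
move=> c Ic /andP[Bc cB]; rewrite mem_cat; case: (hD c Ic) => [->//|[n n0 cn]].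
apply/orP; right; apply/mapP; exists n; last by rewrite -cn.
apply: hl; have [h1 h2] := floor_root cn.
have c0 : (0 : R) <= c%:R by [].
apply/andP; split.
  by apply: le_trans h1; apply: ge0_ler_powR; rewrite ?nnegrE ?(ltW pi0) //; lra.
apply: le_trans h2 _; rewrite -natr1.
by apply: ge0_ler_powR; rewrite ?nnegrE ?(ltW pi0) //; lra.
Qed.

End Counting.

(** * Coverings of F *)

Section PowR.
Context {R : realType}.
Implicit Types (x y a b c s t e r : R).

Lemma powR_le1 x a : 0 < x <= 1 -> 0 <= a -> x `^ a <= 1.
Proof. by move=> x01 a0; rewrite -[leRHS](powRr0 x); apply: ger_powR. Qed.

Lemma powR_ge1 x a : 0 < x <= 1 -> a <= 0 -> 1 <= x `^ a.
Proof. by move=> x01 a0; rewrite -[leLHS](powRr0 x); apply: ger_powR. Qed.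

Lemma powRDm x a b : 0 < x -> x `^ a * x `^ b = x `^ (a + b).
Proof. by move=> x0; rewrite powRD // (gt_eqF x0) implybT. Qed.

(** N bounds both the lengths of words with q^2 r <= 1 and, later, the indices of dyadic annuli. It
    is logarithmic in 1/r, hence below any power. *)
Lemma log_levels e : 0 < e -> exists2 C, 0 < C & forall r, 0 < r <= 1 ->
  exists2 N : nat, N.+1%:R <= C * r `^ (- e) & 1 < 2 ^+ N * r.
Proof.
move=> e0; have l2 : 0 < ln 2 :> R by rewrite ln_gt0 // ltr1n.
exists (2 + (e * ln 2)^-1) => [|r r01]; first by rewrite addr_gt0 // invr_gt0 mulr_gt0.
have /andP[r0 r1] := r01.
have re1 : 1 <= r `^ (- e) by apply: powR_ge1; lra.
have lnr : 0 <= - ln r by rewrite oppr_ge0 ln_le0.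
have x0 : 0 <= - ln r / ln 2 by rewrite divr_ge0 // ltW.
exists (Num.truncn (- ln r / ln 2)).+1.
  have /andP[h1 _] := truncn_itv x0; rewrite -natr1 -natr1.
  have h2 : e * - ln r <= r `^ (- e).
    by rewrite mulrN -mulNr -ln_powR ltW // ln_sublinear // powR_gt0.
  have h3 : - ln r / ln 2 <= (e * ln 2)^-1 * r `^ (- e).
    rewrite invfM [e^-1 / ln 2]mulrC -mulrA mulrC ler_pM2l ?invr_gt0 //.
    by rewrite ler_pdivlMl.
  have : (e * ln 2)^-1 * r `^ (- e) + 2 <= (2 + (e * ln 2)^-1) * r `^ (- e).
    by rewrite mulrDl addrC lerD2r ler_peMr.
  by lra.
have /andP[_ h1] := truncn_itv x0.
rewrite -ltr_ln ?posrE ?mulr_gt0 ?exprn_gt0 // ln1 lnM ?posrE ?exprn_gt0 // lnXn //.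
by move: h1; rewrite ltr_pdivrMr // mulr_natl; lra.
Qed.

End PowR.

(** * Words stopped at a given scale *)

Section Levels.
Context {R : realType}.
Implicit Types (w : seq nat) (r : R).

Lemma cont_ge_digit w b : pos_word w -> b \in w -> (b <= cont w)%N.
Proof.
elim: w => //= a w IH /andP[a0 w0]; have c0 := cont_gt0 w0.
rewrite inE => /orP[/eqP->|bw]; apply: leq_trans (cont_cons_le a w).
  exact: leq_pmulr.
by apply: leq_trans (IH w0 bw) _; exact: leq_pmull.
Qed.

Lemma bounded_words n Q : exists l : seq (seq nat),
  forall w, size w = n -> all (fun b => b <= Q)%N w -> w \in l.
Proof.
elim: n => [|n [l IH]]; first by exists [:: [::]] => w /size0nil ->.
exists (allpairs cons (iota 0 Q.+1) l) => -[//|b w] [sw] bwQ.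
have /andP[bQ wQ] : (b <= Q)%N && all (fun c => c <= Q)%N w by [].
by apply/allpairsP; exists (b, w); rewrite mem_iota; split=> //; exact: IH.
Qed.

Variable I : set nat.
Hypothesis I_pos : forall b, I b -> (0 < b)%N.

Definition word_over w := forall b, b \in w -> I b.

Lemma word_over_pos w : word_over w -> pos_word w.
Proof. by move=> wI; apply/allP => b /wI/I_pos. Qed.

(** Finiteness holds because every digit is at most q(w), and q(w) <= q(w)^2 <= 1/r. *)
Lemma level_words n r : 0 < r -> exists2 W : seq (seq nat), uniq W &
  forall w, w \in W <-> [/\ size w = n, word_over w & (cont w)%:R ^+ 2 * r <= 1].
Proof.
move=> r0; have [l hl] := bounded_words n (Num.truncn r^-1).
pose P w := [/\ size w = n, word_over w & (cont w)%:R ^+ 2 * r <= 1].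
exists (undup [seq w <- l | `[< P w >]]); first exact: undup_uniq.
move=> w; rewrite mem_undup mem_filter; split=> [/andP[/asboolP//]|].
move=> Pw; rewrite asboolT //=; have [wn /word_over_pos w0 wr] := Pw.
apply: hl => //; apply/allP => b /(cont_ge_digit w0) bw.
rewrite truncn_ge_nat ?invr_ge0 ?(ltW r0) //.
have c1 : (1 : R) <= (cont w)%:R by rewrite ler1n cont_gt0.
apply: (@le_trans _ _ (cont w)%:R); first by rewrite ler_nat.
apply: (@le_trans _ _ ((cont w)%:R ^+ 2)); first by rewrite expr2 ler_peMr //; lra.
by rewrite -[leRHS]mul1r ler_pdivlMr.
Qed.

(* [w] is the part of the expansion of [z] before its convergent denominators
   first exceed [r ^ (-1/2)]. *)
Lemma stopping_word (z r : R) : cf_set I z -> 0 < r -> r <= 1 ->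
  exists w b z', [/\ word_over w, I b, cf_set I z' & z = cf_word w (cf_map b z')] /\
   ((cont w)%:R ^+ 2 * r <= 1 /\ 1 <= 4 * ((cont w)%:R ^+ 2 * r) * b%:R ^+ 2).
Proof.
move=> Fz r0 r1; apply: contrapT => hn.
have [C C0 /(_ r)[|N _ Nr]] := @log_levels R 1 ltr01; first by rewrite r0.
(* If the expansion never stopped, prefixes of every length would satisfy q^2 r <= 1, against the
   growth of q. *)
have [w [z' [wI Fz' zE wN wr]]] : exists w z', [/\ word_over w, cf_set I z', z = cf_word w z',
    size w = N.+1 & (cont w)%:R ^+ 2 * r <= 1].
  elim: (N.+1) => [|k [w [z' [wI Fz' zE wk wr]]]].
    by exists [::], z; split=> //; rewrite expr1n mul1r.
  have [b [y [Ib Fy z'E]]] := cf_set_unfold I_pos Fz'.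
  have wbI : word_over (rcons w b).
    by move=> c; rewrite mem_rcons inE => /orP[/eqP->//|/wI].
  exists (rcons w b), y; split=> //.
  - by rewrite zE z'E -cats1 /cf_word foldr_cat.
  - by rewrite size_rcons wk.
  rewrite leNgt; apply/negP => hb; apply: hn; exists w, b, y; split; first by rewrite zE z'E.
  split=> //; apply: le_trans (ltW hb) _.
  have cb : ((cont (rcons w b))%:R : R) <= 2 * (cont w)%:R * b%:R.
    rewrite -!natrM ler_nat; apply: cont_rcons_le; [exact: word_over_pos|exact: I_pos].
  rewrite (_ : 4 * _ * _ = (2 * (cont w)%:R * b%:R) ^+ 2 * r); last by ring.
  by rewrite ler_pM2r // ler_pXn2r ?nnegrE ?mulr_ge0.
move: Nr; apply/negP; rewrite -leNgt; apply: le_trans wr; rewrite ler_pM2r //.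
by rewrite -!natrX ler_nat; have := cont_ge (word_over_pos wI); rewrite wN.
Qed.

Lemma level_bound w r N : 0 < r -> 1 < 2 ^+ N * r -> pos_word w ->
  (cont w)%:R ^+ 2 * r <= 1 -> (size w <= N)%N.
Proof.
move=> r0 Nr w0 wr; rewrite leqNgt; apply/negP => Nw.
move: Nr; apply/negP; rewrite -leNgt; apply: le_trans wr; rewrite ler_pM2r //.
rewrite -!natrX ler_nat; apply: leq_trans (cont_ge w0).
by rewrite leq_exp2l //; case: (size w) Nw.
Qed.

End Levels.

Section Box.
Context {R : realType}.
Variables (I : set nat) (p h : R).
Hypothesis I_pos : forall b, I b -> (0 < b)%N.
Hypothesis hE : hausdorff_dim (cf_set I : set R) = h%:E.
Hypothesis p1 : 1 < p.
Hypothesis I_fin : finite_set (I `+` floor_powers p).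
Implicit Types (r rho s e : R) (w : seq nat).
Local Notation F := (cf_set I : set R).

Let p0 : 0 < p. Proof. exact: lt_trans p1. Qed.

(** Each admissible first-level cylinder has length at most 4 rho and costs a bounded number of
    balls. Cutting the digits at rho^(-p/(p+1)) balances their number, of order rho^(-1/(p+1)), with
    the cost of the remaining interval near 0. The radius rho / 2 prepares the doubling in
    [coverable_image]. *)
Lemma coverable_cf_map_tail : exists2 C : R, 0 < C & forall rho, 0 < rho -> rho <= 1 ->
  coverable [set y | exists b z, [/\ I b, F z, 1 <= 4 * rho * b%:R ^+ 2 & y = cf_map b z]]
    (rho / 2) (C * rho `^ (- (p + 1)^-1)).
Proof.
have [C C0 hC] := count_le p1 I_fin.
exists (C * 17 + 3) => [|rho r0 r1]; first by rewrite addr_gt0 ?mulr_gt0.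
set k := p / (p + 1).
have pp1 : 0 < p + 1 by rewrite addr_gt0.
have kE : k - 1 = - (p + 1)^-1 by rewrite /k; field; rewrite gt_eqF.
have pi0 : 0 < (p + 1)^-1 by rewrite invr_gt0; lra.
have k0 : 0 < k by rewrite divr_gt0 //; lra.
have [|l ls hl] := hC (rho `^ (- k)); first by apply: powR_ge1; [rewrite r0|lra].
have rs1 : 1 <= rho `^ (- (p + 1)^-1) by apply: powR_ge1; [rewrite r0|lra].
rewrite (mulrDl (C * 17)).
apply: (@coverable_cup _ _ [set y | exists2 b, b \in l & exists z, [/\ I b, F z,
  1 <= 4 * rho * b%:R ^+ 2 & y = cf_map b z]]
   [set y | 0 <= y <= 0 + rho `^ k]).
- move=> y [b [z [Ib Fz hb yE]]].
  have [bk|bk] := leP (b%:R : R) (rho `^ (- k)).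
    by left; exists b; [exact: hl|exists z].
  right; have /andP[z0 _] := cf_set_itv Fz.
  have b0 : (0 : R) < b%:R by rewrite ltr0n I_pos.
  rewrite yE /= add0r /cf_map invr_ge0 addr_ge0 ?(ltW z0) //=.
  rewrite -[leRHS]invrK lef_pV2 ?posrE ?invr_gt0 ?powR_gt0 ?addr_gt0 // -powRN.
  by rewrite ltW // (lt_trans bk) // ltrDl.
- rewrite -mulrA [17 * _]mulrC mulrA; apply: (@coverable_union_le _ _ l
    (fun b => [set y | exists z, [/\ I b, F z,
      1 <= 4 * rho * b%:R ^+ 2 & y = cf_map b z]])) => //.
  + apply: le_trans ls _; rewrite -powRrM.
    by rewrite (_ : - k * p^-1 = - (p + 1)^-1) // /k; field; rewrite !gt_eqF //; lra.
  move=> b bl; apply: (@coverable_le _ _ _ (2 * (4 * rho) / (rho / 2) + 1)).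
    by rewrite (_ : _ / (rho / 2) = 16); [lra|field; rewrite gt_eqF].
  apply: coverable_diam; [by rewrite divr_gt0|by rewrite mulr_ge0 // ltW|].
  move=> _ _ [x [Ib Fx hb ->]] [y [_ Fy _ ->]].
  have b0 := I_pos Ib; have b0' : (0 : R) < b%:R by rewrite ltr0n.
  have /andP[x0 x1] := cf_set_itv Fx; have /andP[y0 y1] := cf_set_itv Fy.
  apply: le_trans (cf_map_dist_le b0 (ltW x0) (ltW y0)) _.
  have xy : `|x - y| <= 1 by rewrite ler_norml; apply/andP; split; lra.
  apply: (@le_trans _ _ ((b%:R ^+ 2)^-1 * 1)); first by rewrite ler_wpM2l ?invr_ge0 ?exprn_ge0.
  by rewrite mulr1 -[leLHS]mul1r ler_pdivrMr ?exprn_gt0.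
apply: coverable_le (coverable_itv _ _ _); [|by rewrite divr_gt0|exact: powR_ge0].
rewrite (_ : rho `^ k / (rho / 2) = 2 * rho `^ (- (p + 1)^-1)); first by lra.
rewrite -kE powRB; last by rewrite (gt_eqF r0) implybT.
by rewrite powRr1 ?(ltW r0) //; field; rewrite gt_eqF.
Qed.

(** For a stopping word [w] and rho = q(w)^2 r, the tail costs C rho^(-s) = C r^(-s) [wt w] ^ s. The
    word sums bound the total for each length, and the number of lengths costs r^(-e). *)
Lemma cf_set_coverable_log s e : h < s -> (p + 1)^-1 <= s -> 0 < e ->
  exists2 C : R, 0 < C & forall r, 0 < r -> r <= 1 -> coverable F r (C * r `^ (- (s + e))).
Proof.
move=> hs ps e0; have [C C0 hC] := coverable_cf_map_tail.
have [D D0 hD] := log_levels e0.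
exists (D * (C * 4 `^ s)) => [|r r0 r1]; first by rewrite !mulr_gt0 // powR_gt0.
have [|N NC Nr] := hD r; first by rewrite r0.
pose A n := [set z | exists w b z', [/\ word_over I w, size w = n, I b,
  F z' & z = cf_word w (cf_map b z')] /\
   ((cont w)%:R ^+ 2 * r <= 1 /\ 1 <= 4 * ((cont w)%:R ^+ 2 * r) * b%:R ^+ 2)].
have Cs0 : 0 <= C * 4 `^ s * r `^ (- s) by rewrite !mulr_ge0 ?powR_ge0 ?(ltW C0).
apply: (@coverable_le _ _ _ (D * r `^ (- e) * (C * 4 `^ s * r `^ (- s)))).
  rewrite opprD -powRDm // le_eqVlt; apply/orP; left; apply/eqP; ring.
apply: (@coverable_union_le _ _ (iota 0 N.+1) A) => //.
- by rewrite size_iota.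
- move=> z Fz; have [w [b [z' [[wI Ib Fz' zE] [wr wb]]]]] := stopping_word I_pos Fz r0 r1.
  exists (size w); last by exists w, b, z'.
  rewrite mem_iota /= ltnS.
  by apply: level_bound wr => //; exact: (word_over_pos I_pos).
move=> n _; have [W uW hW] := @level_words R I I_pos n r r0.
apply: (@coverable_le _ _ _ (\sum_(w <- W) C * r `^ (- s) * wt w `^ s)).
  rewrite -mulr_sumr [leRHS]mulrAC.
  apply: ler_wpM2l; first by rewrite mulr_ge0 ?powR_ge0 // ltW.
  apply: (word_sum_le I_pos hE hs uW (n := n)); first by move=> w /hW[].
  by move=> w b /hW[_ wI _]; exact: wI.
apply: (@coverable_union _ _ W (fun w => cf_word w @` [set y | exists b z,
   [/\ I b, F z, 1 <= 4 * ((cont w)%:R ^+ 2 * r) * b%:R ^+ 2 & y = cf_map b z]])).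
  move=> _ [w [b [z' [[wI wn Ib Fz' ->] [wr wb]]]]].
  exists w; first exact/hW.
  by exists (cf_map b z') => //; exists b, z'.
move=> w /hW[wn wI wr]; have wp := word_over_pos I_pos wI.
have w0 := wt_gt0 (R := R) wp.
set rho := _ * r in wr *.
have rE : rho = r / wt w by rewrite /rho /wt invrK mulrC.
have rho0 : 0 < rho by rewrite rE divr_gt0.
have -> : r = 2 * wt w * (rho / 2) by rewrite rE; field; rewrite gt_eqF.
apply: coverable_image => //.
  move=> _ _ [b [x [Ib Fx _ ->]]] [c [y [Ic Fy _ ->]]]; apply: cf_word_dist_le => //.
    by have /andP[/ltW] := cf_set_itv (cf_set_map I_pos Ib Fx).
  by have /andP[/ltW] := cf_set_itv (cf_set_map I_pos Ic Fy).
apply: coverable_le (hC rho rho0 wr).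
rewrite (_ : 2 * wt w * (rho / 2) = r); last by rewrite rE; field; rewrite gt_eqF.
rewrite -mulrA ler_wpM2l ?(ltW C0) //.
apply: (@le_trans _ _ (rho `^ (- s))); first by apply: ger_powR; [rewrite rho0|lra].
rewrite rE powRM ?invr_ge0 ?(ltW r0) ?(ltW w0) // powRV ?(ltW w0) //.
by rewrite -powRN opprK.
Qed.

Lemma cf_set_coverable s : h < s -> (p + 1)^-1 < s ->
  exists2 C : R, 0 < C & forall r, 0 < r -> r <= 1 -> coverable F r (C * r `^ (- s)).
Proof.
move=> hs ps; pose m := Num.max h (p + 1)^-1.
have hm : h <= m by rewrite le_max lexx.
have pm : (p + 1)^-1 <= m by rewrite le_max lexx orbT.
have ms : m < s by rewrite gt_max hs.
have [|||C C0 hC] := @cf_set_coverable_log ((m + s) / 2) ((s - m) / 2); [lra..|].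
exists C => // r r0 r1; have := hC r r0 r1.
by rewrite (_ : (m + s) / 2 + (s - m) / 2 = s) //; field.
Qed.

End Box.

(** * Cylinders of one length that meet a ball *)

Section GridCount.
Context {R : realType}.

(* A cylinder of length at least [rho / 4] that meets the ball around [x] contains
   in its interior a point of the grid of mesh [rho / 16] around [x]. *)
Lemma cylinders_meeting_ball n (x rho : R) : 0 < rho -> exists2 l : seq (seq nat),
  size l = 64 & forall w u, pos_word w -> size w = n -> (cont w)%:R ^+ 2 * rho <= 1 ->
    0 < u < 1 -> `|x - cf_word w u| < rho -> w \in l.
Proof.
move=> r0; pose g (j : nat) : R := x - 2 * rho + j%:R * (rho / 16).
(* At most one word of length n has the j-th grid point inside its cylinder. The 64 points span 4
   rho, from x - 2 rho. *)
pose f j := xget [::] [set w | pos_word w /\ size w = n /\ exists2 u,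
  0 < u < 1 & cf_word w u = g j].
exists [seq f j | j <- iota 0 64]; first by rewrite size_map size_iota.
move=> w u w0 wn wr u01 xu.
suff [j [j32 [c c01 cg]]] : exists j, (j < 64)%N /\ exists2 c, 0 < c < 1 & cf_word w c = g j.
  apply/mapP; exists j; first by rewrite mem_iota.
  have : [set w | pos_word w /\ size w = n /\ exists2 u, 0 < u < 1 & cf_word w u = g j] (f j).
    by apply: xgetPex; exists w; split => //; split => //; exists c.
  move=> [f0 [fn [v v01 vg]]].
  by have [] := cf_word_inj w0 f0 (etrans wn (esym fn)) c01 v01 (etrans cg (esym vg)).
have /andP[u0 u1] := u01.
set v := cf_word w u in xu.
have dist01 : rho / 4 <= `|cf_word w 0 - cf_word w 1|.
  have q0 : (0 : R) < (cont w)%:R ^+ 2 by rewrite exprn_gt0 // ltr0n cont_gt0.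
  have z01 : 0 <= (0 : R) <= 1 by rewrite lexx ler01.
  have o01 : 0 <= (1 : R) <= 1 by rewrite lexx ler01.
  apply: le_trans (cf_word_dist_ge w0 z01 o01); rewrite sub0r normrN normr1.
  rewrite mulr1 -[leRHS]mul1r ler_pdivlMr ?(mulr_gt0 _ q0) //.
  by have -> : rho / 4 * (4 * (cont w)%:R ^+ 2) = (cont w)%:R ^+ 2 * rho by field.
have cw y : 0 <= y -> {for y, continuous (cf_word w : R -> R)} by exact: cf_word_continuous.
(* The cylinder has length at least rho / 4, so one of its ends is at distance at least rho / 8,
   that is two meshes, from v; the values in between contain a grid point. *)
have [e [e01 ee] ev] : exists2 e : R, (0 <= e <= 1) /\
  ((e = 0) \/ (e = 1)) & rho / 8 <= `|cf_word w e - v|.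
  have [h|h] := leP (rho / 8) `|cf_word w 0 - v|.
    by exists 0 => //; rewrite lexx ler01; split=> //; left.
  exists 1; first by rewrite lexx ler01; split=> //; right.
  have := ler_distD v (cf_word w 0) (cf_word w 1); rewrite (distrC v); lra.
have [a0 ab] : 0 <= Num.min u e /\ Num.min u e <= Num.max u e.
  by rewrite le_min ge_min le_max lexx (ltW u0); case/andP: e01 => ->.
have ivt y : y != cf_word w e -> Num.min v (cf_word w e) <= y <= Num.max v (cf_word w e) ->
    exists2 c, 0 < c < 1 & cf_word w c = y.
  move=> ye hy; have cont_w : {within `[Num.min u e, Num.max u e], continuous (cf_word w : R ->
    R)}.
    apply: continuous_in_subspaceT => z /set_mem /=; rewrite in_itv /= => /andP[z0 _].
    exact: cw (le_trans a0 z0).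
  have [|c cI cy] := IVT ab cont_w (v := y).
    move: hy; rewrite -/v; have [ue|ue] := leP u e; rewrite -/v //.
    by rewrite minC maxC.
  exists c => //; move: cI; rewrite in_itv /= ge_min le_max => /andP[h1 h2].
  have ce : c != e by apply: contra ye => /eqP <-; rewrite cy.
  case: ee => ee; move: h1 h2 ce; rewrite ee => h1 h2 ce.
    rewrite lt_neqAle eq_sym ce /=; lra.
  rewrite [X in _ && X]lt_neqAle ce /=; lra.
pose t := (v - (x - 2 * rho)) / (rho / 16).
have r16 : 0 < rho / 16 by rewrite divr_gt0.
have tv : v = x - 2 * rho + t * (rho / 16) by rewrite /t divfK ?gt_eqF //; ring.
have : 16 < t < 48.
  rewrite /t ltr_pdivlMr // ltr_pdivrMr //; move: xu; rewrite ltr_norml => /andP[? ?].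
  by apply/andP; split; lra.
move=> /andP[t16 t48]; have t0 : 0 <= t by lra.
have /andP[m1 m2] := truncn_itv t0; set m := Num.truncn t in m1 m2.
have m48 : (m < 48)%N by rewrite -(ltr_nat R); lra.
have m0 : (0 < m)%N by rewrite truncn_gt0; lra.
move: m2; rewrite -natr1 => m2.
have [ve|ev'] := leP v (cf_word w e).
  exists m.+1; split; first by apply: (leq_ltn_trans m48).
  have gv : v < g m.+1 < v + rho / 8.
    by rewrite /g -natr1 tv; apply/andP; split; nra.
  move: ev; rewrite ger0_norm ?subr_ge0 // => ev.
  apply: ivt; first by rewrite lt_eqF //; lra.
  by rewrite ?(min_idPl ve) ?(max_idPr ve); lra.
exists m.-1; split; first by apply: leq_ltn_trans (leq_pred m) (ltn_trans m48 _).
have gv : v - rho / 8 < g m.-1 < v.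
  have mE : (m.-1%:R : R) = m%:R - 1 by rewrite -[in RHS](prednK m0) -natr1; ring.
  by rewrite /g mE tv; apply/andP; split; nra.
move: ev; rewrite ltr0_norm ?subr_lt0 // => ev.
apply: ivt; first by rewrite gt_eqF //; lra.
by rewrite minC maxC ?(min_idPl (ltW ev')) ?(max_idPr (ltW ev')); lra.
Qed.

End GridCount.

(** * Covering pieces of F near 0 *)

Section SpectrumUpper.
Context {R : realType}.
Variables (I : set nat) (p h s : R).
Hypothesis I_pos : forall b, I b -> (0 < b)%N.
Hypothesis hE : hausdorff_dim (cf_set I : set R) = h%:E.
Hypothesis p1 : 1 < p.
Hypothesis I_fin : finite_set (I `+` floor_powers p).
Hypothesis hs : h < s.
Hypothesis ps : (p + 1)^-1 < s.
Hypothesis sp : s < p^-1.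
Implicit Types (r rho T d e : R) (w : seq nat).
Local Notation F := (cf_set I : set R).

Let p0 : 0 < p. Proof. exact: lt_trans p1. Qed.
Let pp0 : 0 < p + 1. Proof. by rewrite addr_gt0. Qed.
Let s0 : 0 < s. Proof. by apply: lt_trans ps; rewrite invr_gt0. Qed.
Let s1 : s < 1. Proof. by apply: lt_trans sp _; rewrite invf_lt1. Qed.

(** With [two_s_lt], this gives the signs that make T = d the worst annulus: T^(2s-1/p) increases
    for T <= d, and d T^(2s-1-1/p) decreases for T >= d. *)
Let two_s_gt : p^-1 < 2 * s.
Proof.
apply: (@lt_trans _ _ (2 * (p + 1)^-1)); last by rewrite ltr_pM2l.
have pi1 : p^-1 < 1 by rewrite invf_lt1.
by rewrite ltr_pdivlMr // mulrDr mulVf ?gt_eqF // mulr1; lra.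
Qed.

Let two_s_lt : 2 * s - 1 - p^-1 < 0.
Proof. have : p^-1 < 1 by rewrite invf_lt1. by move: sp; lra. Qed.

Let pow_le (c x : R) : 1 <= c -> 0 <= x -> (c * x) `^ s <= c * x `^ s.
Proof.
move=> c1 x0; rewrite powRM //; last by lra.
by rewrite ler_wpM2r ?powR_ge0 //; apply: ler1_powR => //; exact: ltW.
Qed.

(** Cost of a blown-up piece of diameter about d at scale rho: one cylinder of length about d, the
    number of cylinders in the finest annulus, and the mixed term at T = d. *)
Definition local_bound rho d := (d / rho) `^ s + rho `^ (- (p + 1)^-1) +
   d `^ (2 * s - p^-1) * rho `^ (- s).

Let local_bound_ge1 rho d : 0 < rho <= 1 -> 1 <= local_bound rho d.
Proof.
move=> r01; rewrite /local_bound.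
have : 1 <= rho `^ (- (p + 1)^-1) by apply: powR_ge1; rewrite // oppr_le0 invr_ge0 ltW.
have := powR_ge0 (d / rho) s; have := powR_ge0 d (2 * s - p^-1).
by have := powR_ge0 rho (- s); nra.
Qed.

(** The cylinder is a copy of F contracted by about b^(-2) <= 4 T^2, to which the box bound applies;
    the term 1 stands for copies already shorter than the scale. *)
Let coverable_cf_map_image : exists2 C : R, 0 < C & forall (b : nat) rho T, I b ->
  0 < rho -> 0 < T -> 1 <= 2 * T * b%:R ->
  coverable (cf_map b @` F) (rho / 2) (C * (1 + (T ^+ 2 / rho) `^ s)).
Proof.
have [C C0 hC] := cf_set_coverable I_pos hE p1 I_fin hs ps.
exists (C * 16 + 2) => [|b rho T Ib r0 T0 Tb]; first by rewrite addr_gt0 ?mulr_gt0.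
have b0 := I_pos Ib; have bR : (0 : R) < b%:R by rewrite ltr0n.
have b2 : (0 : R) < b%:R ^+ 2 by rewrite exprn_gt0.
have Tr0 : 0 <= T ^+ 2 / rho by rewrite divr_ge0 ?exprn_ge0 ?ltW.
have Ts0 := powR_ge0 (T ^+ 2 / rho) s.
have Lip x y : F x -> F y -> `|cf_map b x - cf_map b y| <= (b%:R ^+ 2)^-1 * `|x - y|.
  move=> /cf_set_itv/andP[x0 _] /cf_set_itv/andP[y0 _].
  by apply: cf_map_dist_le => //; exact: ltW.
have [r1|r1] := leP (rho * b%:R ^+ 2 / 4) 1.
  have rb0 : 0 < rho * b%:R ^+ 2 / 4 by rewrite divr_gt0 // mulr_gt0.
  have -> : rho / 2 = 2 * (b%:R ^+ 2)^-1 * (rho * b%:R ^+ 2 / 4) by field; rewrite gt_eqF.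
  apply: coverable_image => //; first by rewrite invr_gt0.
  apply: coverable_le (hC _ rb0 r1).
  have : (rho * b%:R ^+ 2 / 4) `^ (- s) <= 16 * (T ^+ 2 / rho) `^ s.
    apply: le_trans (pow_le _ Tr0); last by rewrite ler1n.
    rewrite powRN -powRV ?(ltW rb0) //; apply: ge0_ler_powR;
      rewrite ?nnegrE ?invr_ge0 ?(ltW s0) ?(ltW rb0) //.
      by rewrite mulr_ge0.
    rewrite -[leLHS]mul1r ler_pdivrMr //.
    rewrite (_ : 16 * (T ^+ 2 / rho) * _ = (2 * T * b%:R) ^+ 2); last by field; rewrite gt_eqF.
    exact: exprn_ege1.
  by nra.
apply: (@coverable_le _ _ _ 2); first by nra.
apply: (@coverable_le _ _ _ (2 * (rho / 4) / (rho / 2) + 1)).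
  by rewrite (_ : 2 * _ / _ = 1); [lra|field; rewrite gt_eqF].
apply: coverable_diam; [by rewrite divr_gt0|by rewrite divr_ge0 // ltW|].
move=> _ _ [x Fx <-] [y Fy <-]; apply: le_trans (Lip x y Fx Fy) _.
have /andP[x0 x1] := cf_set_itv Fx; have /andP[y0 y1] := cf_set_itv Fy.
have xy : `|x - y| <= 1 by rewrite ler_norml; apply/andP; split; lra.
apply: (@le_trans _ _ ((b%:R ^+ 2)^-1 * 1)); first by rewrite ler_wpM2l ?invr_ge0 ?exprn_ge0.
by rewrite mulr1 -[leLHS]mul1r ler_pdivrMr //; lra.
Qed.

(** Number of cylinders times cost of each. Of the four products, the cost alone is controlled by
    T^2 <= 16 d, the number alone by T >= rho^(p/(p+1)), and the mixed one by its value at T = d. *)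
Lemma coverable_annulus : exists2 C : R, 0 < C & forall rho d T (A : set R),
  0 < rho -> rho <= d -> d <= 1 -> rho `^ (p / (p + 1)) <= T -> T <= 1 ->
  (forall y, A y -> [/\ F y, T / 2 < y, y <= T & y ^+ 2 <= 4 * d]) ->
  (forall x y, A x -> A y -> `|x - y| <= 8 * d) ->
  coverable A (rho / 2) (C * local_bound rho d).
Proof.
have [s0' s1' sp' s2g s2l] := And5 s0 s1 sp two_s_gt two_s_lt.
have [C C0 hC] := count_itv p1 I_fin; have [D D0 hD] := coverable_cf_map_image.
exists (C * 16 * (D * 16)) => [|rho d T A r0 rd d1 rT T1 hA Ad]; first by rewrite !mulr_gt0.
have T0 : 0 < T by apply: lt_le_trans rT; exact: powR_gt0.
have d0 : 0 < d := lt_le_trans r0 rd.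
have r01 : 0 < rho <= 1 by rewrite r0 (le_trans rd).
have [[y0 Ay0]|A0] := pselect (exists y, A y); last first.
  apply: (@coverable_le _ _ _ 0); last by exists [::] => // y Ay; case: A0; exists y.
  by rewrite !mulr_ge0 ?ltW // (lt_le_trans ltr01) // local_bound_ge1.
have [Fy0 y0T y0T' y0d] := hA y0 Ay0.
(* The spread of [A], limited both by its diameter and by the annulus; reciprocals then spread over
   at most 4 dl / T^2. *)
pose dl := Num.min (8 * d) T.
have dl0 : 0 < dl by rewrite lt_min T0 mulr_gt0.
have dlT : dl <= T by rewrite ge_min lexx orbT.
have T2 : 0 < T ^+ 2 by rewrite exprn_gt0.
have invA y : A y -> `|y^-1 - y0^-1| <= 4 * dl / T ^+ 2.
  move=> Ay; have [Fy yT yT' yd] := hA y Ay.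
  have yp : 0 < y by apply: lt_trans yT; rewrite divr_gt0.
  have y0p : 0 < y0 by apply: lt_trans y0T; rewrite divr_gt0.
  have -> : y^-1 - y0^-1 = (y0 - y) / (y * y0) by field; rewrite !gt_eqF.
  rewrite normrM [`|(_)^-1|]gtr0_norm ?invr_gt0 ?mulr_gt0 //.
  rewrite ler_pdivrMr ?mulr_gt0 // mulrAC ler_pdivlMr //.
  have y0y : `|y0 - y| <= dl.
    by rewrite le_min Ad //= ler_norml; apply/andP; split; lra.
  have yy : T ^+ 2 <= 4 * (y * y0).
    have : (T / 2) * (T / 2) <= y * y0 by apply: ler_pM; lra.
    by rewrite expr2; lra.
  rewrite (_ : 4 * dl * (y * y0) = dl * (4 * (y * y0))); last by ring.
  by apply: ler_pM => //; exact: ltW.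
pose L := 8 * dl / T ^+ 2 + 1.
have q0 : 0 < dl / T ^+ 2 by rewrite divr_gt0.
have L0 : 0 <= L by rewrite /L -mulrA; lra.
(* The left end of the range of digits is raised to 1 / (2 T), so that the density of I is evaluated
   at digits of order at least 1/T. *)
pose B := Num.max (Num.max 1 (2 * T)^-1) (y0^-1 - 4 * dl / T ^+ 2 - 1).
have B1 : 1 <= B by rewrite /B !le_max lexx.
have TB : (2 * T)^-1 <= B by rewrite /B !le_max lexx orbT.
have [l ls hl] := hC B L B1 L0.
have digit b z : I b -> F z -> A (cf_map b z) -> b \in l /\ 1 <= 2 * T * b%:R.
  move=> Ib Fz Ay; have /andP[z0 z1] := cf_set_itv Fz.
  have := invA _ Ay; rewrite {1}/cf_map invrK ler_norml => /andP[h1 h2].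
  have b1 : (1 : R) <= b%:R by rewrite ler1n I_pos.
  have [_ _ yT _] := hA _ Ay.
  have Tb : T^-1 <= b%:R + z.
    by rewrite -[leRHS]invrK lef_pV2 ?posrE ?invr_gt0 //; lra.
  have Tb2 : (2 * T)^-1 <= b%:R.
    by rewrite invfM; lra.
  split; last by rewrite mulrC -ler_pdivrMr ?mulr_gt0 // mul1r.
  apply: hl => //; apply/andP; split; first by rewrite /B !ge_max b1 Tb2 /=; lra.
  have : y0^-1 - 4 * dl / T ^+ 2 - 1 <= B by rewrite /B le_max lexx orbT.
  by rewrite /L; move: h1 h2; rewrite -![_ * dl / _]mulrA; lra.
have countE : (size l)%:R <= C * 16 * (1 + dl * T `^ (- 1 - p^-1)).
  apply: le_trans ls _; rewrite -[_ * 16 * _]mulrA ler_wpM2l ?(ltW C0) //.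
  have BT : B `^ (p^-1 - 1) <= 2 * T `^ (1 - p^-1).
    have pi1 : p^-1 < 1 by rewrite invf_lt1.
    have pi0 : 0 < p^-1 by rewrite invr_gt0.
    rewrite -[p^-1 - 1]opprB powRN -powRV; last by lra.
    apply: (@le_trans _ _ ((2 * T) `^ (1 - p^-1))).
      apply: ge0_ler_powR; rewrite ?nnegrE ?invr_ge0 ?mulr_ge0 //; try lra.
      by rewrite -[leRHS]invrK lef_pV2 ?posrE ?invr_gt0 ?mulr_gt0 //; lra.
    rewrite powRM //; last lra.
    by rewrite ler_wpM2r ?powR_ge0 //; apply: ler1_powR; lra.
  have T1' : T `^ (1 - p^-1) <= 1.
    by apply: powR_le1; rewrite ?T0 // subr_ge0 ltW // invf_lt1.
  have TE : dl * T `^ (- 1 - p^-1) = dl / T ^+ 2 * T `^ (1 - p^-1).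
    have -> : - 1 - p^-1 = (- 2%:R) + (1 - p^-1) :> R by ring.
    by rewrite -powRDm // powR_invn ?(ltW T0) // mulrA.
  rewrite TE; apply: (@le_trans _ _ (1 + L * (2 * T `^ (1 - p^-1)))).
    by rewrite lerD2l ler_wpM2l.
  rewrite /L -[8 * dl / _]mulrA.
  have := mulr_ge0 (ltW q0) (powR_ge0 T (1 - p^-1)).
  by have := powR_ge0 T (1 - p^-1); nra.
have cost0 : 0 <= D * (1 + (T ^+ 2 / rho) `^ s).
  by rewrite mulr_ge0 ?(ltW D0) // addr_ge0 // powR_ge0.
apply: (@coverable_le _ _ _ (C * 16 * (1 + dl * T `^ (- 1 - p^-1)) * (D * (1 + (T ^+ 2 / rho) `^
  s)))); last first.
  apply: (@coverable_union_le _ _ [seq b <- l | `[< I b /\ 1 <= 2 * T * b%:R >]] (fun b =>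
    cf_map b @` F)) => //.
  - by apply: le_trans countE; rewrite ler_nat size_filter count_size.
  - move=> y Ay; have [Fy _ _ _] := hA y Ay.
    have [b [z [Ib Fz yE]]] := cf_set_unfold I_pos Fy; rewrite yE in Ay *.
    have [bl Tb] := digit b z Ib Fz Ay.
    by exists b; [rewrite mem_filter bl asboolT|exists z].
  - move=> b; rewrite mem_filter => /andP[/asboolP[Ib Tb] _].
    exact: hD.
set u := T `^ (- 1 - p^-1); set v := (T ^+ 2 / rho) `^ s.
rewrite (_ : C * 16 * (1 + dl * u) * (D * (1 + v)) = C * 16 * D * ((1 + dl * u) * (1 + v)));
  last by ring.
rewrite (_ : C * 16 * (D * 16) * _ = C * 16 * D * (16 * local_bound rho d)); last by ring.
rewrite ler_wpM2l ?mulr_ge0 ?(ltW C0) ?(ltW D0) //.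
have pi0 : 0 < p^-1 by rewrite invr_gt0.
have h1 : 1 <= rho `^ (- (p + 1)^-1) by apply: powR_ge1; rewrite // oppr_le0 invr_ge0 ltW.
have h2 : v <= 16 * (d / rho) `^ s.
  have dr0 : 0 <= d / rho by rewrite divr_ge0 ?ltW.
  apply: le_trans (pow_le _ dr0); last by rewrite ler1n.
  have T20 : 0 <= T ^+ 2 / rho by rewrite divr_ge0 ?exprn_ge0 ?ltW.
  apply: ge0_ler_powR; rewrite ?nnegrE //; [exact: ltW|by rewrite mulr_ge0|].
  by rewrite mulrA ler_pM2r ?invr_gt0 //; move: y0d; rewrite !expr2; nra.
have uT : T * u = T `^ (- p^-1).
  by rewrite /u -{1}(powRr1 (ltW T0)) powRDm //; congr (_ `^ _); ring.
have h3 : dl * u <= rho `^ (- (p + 1)^-1).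
  apply: (@le_trans _ _ (T * u)); first by rewrite ler_wpM2r ?powR_ge0.
  rewrite uT; have -> : - (p + 1)^-1 = p / (p + 1) * (- p^-1) by field; rewrite !gt_eqF.
  rewrite powRrM !(powRN _ p^-1) lef_pV2 ?posrE ?powR_gt0 //.
  by apply: ge0_ler_powR; rewrite ?nnegrE ?powR_ge0 ?(ltW pi0) ?(ltW T0).
have h4 : dl * u * v <= 8 * (d `^ (2 * s - p^-1) * rho `^ (- s)).
  have -> : dl * u * v = dl * T `^ (2 * s - 1 - p^-1) * rho `^ (- s).
    rewrite /u /v powRM ?exprn_ge0 ?invr_ge0 ?(ltW T0) ?(ltW r0) // powRV ?(ltW r0) // -powRN.
    rewrite -powR_mulrn ?(ltW T0) // -powRrM.
    have -> : T `^ (2 * s - 1 - p^-1) = T `^ (- 1 - p^-1) * T `^ (2 * s).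
      by rewrite powRDm //; congr (_ `^ _); ring.
    by ring.
  rewrite mulrA ler_wpM2r ?powR_ge0 //.
  have [Td|dT] := leP d T.
    apply: (@le_trans _ _ (8 * d * d `^ (2 * s - 1 - p^-1))).
      apply: ler_pM; rewrite ?powR_ge0 ?(ltW dl0) //; first by rewrite ge_min lexx.
      rewrite -[2 * s - 1 - p^-1]opprK !(powRN _ (- (2 * s - 1 - p^-1))) lef_pV2 ?posrE
        ?powR_gt0 //.
      by apply: ge0_ler_powR; rewrite ?nnegrE ?(ltW T0) ?(ltW d0) //; lra.
    rewrite -mulrA -{1}(powRr1 (ltW d0)) powRDm //.
    by rewrite (_ : 1 + (2 * s - 1 - p^-1) = 2 * s - p^-1) //; ring.
  apply: (@le_trans _ _ (T * T `^ (2 * s - 1 - p^-1))); first by rewrite ler_wpM2r ?powR_ge0.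
  rewrite -{1}(powRr1 (ltW T0)) powRDm // (_ : 1 + (2 * s - 1 - p^-1) = 2 * s - p^-1);
    last by ring.
  apply: (@le_trans _ _ (d `^ (2 * s - p^-1))).
    by apply: ge0_ler_powR; rewrite ?nnegrE ?(ltW T0) ?(ltW d0) //; lra.
  by rewrite ler_peMl ?powR_ge0 // ler1n.
have v0 : 0 <= v by exact: powR_ge0.
have h5 := powR_ge0 (d / rho) s.
have h6 : 0 <= d `^ (2 * s - p^-1) * rho `^ (- s) by rewrite mulr_ge0 ?powR_ge0.
rewrite /local_bound; move: h1 h2 h3 h4 h5 h6;
  move: (d `^ _ * _) (rho `^ _) ((d / rho) `^ _) => x1 x2 x3.
rewrite mulrDl mul1r mulrDr mulr1; move: (dl * u * v) (dl * u) => x4 x5; lra.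
Qed.

End SpectrumUpper.

Section SpectrumUpperMain.
Context {R : realType}.
Variables (I : set nat) (p h s : R).
Hypothesis I_pos : forall b, I b -> (0 < b)%N.
Hypothesis hE : hausdorff_dim (cf_set I : set R) = h%:E.
Hypothesis p1 : 1 < p.
Hypothesis I_fin : finite_set (I `+` floor_powers p).
Hypothesis hs : h < s.
Hypothesis ps : (p + 1)^-1 < s.
Hypothesis sp : s < p^-1.
Implicit Types (r rho T d e : R) (w : seq nat).
Local Notation F := (cf_set I : set R).

Let p0 : 0 < p. Proof. exact: lt_trans p1. Qed.
Let pp0 : 0 < p + 1. Proof. by rewrite addr_gt0. Qed.
Let s0 : 0 < s. Proof. by apply: lt_trans ps; rewrite invr_gt0. Qed.

Lemma local_bound_ge rho d : 0 < rho -> 0 < d -> rho `^ (- (p + 1)^-1) <= local_bound p s rho d.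
Proof.
move=> r0 d0; rewrite /local_bound.
have := powR_ge0 (d / rho) s; have := powR_ge0 d (2 * s - p^-1).
by have := powR_ge0 rho (- s); nra.
Qed.

(** Dyadic annuli are used down to rho^(p/(p+1)); what lies below is an interval that needs only
    about rho^(-1/(p+1)) balls. *)
Lemma coverable_local e : 0 < e -> exists2 C : R, 0 < C & forall rho d (A : set R),
  0 < rho -> rho <= d -> d <= 1 ->
  (forall y, A y -> F y /\ y ^+ 2 <= 4 * d) ->
  (forall x y, A x -> A y -> `|x - y| <= 8 * d) ->
  coverable A (rho / 2) (C * rho `^ (- e) * local_bound p s rho d).
Proof.
move=> e0; have [C C0 hC] := coverable_annulus I_pos hE p1 I_fin hs ps sp.
have [D D0 hD] := @log_levels R e e0.
exists (D * C + 3) => [|rho d A r0 rd d1 hA Ad]; first by rewrite addr_gt0 ?mulr_gt0.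
have d0 := lt_le_trans r0 rd; have r1 := le_trans rd d1.
have r01 : 0 < rho <= 1 by rewrite r0.
have [N ND Nr] := hD rho r01.
set k := p / (p + 1).
have k0 : 0 < k by rewrite divr_gt0.
have kE : k - 1 = - (p + 1)^-1 by rewrite /k; field; rewrite gt_eqF.
have pi0 : 0 < (p + 1)^-1 by rewrite invr_gt0.
have re1 : 1 <= rho `^ (- e) by apply: powR_ge1; rewrite // oppr_le0 ltW.
have lb := local_bound_ge r0 d0.
have rs0 := powR_ge0 rho (- (p + 1)^-1).
have rs1 : 1 <= rho `^ (- (p + 1)^-1) by apply: powR_ge1; rewrite // oppr_le0 ltW.
apply: (@coverable_le _ _ _ (D * rho `^ (- e) * (C * local_bound p s rho d) + 3 * rho `^ (- (p +
  1)^-1))).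
  rewrite (_ : (D * C + 3) * _ * _ = D * rho `^ (- e) * (C * local_bound p s rho d) +
    3 * (rho `^ (- e) * local_bound p s rho d)); last by ring.
  rewrite lerD2l ler_wpM2l //; nra.
apply: (@coverable_cup _ _ [set y | exists2 j, j \in iota 0 N.+1 &
    A y /\ 2^-1 ^+ j / 2 < y <= 2^-1 ^+ j /\
      rho `^ k <= 2^-1 ^+ j] [set y | 0 <= y <= 0 + rho `^ k]).
- move=> y Ay; have [Fy _] := hA y Ay; have /andP[y0 y1] := cf_set_itv Fy.
  have [yk|ky] := leP y (rho `^ k); first by right; rewrite /= add0r (ltW y0).
  (* The least j with 2^(-j-1) < y names the annulus of y. *)
  left; have hN : exists j, 2^-1 ^+ j / 2 < y.
    exists N; apply: le_lt_trans ky; apply: (@le_trans _ _ rho).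
      rewrite exprVn -[leRHS]mul1r ler_pdivrMr // mul1r; apply: (@le_trans _ _ rho).
        rewrite -[leLHS]mul1r ler_pdivrMr ?exprn_gt0 // mulrC; exact: ltW.
      lra.
    by rewrite -[leLHS](powRr1 (ltW r0)); apply: ger_powR => //; rewrite ler_pdivrMr //; lra.
  case: (ex_minnP hN) => j hj jmin; exists j.
    rewrite mem_iota /= ltnS leqNgt; apply/negP => Nj.
    have := jmin N; rewrite leqNgt Nj => /(_ _); suff hN' : 2^-1 ^+ N / 2 < y by move=> /(_ hN').
    apply: le_lt_trans ky; apply: (@le_trans _ _ rho).
      rewrite exprVn; apply: (@le_trans _ _ ((2 ^+ N)^-1)).
        by rewrite ler_pdivrMr // ler_peMr ?invr_ge0 ?exprn_ge0 // ler1n.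
      rewrite -[leLHS]mul1r ler_pdivrMr ?exprn_gt0 // mulrC; exact: ltW.
    by rewrite -[leLHS](powRr1 (ltW r0)); apply: ger_powR => //; rewrite ler_pdivrMr //; lra.
  have yj : y <= 2^-1 ^+ j.
    case: j hj jmin => [|j] hj jmin; first by rewrite expr0 ltW.
    rewrite leNgt; apply/negP => hy; have := jmin j; rewrite ltnn => hh.
    by apply: notF; apply: hh; rewrite -exprSr.
  by split => //; rewrite hj yj; split => //; apply: le_trans (ltW ky) yj.
- apply: (@coverable_union_le _ _ (iota 0 N.+1) (fun j => [set y |
    A y /\ 2^-1 ^+ j / 2 < y <= 2^-1 ^+ j /\ rho `^ k <= 2^-1 ^+ j])).
  + by rewrite size_iota.
  + by rewrite mulr_ge0 ?(ltW C0) // (le_trans rs0).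
  + by move=> y [j jN hy]; exists j.
  move=> j _; have [kj|jk] := leP (rho `^ k) (2^-1 ^+ j); last first.
    apply: (@coverable_le _ _ _ 0); first by rewrite mulr_ge0 ?(ltW C0) // (le_trans rs0).
    by exists [::] => // y [_ [_]].
  apply: (hC _ _ (2^-1 ^+ j)) => //.
  + by apply: exprn_ile1; rewrite ?invr_ge0 // invf_le1 // ler1n.
  + by move=> y [Ay [/andP[? ?] _]]; have [] := hA y Ay.
  + by move=> x y [Ax _] [Ay _]; exact: Ad.
apply: coverable_le (coverable_itv _ _ _); [|by rewrite divr_gt0|exact: powR_ge0].
rewrite (_ : rho `^ k / (rho / 2) = 2 * rho `^ (- (p + 1)^-1)); first by lra.
rewrite -kE powRB; last by rewrite (gt_eqF r0) implybT.
by rewrite powRr1 ?(ltW r0) //; field; rewrite gt_eqF.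
Qed.

(** One half of e pays for the lengths of the stopping words, the other for the annuli of a blown-up
    piece; each length contributes at most 64 words. *)
Lemma cf_set_ball_coverable e : 0 < e -> exists2 C : R, 0 < C & forall x rho r,
  0 < r -> r <= rho -> rho <= 1 ->
  coverable (ball x rho `&` F) r
    (C * r `^ (- e) * ((rho / r) `^ s * rho `^ (s - p^-1) + r `^ (- (p + 1)^-1))).
Proof.
move=> e0; pose e2 := e / 2; have e20 : 0 < e2 by rewrite divr_gt0.
have [C C0 hC] := coverable_local e20; have [D D0 hD] := @log_levels R e2 e20.
exists (D * 64 * (2 * C)) => [|x d r r0 rd d1]; first by rewrite !mulr_gt0.
have d0 := lt_le_trans r0 rd; have r1 := le_trans rd d1.
have [|N ND Nd] := hD d; first by rewrite d0.
pose A n := [set z | (`|x - z| < d) /\ exists w b z', [/\ word_over I w, size w = n, I b,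
  F z' & z = cf_word w (cf_map b z')] /\
   ((cont w)%:R ^+ 2 * d <= 1 /\ 1 <= 4 * ((cont w)%:R ^+ 2 * d) * b%:R ^+ 2)].
set Y := (d / r) `^ s * d `^ (s - p^-1) + r `^ (- (p + 1)^-1).
have Y0 : 0 <= Y by rewrite addr_ge0 ?mulr_ge0 ?powR_ge0.
have dr : d `^ (- e2) <= r `^ (- e2).
  rewrite !powRN lef_pV2 ?posrE ?powR_gt0 //.
  by apply: ge0_ler_powR; rewrite ?nnegrE ?(ltW e20) ?(ltW r0) ?(ltW d0).
have re0 := powR_ge0 r (- e2).
have X0 : 0 <= 2 * C * r `^ (- e2) * Y by rewrite !mulr_ge0 // ltW.
apply: (@coverable_le _ _ _ (D * d `^ (- e2) * (64 * (2 * C * r `^ (- e2) * Y)))).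
  rewrite (_ : D * 64 * (2 * C) * r `^ (- e) * Y =
    D * r `^ (- e2) * (64 * (2 * C * r `^ (- e2) * Y))).
    apply: ler_wpM2r; first by rewrite mulr_ge0.
    by apply: ler_wpM2l => //; exact: ltW.
  have -> : - e = - e2 + - e2 by rewrite /e2; field.
  by rewrite -powRDm //; ring.
apply: (@coverable_union_le _ _ (iota 0 N.+1) A).
- by rewrite size_iota.
- by rewrite mulr_ge0.
- move=> z [xz Fz]; have [w [b [z' [[wI Ib Fz' zE] [wd wb]]]]] := stopping_word I_pos Fz d0 d1.
  exists (size w); last by split=> //; exists w, b, z'.
  rewrite mem_iota /= ltnS; apply: level_bound wd => //; exact: (word_over_pos I_pos).
move=> n _; have [l l64 hl] := @cylinders_meeting_ball R n x d d0.
pose P w := word_over I w /\ (cont w)%:R ^+ 2 * d <= 1.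
pose G w : set R := [set y | `|x - cf_word w y| < d /\ exists b z,
   [/\ I b, F z, 1 <= 4 * ((cont w)%:R ^+ 2 * d) * b%:R ^+ 2 & y = cf_map b z]].
apply: (@coverable_union_le _ _ [seq w <- l | `[< P w >]] (fun w => cf_word w @` G w)) => //.
- rewrite (_ : 64 = (size l)%:R); last by rewrite l64.
  by rewrite ler_nat size_filter count_size.
- move=> z [xz [w [b [z' [[wI wn Ib Fz' zE] [wd wb]]]]]].
  have Fy := cf_set_map I_pos Ib Fz'; rewrite zE in xz *.
  exists w; last by exists (cf_map b z') => //; split=> //; exists b, z'.
  rewrite mem_filter asboolT //=; apply: hl xz => //; first exact: (word_over_pos I_pos).
  exact: cf_set_itv Fy.
move=> w; rewrite mem_filter => /andP[/asboolP[wI wd] _].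
have wp := word_over_pos I_pos wI; have w0 := wt_gt0 (R := R) wp.
have c1 : (1 : R) <= (cont w)%:R by rewrite ler1n cont_gt0.
have c2 : (1 : R) <= (cont w)%:R ^+ 2 by rewrite exprn_ege1.
have q2 : (0 : R) < (cont w)%:R ^+ 2 by apply: lt_le_trans c2.
set d' := (cont w)%:R ^+ 2 * d in wd *; pose r' := (cont w)%:R ^+ 2 * r.
have r'0 : 0 < r' by rewrite mulr_gt0.
have rr' : r <= r' by rewrite ler_peMl // ltW.
have dd' : d <= d' by rewrite ler_peMl // ltW.
have r'd' : r' <= d' by rewrite ler_pM2l.
have -> : r = 2 * wt w * (r' / 2) by rewrite /r' /wt; field;
  rewrite gt_eqF // (lt_le_trans ltr01).
have GF y : G w y -> F y by move=> [_ [b [z [Ib Fz _ ->]]]]; exact: (cf_set_map I_pos).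
have G01 y : G w y -> 0 <= y <= 1 by move=> /GF/cf_set_itv/andP[? ?]; rewrite !ltW.
apply: coverable_image => //.
  by move=> y z /G01/andP[y0 _] /G01/andP[z0 _]; exact: cf_word_dist_le.
rewrite (_ : 2 * wt w * (r' / 2) = r); last by rewrite /r' /wt; field;
  rewrite gt_eqF // (lt_le_trans ltr01).
apply: (@coverable_le _ _ _ (C * r' `^ (- e2) * local_bound p s r' d')); last first.
  (* Closeness to 0 comes from the stopping digit. The diameter bound 8 d' is the diameter 2 d of
     the ball times the distortion 4 q^2. *)
  apply: hC => //.
    move=> y Gy; split; first exact: GF.
    have [_ [b [z [Ib Fz hb ->]]]] := Gy; have /andP[z0 _] := cf_set_itv Fz.
    have b0 : (0 : R) < b%:R by rewrite ltr0n I_pos.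
    rewrite /cf_map exprVn -[leLHS]mul1r ler_pdivrMr ?exprn_gt0 ?addr_gt0 //.
    apply: le_trans hb _; rewrite -/d'; apply: ler_wpM2l;
      first by rewrite mulr_ge0 // (le_trans (ltW d0)).
    by apply: lerXn2r; rewrite ?nnegrE; lra.
  move=> y z Gy Gz; have := cf_word_dist_ge wp (G01 y Gy) (G01 z Gz).
  move: Gy Gz => [yd _] [zd _].
  have : `|cf_word w y - cf_word w z| <= 2 * d.
    by have := ler_distD x (cf_word w y) (cf_word w z); rewrite (distrC (cf_word w y) x); lra.
  move=> /[swap] /le_trans h1 /h1; rewrite ler_pdivrMl ?mulr_gt0 // /d'; lra.
have hX : r' `^ (- e2) <= r `^ (- e2).
  rewrite !powRN lef_pV2 ?posrE ?powR_gt0 //.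
  by apply: ge0_ler_powR; rewrite ?nnegrE ?(ltW e20) ?(ltW r0) ?(ltW r'0).
have hL : local_bound p s r' d' <= 2 * Y; last first.
  rewrite (_ : 2 * C * r `^ (- e2) * Y = C * r `^ (- e2) * (2 * Y)); last by ring.
  apply: ler_pM => //; rewrite ?mulr_ge0 ?powR_ge0 ?(ltW C0) //.
    by rewrite !addr_ge0 ?mulr_ge0 ?powR_ge0.
  by rewrite ler_wpM2l // ltW.
have d'0 : 0 < d' by rewrite mulr_gt0.
have drE : d' / r' = d / r by rewrite /d' /r'; field; rewrite !gt_eqF // (lt_le_trans ltr01).
rewrite /local_bound drE.
have t1 : (d / r) `^ s <= (d / r) `^ s * d `^ (s - p^-1).
  by rewrite ler_peMr ?powR_ge0 // powR_ge1 ?d0 // subr_le0 ltW.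
have t2 : r' `^ (- (p + 1)^-1) <= r `^ (- (p + 1)^-1).
  rewrite !powRN lef_pV2 ?posrE ?powR_gt0 //.
  by apply: ge0_ler_powR; rewrite ?nnegrE ?invr_ge0 ?(ltW pp0) ?(ltW r0) ?(ltW r'0).
(* Blowing up keeps the ratio d / r, so the term equals (d / r)^s d'^(s-1/p), which decreases in d'
   >= d because s < 1/p. *)
have t3 : d' `^ (2 * s - p^-1) * r' `^ (- s) <= (d / r) `^ s * d `^ (s - p^-1).
  have -> : d' `^ (2 * s - p^-1) * r' `^ (- s) = (d / r) `^ s * d' `^ (s - p^-1).
    rewrite -drE powRM ?invr_ge0 ?(ltW d'0) ?(ltW r'0) // powRV ?(ltW r'0) // -powRN.
    have -> : d' `^ (2 * s - p^-1) = d' `^ s * d' `^ (s - p^-1).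
      by rewrite powRDm //; congr (_ `^ _); ring.
    by ring.
  rewrite ler_wpM2l ?powR_ge0 // -[s - p^-1]opprB !(powRN _ (p^-1 - s)) lef_pV2 ?posrE ?powR_gt0
    //.
  by apply: ge0_ler_powR; rewrite ?nnegrE ?subr_ge0 ?(ltW sp) ?(ltW d0) ?(ltW d'0).
have := powR_ge0 r (- (p + 1)^-1).
rewrite /Y; move: t1 t2 t3; set a1 := _ * d `^ _; set a2 := (d / r) `^ s; lra.
Qed.

End SpectrumUpperMain.

(** * Lower bounds for the spectra *)

Section SpectrumDefs.
Context {R : realType}.
Implicit Types (E : set R) (a b c C t r rho theta alpha : R).

Lemma powR_compare a b C r0 : 0 < C -> 0 < r0 ->
  (forall r, 0 < r -> r < r0 -> r `^ a <= C * r `^ b) -> b <= a.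
Proof.
move=> C0 r00 h; rewrite leNgt; apply/negP => ab.
have ba : 0 < b - a by rewrite subr_gt0.
(* At this radius C r^(b-a) = 1/2, which contradicts the assumed bound. *)
pose r1 := (2 * C)^-1 `^ (b - a)^-1.
have C2 : 0 < (2 * C)^-1 by rewrite invr_gt0 mulr_gt0.
have r10 : 0 < r1 by exact: powR_gt0.
pose r := Num.min (r0 / 2) r1.
have r_gt0 : 0 < r by rewrite lt_min divr_gt0.
have rr0 : r < r0 by rewrite /r gt_min; apply/orP; left; lra.
have := h r r_gt0 rr0.
have -> : r `^ b = r `^ a * r `^ (b - a) by rewrite powRDm // addrC subrK.
rewrite mulrCA -[leLHS]mulr1 ler_pM2l ?powR_gt0 //; apply/negP; rewrite -ltNge.
have : r `^ (b - a) <= (2 * C)^-1.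
  apply: (@le_trans _ _ (r1 `^ (b - a))).
    by apply: ge0_ler_powR; rewrite ?nnegrE ?(ltW ba) ?(ltW r_gt0) ?(ltW r10) // ge_min lexx orbT.
  by rewrite -powRrM mulVf ?gt_eqF // powRr1 // ltW.
move=> /(ler_wpM2l (ltW C0)) /le_lt_trans; apply.
by rewrite invfM mulrCA divff ?gt_eqF // mulr1 invf_lt1 // ltr1n.
Qed.

Definition spectrum_exponent theta E alpha := exists2 C : R, 0 < C &
  forall x, E x -> forall rho, 0 < rho -> rho <= 1 ->
    coverable (ball x rho `&` E) (rho `^ theta^-1) (C * rho `^ (alpha * (1 - theta^-1))).

Lemma assouad_spectrum_openE theta E :
  assouad_spectrum_open theta E = ereal_inf [set alpha%:E | alpha in spectrum_exponent theta E].
Proof.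
congr ereal_inf; congr image; apply/seteqP; split=> alpha [C C0 h]; exists C => // x Ex rho r0 r1.
  exact/covering_number_le/h.
exact/covering_number_le/h.
Qed.

Lemma assouad_spectrum_open_le theta E a :
  (forall alpha, a < alpha -> spectrum_exponent theta E alpha) ->
  (assouad_spectrum_open theta E <= a%:E)%E.
Proof.
move=> h; rewrite assouad_spectrum_openE; apply/lee_addgt0Pr => e e0.
by apply: ereal_inf_lbound; exists (a + e) => //; apply: h; rewrite ltrDl.
Qed.

Lemma assouad_spectrum_open_ge theta E a :
  (forall alpha, spectrum_exponent theta E alpha -> a <= alpha) ->
  (a%:E <= assouad_spectrum_open theta E)%E.
Proof.
move=> h; rewrite assouad_spectrum_openE; apply: le_ereal_inf_tmp => _ [alpha /h ? <-].
by rewrite lee_fin.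
Qed.

Definition upper_spectrum_exponent theta E alpha := exists2 C : R, 0 < C &
  forall x, E x -> forall r rho, 0 < r -> r <= rho `^ theta^-1 -> rho `^ theta^-1 <= rho ->
    rho <= 1 ->
    coverable (ball x rho `&` E) r (C * (rho / r) `^ alpha).

Lemma upper_assouad_spectrum_openE theta E :
  upper_assouad_spectrum_open theta E =
    ereal_inf [set alpha%:E | alpha in upper_spectrum_exponent theta E].
Proof.
congr ereal_inf; congr image; apply/seteqP; split=> alpha [C C0 h];
  exists C => // x Ex r rho r0 h1 h2 h3.
  exact/covering_number_le/h.
exact/covering_number_le/h.
Qed.

Lemma assouad_spectrum_open_le_upper theta E : 0 < theta -> theta < 1 ->
  (assouad_spectrum_open theta E <= upper_assouad_spectrum_open theta E)%E.
Proof.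
move=> t0 t1; rewrite assouad_spectrum_openE upper_assouad_spectrum_openE.
apply: le_ereal_inf => _ [alpha [C C0 h] <-]; exists alpha => //.
exists C => // x Ex rho r0 r1.
have ti1 : 1 <= theta^-1 by rewrite invf_ge1 // ltW.
have rr : rho `^ theta^-1 <= rho.
  by rewrite -[leRHS](powRr1 (ltW r0)); apply: ger_powR; rewrite ?r0.
have := h x Ex _ rho (powR_gt0 _ r0) (lexx _) rr r1.
rewrite (_ : (rho / rho `^ theta^-1) `^ alpha = rho `^ (alpha * (1 - theta^-1))) //.
by rewrite (mulrC alpha) powRrM -(powRDm 1 (- theta^-1) r0) powRr1 ?(ltW r0) // powRN.
Qed.

Lemma upper_assouad_spectrum_open_le1 theta E : 0 < theta -> theta < 1 ->
  (upper_assouad_spectrum_open theta E <= 1%:E)%E.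
Proof.
move=> t0 t1; rewrite upper_assouad_spectrum_openE; apply: ereal_inf_lbound.
exists 1 => //; exists 5 => // x Ex r rho r0 h1 h2 h3.
have rho0 : 0 < rho by exact: lt_le_trans (lt_le_trans r0 h1) h2.
rewrite powRr1 ?divr_ge0 ?(ltW rho0) ?(ltW r0) //.
apply: (@coverable_le _ _ _ (2 * (2 * rho) / r + 1)).
  have : 1 <= rho / r by rewrite ler_pdivlMr // mul1r; exact: le_trans h1 h2.
  by rewrite mulrA -[2 * 2 * rho / r]mulrA; lra.
apply: coverable_diam => //; first by rewrite mulr_ge0 // ltW.
move=> y z [yx _] [zx _]; move: yx zx; rewrite /ball /=.
by have := ler_distD x y z; rewrite (distrC y x); lra.
Qed.

Variable p : R.
Hypothesis p1 : 1 < p.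
Let p0 : 0 < p. Proof. exact: lt_trans p1. Qed.
Let pp0 : 0 < p + 1. Proof. by rewrite addr_gt0. Qed.

(* [E] is as dense near 0 as the set of all [n ^ (-p)]. *)
Definition power_dense E := exists C t0, [/\ 0 < C, 0 < t0 & forall t, 0 < t -> t < t0 ->
  exists e, [/\ E e, 0 < e & `|e - t| <= C * t `^ (1 + p^-1)]].

(** The gap t^(1+1/p) of [E] near t is at most r for t <= r^(p/(p+1)), so [E] has a point within C r
    of every multiple of K r below y / 2; K = 2 C + 2 keeps these points 2 r apart. *)
Lemma power_dense_count E : power_dense E -> exists D y0, [/\ 0 < D, 0 < y0 &
  forall r y N, 0 < r -> 0 < y -> y < y0 -> y <= r `^ (p / (p + 1)) ->
    coverable (E `&` [set x | 0 < x < y]) r N -> D * (y / r) - 1 <= N].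
Proof.
move=> [C [t0 [C0 t00 hE]]]; pose K := 2 * C + 2.
have K0 : 0 < K by rewrite /K; lra.
exists (2 * K)^-1, t0; split=> //; first by rewrite invr_gt0 mulr_gt0.
move=> r y N r0 y_gt0 yt0 yr hN; pose J := Num.truncn (y / (2 * K * r)).
have KJ : J%:R * (2 * K * r) <= y.
  by rewrite -ler_pdivlMr ?mulr_gt0 // truncn_le ltW // divr_gt0 ?mulr_gt0.
have pt (j : nat) : exists e, (j < J)%N -> [/\ E e,
  0 < e < y & `|e - j.+1%:R * (K * r)| <= C * r].
  have [jJ|] := boolP (j < J)%N; last by exists 0.
  set t := j.+1%:R * (K * r).
  have tpos : 0 < t by rewrite !mulr_gt0.
  have jJ' : (j.+1%:R : R) <= J%:R by rewrite ler_nat.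
  have Kr0 : 0 < K * r by rewrite mulr_gt0.
  have ty : t <= y / 2.
    apply: (@le_trans _ _ (J%:R * (K * r))); first by rewrite ler_pM2r.
    by lra.
  have [|e [Ee e0 et]] := hE t tpos; first by lra.
  have tr : t `^ (1 + p^-1) <= r.
    apply: (@le_trans _ _ ((r `^ (p / (p + 1))) `^ (1 + p^-1))).
      apply: ge0_ler_powR; rewrite ?nnegrE ?powR_ge0 ?(ltW tpos) ?addr_ge0 ?invr_ge0 ?(ltW p0)
        //; lra.
    rewrite -powRrM (_ : _ * _ = 1) ?powRr1 ?(ltW r0) //.
    by field; rewrite !gt_eqF.
  have et' : `|e - t| <= C * r by apply: le_trans et _; rewrite ler_pM2l.
  exists e => _; split=> //; rewrite e0 /=.
  have j1 : (1 : R) <= j.+1%:R by rewrite ler1n.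
  have tK : K * r <= t by rewrite ler_peMl // ltW.
  have Kr2 : K * r = 2 * (C * r) + 2 * r by rewrite /K; ring.
  by move: et'; rewrite ler_norml; lra.
have [f hf] := choice pt.
have JN : (J%:R : R) <= N.
  rewrite -(size_iota 0 J); apply: (coverable_points (f := f) _ _ _ hN); first exact: iota_uniq.
    by move=> j; rewrite mem_iota /= => /hf[].
  move=> j k; rewrite !mem_iota /= => /hf[_ _ hj] /hf[_ _ hk].
  wlog jk : j k hj hk / (j < k)%N.
    move=> H hlt; have [jk|kj|//] := ltngtP j k; first exact: H.
    by apply/esym; apply: H => //; rewrite distrC.
  have jk' : (j.+1%:R : R) + 1 <= k.+1%:R by rewrite natr1 ler_nat.
  move: hj hk; rewrite !ler_norml ltr_norml => /andP[h1 h2] /andP[h3 h4] /andP[h5 h6]; exfalso.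
  have : (j.+1%:R + 1) * (K * r) <= k.+1%:R * (K * r) by rewrite ler_wpM2r // mulr_ge0 // ltW.
  have : K * r = 2 * (C * r) + 2 * r by rewrite /K; ring.
  by rewrite (mulrDl j.+1%:R 1) mul1r; lra.
apply: le_trans JN; rewrite lerBlDr natr1; apply: ltW.
by rewrite (_ : _ * (y / r) = y / (2 * K * r)) ?truncnS_gt //; field; rewrite !gt_eqF.
Qed.

Lemma power_dense_small E rho : power_dense E -> 0 < rho -> exists x, [/\ E x, 0 < x & x < rho].
Proof.
move=> [C [t0 [C0 t00 hE]]] r0.
pose t := Num.min (Num.min (t0 / 2) 1) (rho / (2 * (1 + C))).
have tpos : 0 < t by rewrite !lt_min ltr01 !divr_gt0 // mulr_gt0 // addr_gt0.
have tt0 : t < t0 by rewrite !gt_min; apply/orP; left; apply/orP; left; lra.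
have t1 : t <= 1 by rewrite !ge_min lexx orbT.
have tr : t <= rho / (2 * (1 + C)) by rewrite !ge_min lexx !orbT.
have [e [Ee e0 et]] := hE t tpos tt0; exists e; split=> //.
have te : t `^ (1 + p^-1) <= t.
  rewrite -[leRHS](powRr1 (ltW tpos)); apply: ger_powR; first by rewrite tpos.
  by rewrite lerDl invr_ge0 ltW.
have : t * (2 * (1 + C)) <= rho by rewrite -ler_pdivlMr // mulr_gt0 // addr_gt0.
have : C * t `^ (1 + p^-1) <= C * t by rewrite ler_pM2l.
by move: et; rewrite ler_norml => /andP[_]; nra.
Qed.

(** The test ball is centred at a point of [E] in (0, r), and the points of [E] in (0, r^a) are
    counted. *)
Lemma power_dense_spectrum_ge E theta : power_dense E -> 0 < theta -> theta < 1 ->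
  ((Num.min 1 ((1 + p) * (1 - theta))^-1)%:E <= assouad_spectrum_open theta E)%E.
Proof.
move=> dE t0 t1; apply: assouad_spectrum_open_ge => alpha [C C0 hC].
have ti1 : 1 < theta^-1 by rewrite invf_gt1.
have [D [y0 [D0 y00 hD]]] := power_dense_count dE.
set k := p / (p + 1) in hD; have k0 : 0 < k by rewrite divr_gt0.
have k1 : k < 1 by rewrite ltr_pdivrMr // mul1r ltrDl.
(* The smallest exponent for which (0, r^a) lies in the ball and in the range where [E] is dense at
   scale r^(1/theta). *)
pose a := Num.max 1 (k / theta).
have a1 : 1 <= a by rewrite le_max lexx.
have at1 : a < theta^-1.
  by rewrite gt_max ti1 /= -[ltRHS]mul1r ltr_pM2r ?invr_gt0.
(* The minimum with 0 makes r^b >= 1, which absorbs the -1 of the count; as a < 1/theta, the bound b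
   <= a - 1/theta then concerns the first entry. *)
pose b := Num.min (alpha * (1 - theta^-1)) 0.
have ba : b <= a - theta^-1.
  apply: (@powR_compare _ _ (D^-1 * (C + 1)) (Num.min 1 y0)).
  - by rewrite mulr_gt0 ?invr_gt0 // addr_gt0.
  - by rewrite lt_min ltr01.
  move=> r r0; rewrite lt_min => /andP[r1 ry].
  have r01 : 0 < r <= 1 by rewrite r0 ltW.
  have [x [Ex x0 xr]] := power_dense_small dE r0.
  have yr : r `^ a <= r by rewrite -[leRHS](powRr1 (ltW r0)); apply: ger_powR.
  have hcov : coverable (E `&` [set z | 0 < z < r `^ a]) (r `^ theta^-1) (C * r `^ (alpha * (1 -
    theta^-1))).
    apply: coverable_sub (hC x Ex r r0 (ltW r1)) => z [Ez /andP[z0 zr]]; split=> //.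
    by rewrite /ball /= ltr_norml; apply/andP; split; lra.
  have : D * (r `^ a / r `^ theta^-1) - 1 <= C * r `^ (alpha * (1 - theta^-1)).
    apply: hD hcov; rewrite ?powR_gt0 //; first exact: le_lt_trans yr ry.
    by rewrite -powRrM; apply: ger_powR => //; rewrite mulrC le_max lexx orbT.
  have -> : r `^ a / r `^ theta^-1 = r `^ (a - theta^-1) by rewrite -powRN powRDm.
  have h1 : r `^ (alpha * (1 - theta^-1)) <= r `^ b by apply: ger_powR => //; rewrite ge_min lexx.
  have h2 : 1 <= r `^ b by apply: powR_ge1 => //; rewrite ge_min lexx orbT.
  move=> h; rewrite -mulrA ler_pdivlMl //; nra.
have ab : alpha * (1 - theta^-1) <= a - theta^-1.
  by move: ba; rewrite /b ge_min => /orP[//|]; lra.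
have th1 : 0 < theta^-1 - 1 by lra.
have h : (theta^-1 - a) / (theta^-1 - 1) <= alpha by rewrite ler_pdivrMr //; lra.
apply: le_trans h; have tt : 0 < 1 - theta by lra.
rewrite /a ge_min; have [ka|ka] := leP (k / theta) 1.
  by rewrite divff ?lexx // gt_eqF.
apply/orP; right; rewrite le_eqVlt; apply/orP; left; apply/eqP.
have th0 : theta^-1 - 1 = (1 - theta) / theta by field; rewrite gt_eqF.
rewrite th0 /k; field; rewrite !gt_eqF //; lra.
Qed.

End SpectrumDefs.

(** * Density of F and of P near 0 *)

Section LowerBounds.
Context {R : realType}.
Variables (p : R).
Hypothesis p1 : 1 < p.
Implicit Types (E : set R) (t r rho theta alpha : R).
Let p0 : 0 < p. Proof. exact: lt_trans p1. Qed.
Let pp0 : 0 < p + 1. Proof. by rewrite addr_gt0. Qed.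

Definition floor_pow (n : nat) : nat := `|Num.floor ((n%:R : R) `^ p)|%N.

Lemma floor_powE n : (floor_pow n)%:Z = Num.floor ((n%:R : R) `^ p).
Proof. by rewrite /floor_pow gez0_abs // floor_ge0 powR_ge0. Qed.

Lemma floor_pow_itv n : (floor_pow n)%:R <= (n%:R : R) `^ p < (floor_pow n).+1%:R.
Proof.
have := floor_itv (n%:R `^ p : R); rewrite -floor_powE rmorphD /= -!pmulrn.
by rewrite mulr1n natr1.
Qed.

Lemma floor_pow_ge n : (n <= floor_pow n)%N.
Proof.
have /andP[_ h] := floor_pow_itv n; rewrite -ltnS -(ltr_nat R); apply: le_lt_trans h.
case: n => [|n]; first exact: powR_ge0.
by apply: le1r_powR; [rewrite ler1n|exact: ltW].
Qed.

(** A mean value bound obtained from (1 + 1/x)^p <= exp(p/x) and exp(y) - 1 <= y exp(y); the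
    constant is not optimal. *)
Lemma powR_succ_sub (x : R) : 1 <= x -> (x + 1) `^ p - x `^ p <= p * expR p * x `^ (p - 1).
Proof.
move=> x1; have x0 : 0 < x by lra.
have y0 : 0 < 1 + x^-1 by rewrite addr_gt0 // invr_gt0.
have xi1 : x^-1 <= 1 by rewrite invf_le1.
have xi0 : 0 < x^-1 by rewrite invr_gt0.
have -> : x + 1 = x * (1 + x^-1) by rewrite mulrDr mulr1 divff // gt_eqF.
rewrite powRM ?(ltW x0) ?(ltW y0) //.
have h1 : (1 + x^-1) `^ p <= expR (p / x).
  rewrite /powR gt_eqF // ler_expR ler_pM2l //.
  apply: le_ln1Dx; lra.
have h2 : expR (p / x) - 1 <= p / x * expR (p / x).
  have := expR_ge1Dx (- (p / x)); rewrite expRN => h.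
  have e0 := expR_gt0 (p / x).
  have : (1 - p / x) * expR (p / x) <= 1 by rewrite -ler_pdivlMr // mul1r.
  by lra.
have h3 : expR (p / x) <= expR p by rewrite ler_expR ler_piMr // ltW.
have xp : x `^ p = x `^ (p - 1) * x.
  by rewrite -{3}(powRr1 (ltW x0)) powRDm // subrK.
have q0 := powR_ge0 x (p - 1).
apply: (@le_trans _ _ (x `^ p * (p / x * expR p))).
  rewrite -[X in _ - X]mulr1 -mulrBr ler_wpM2l ?powR_ge0 //.
  have : p / x * expR (p / x) <= p / x * expR p by rewrite ler_wpM2l // divr_ge0 // ltW.
  by lra.
by rewrite xp le_eqVlt; apply/orP; left; apply/eqP; field; rewrite gt_eqF.
Qed.

(** For n just above t^(-1/p), the reciprocal of the point is within order t^(1/p-1) of 1/t;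
    inverting multiplies this by e t <= 2 t^2. The condition t < 1/2 gives 1/t - 1 >= 1/(2t), hence
    e <= 2 t. *)
Lemma power_dense_reciprocals E :
  (exists n0, forall n, (n0 <= n)%N ->
     exists2 e, E e & ((floor_pow n).+1%:R)^-1 <= e <= ((floor_pow n)%:R)^-1) ->
  power_dense p E.
Proof.
move=> [n0 hn]; pose K := p * expR p + 1.
have K0 : 0 < K by rewrite addr_gt0 // mulr_gt0 // expR_gt0.
exists (2 * K), (Num.min (2^-1) (n0.+1%:R `^ (- p))); split.
- by rewrite mulr_gt0.
- by rewrite lt_min invr_gt0 powR_gt0 // ltr0n.
move=> t t0; rewrite lt_min => /andP[t2 tn]; pose x := t `^ (- p^-1).
have x0 : 0 < x by exact: powR_gt0.
have ti0 : 0 < t^-1 by rewrite invr_gt0.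
have xp : x `^ p = t^-1.
  by rewrite /x -powRrM mulNr mulVf ?gt_eqF // powR_inv1 // ltW.
have ti2 : 2 < t^-1 by rewrite -[ltLHS]invrK ltf_pV2 ?posrE ?invr_gt0.
have xn0 : n0.+1%:R < x.
  rewrite ltNge; apply/negP => xn; move: tn; apply/negP; rewrite -leNgt powRN -[leRHS]invrK.
  rewrite lef_pV2 ?posrE ?powR_gt0 ?ltr0n // -xp.
  by apply: ge0_ler_powR; rewrite ?nnegrE ?(ltW p0) ?(ltW x0).
have x1 : 1 <= x by apply: ltW; apply: le_lt_trans xn0; rewrite ler1n.
pose n := (Num.truncn x).+1.
have /andP[nx xn] := truncn_itv (ltW x0); rewrite -/n in xn.
have nx1 : (n%:R : R) <= x + 1 by rewrite /n -natr1 lerD2r.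
have n0n : (n0 <= n)%N by do 2 apply: ltnW; rewrite -(ltr_nat R); exact: lt_trans xn0 xn.
have [e Ee /andP[e1 e2]] := hn n n0n.
have /andP[b1 b2] := floor_pow_itv n; set b := floor_pow n in e1 e2 b1 b2.
have e0 : 0 < e by apply: lt_le_trans e1; rewrite invr_gt0.
exists e; split=> //.
have npl : x `^ p <= n%:R `^ p.
  by apply: ge0_ler_powR; rewrite ?nnegrE ?(ltW p0) ?(ltW x0) // ltW.
have npu : n%:R `^ p <= (x + 1) `^ p.
  by apply: ge0_ler_powR; rewrite ?nnegrE ?(ltW p0) ?addr_ge0 ?(ltW x0).
move: b2; rewrite -natr1 => b2.
have b0 : (0 : R) < b%:R by lra.
have ei1 : e^-1 <= b%:R + 1 by rewrite natr1 -[leRHS]invrK lef_pV2 ?posrE ?invr_gt0.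
have ei2 : b%:R <= e^-1 by rewrite -[leLHS]invrK lef_pV2 ?posrE ?invr_gt0.
have hx := powR_succ_sub x1.
have xp1 : 1 <= x `^ (p - 1).
  by rewrite -[leLHS](powRr0 x); apply: ler_powR => //; rewrite subr_ge0 ltW.
have dist : `|t^-1 - e^-1| <= K * x `^ (p - 1).
  rewrite /K mulrDl mul1r ler_norml; apply/andP; split; lra.
have et2 : e <= 2 * t.
  rewrite -[leLHS]invrK -[leRHS]invrK lef_pV2 ?posrE ?invr_gt0 ?mulr_gt0 // invfM; lra.
have xt : x `^ (p - 1) = t `^ (p^-1 - 1).
  by rewrite /x -powRrM; congr (_ `^ _); field; rewrite gt_eqF.
have -> : e - t = (e * t) * (t^-1 - e^-1) by field; rewrite !gt_eqF.
rewrite normrM gtr0_norm ?mulr_gt0 //.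
apply: (@le_trans _ _ (2 * t * t * (K * x `^ (p - 1)))).
  apply: ler_pM => //; first by rewrite mulr_ge0 // ltW.
  by rewrite ler_pM2r.
rewrite xt (_ : 1 + p^-1 = 1 + 1 + (p^-1 - 1)); last by ring.
rewrite -!powRDm // powRr1 ?(ltW t0) //.
by rewrite le_eqVlt; apply/orP; left; apply/eqP; ring.
Qed.

Variable I : set nat.
Hypothesis I_fin : finite_set (I `+` floor_powers p).
Hypothesis I_pos : forall b, I b -> (0 < b)%N.
Local Notation F := (cf_set I : set R).

Lemma floor_pow_eventually : exists n0, forall n, (n0 <= n)%N -> I (floor_pow n).
Proof.
have [D [_ hD]] := floor_powers_cases I_fin.
exists (\max_(b <- D) b).+1 => n hn; apply/hD; last first.
  by exists n; [exact: leq_trans hn|rewrite floor_powE].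
apply/negP => bD; have := leq_trans hn (floor_pow_ge n).
by rewrite ltnNge (big_rem _ bD) /= leq_maxl.
Qed.

Lemma power_dense_cf_set : F !=set0 -> power_dense p F.
Proof.
move=> [z Fz]; apply: power_dense_reciprocals.
have [n0 hn] := floor_pow_eventually; exists n0 => n /hn Ib.
exists (cf_map (floor_pow n) z); first exact: (cf_set_map I_pos).
have /andP[z0 z1] := cf_set_itv Fz; have b0 := I_pos Ib.
have b0' : (0 : R) < (floor_pow n)%:R by rewrite ltr0n.
by rewrite /cf_map !lef_pV2 ?posrE ?addr_gt0 // -?natr1; lra.
Qed.

(** The digit 1 is left out because the map 1/(1 + x) is not in the system when 1 is in I. *)
Lemma ifs_section_itv (P : set R) b : ifs_section (cf_ifs I) P -> I b -> (1 < b)%N ->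
  exists2 e, P e & (b.+1%:R)^-1 <= e <= (b%:R)^-1.
Proof.
move=> [_ hP] Ib b1; have b0 : (0 : R) < b%:R by rewrite ltr0n ltnW.
have Sb : cf_ifs I (cf_map b : R -> R).
  rewrite /cf_ifs; case: ifP => _; last by exists b.
  by left; exists b => //; split=> //= b1'; rewrite b1' in b1.
have [e [[Pe [x x01 xe]] _]] := hP _ Sb; move: x01; rewrite /= in_itv /= => /andP[x0 x1].
exists e => //; rewrite -xe /cf_map !lef_pV2 ?posrE -?natr1; lra.
Qed.

Lemma power_dense_section (P : set R) : ifs_section (cf_ifs I) P -> power_dense p P.
Proof.
move=> hP; apply: power_dense_reciprocals.
have [n0 hn] := floor_pow_eventually; exists (maxn n0 2) => n;
  rewrite geq_max => /andP[/hn Ib n2].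
apply: ifs_section_itv => //; exact: leq_trans n2 (floor_pow_ge n).
Qed.

End LowerBounds.

(** * Copies of F with first digit of order 1/rho *)

Section FirstRegime.
Context {R : realType}.
Variables (p h : R) (I : set nat).
Hypothesis p1 : 1 < p.
Hypothesis I_fin : finite_set (I `+` floor_powers p).
Hypothesis I_pos : forall b, I b -> (0 < b)%N.
Hypothesis hE : hausdorff_dim (cf_set I : set R) = h%:E.
Implicit Types (t r rho theta alpha : R).
Local Notation F := (cf_set I : set R).
Let p0 : 0 < p. Proof. exact: lt_trans p1. Qed.
Local Notation fp := (floor_pow p).

(** Only even arguments are used: digits then differ by at least 2, and the tails in (0, 1) cannot
    close the gap. *)
Let fp_gap n m : (0 < n)%N -> (n < m)%N -> (fp (2 * n) + 2 <= fp (2 * m))%N.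
Proof.
move=> n0 nm; rewrite -ltnS -(ltr_nat R).
have /andP[_ h1] := floor_pow_itv p (2 * m); apply: le_lt_trans h1.
have /andP[h2 _] := floor_pow_itv p (2 * n); rewrite natrD.
have n1 : (1 : R) <= (2 * n)%:R by rewrite ler1n muln_gt0.
have n0' : (0 : R) < (2 * n)%:R by lra.
have nm' : (2 * n)%:R + 2 <= (2 * m)%:R :> R by rewrite -natrD ler_nat; lia.
have nmW : (2 * n)%:R <= (2 * m)%:R :> R by lra.
have := powR_sub_ge p1 n0' nmW.
have : 1 <= (2 * n)%:R `^ (p - 1) :> R.
  rewrite -[leLHS](powRr0 (2 * n)%:R); apply: ler_powR => //; rewrite subr_ge0; exact: ltW.
by nra.
Qed.

(** About rho^(-1/p) digits of order 1/rho give copies of F of size rho^2 inside the ball, each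
    needing about (rho^2 / r)^t balls. Their gaps are of order rho^2, which exceeds r =
    rho^(1/theta) for small rho since theta < 1/2. *)
Lemma cf_set_spectrum_exponent_le t theta alpha : 0 < t -> t < h -> 0 < theta -> theta < 2^-1 ->
  F !=set0 -> spectrum_exponent theta F alpha ->
  alpha * (1 - theta^-1) <= 2 * t - p^-1 - t / theta.
Proof.
move=> t0 th th0 th2 F0 [C C0 hC].
have [c c0 hc] := coverable_lower hE t0 th.
have [n0 hn0] := floor_pow_eventually p1 I_fin.
have dF := power_dense_cf_set p1 I_fin I_pos F0.
have ti2 : 2 < theta^-1 by rewrite -[ltLHS]invrK ltf_pV2 ?posrE ?invr_gt0.
have ti20 : 0 < theta^-1 - 2 by lra.
have pi0 : 0 < p^-1 by rewrite invr_gt0.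
(* The arguments 2 n used below are at most 8 rho^(-1/p), so the digits plus 1 are at most Q /
   rho. *)
pose Q : R := 8 `^ p + 1.
have P8 : 0 < 8 `^ p :> R by exact: powR_gt0.
have Q0 : 0 < Q by rewrite /Q; lra.
have Q2 : 0 < 8 * Q ^+ 2 by rewrite mulr_gt0 // exprn_gt0.
pose K := (8 * Q ^+ 2) `^ (- t); have K0 : 0 < K by exact: powR_gt0.
(* The second entry brings the digits into I; the third gives 8 Q^2 r <= rho^2, needed both for the
   separation and for rescaled radii at most 1. *)
pose r0 := Num.min (Num.min 1 (n0.+1%:R `^ (- p))) ((8 * Q ^+ 2)^-1 `^ (theta^-1 - 2)^-1).
apply: (@powR_compare _ _ _ (C / (c * K)) r0).
- by rewrite divr_gt0 // mulr_gt0.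
- by rewrite !lt_min ltr01 !powR_gt0 ?invr_gt0 // ltr0n.
move=> rho rho0; rewrite !lt_min => /andP[/andP[rho1 rhon] rhoQ].
set r := rho `^ theta^-1; have rp : 0 < r by exact: powR_gt0.
have rhoi : 1 < rho^-1 by rewrite invf_gt1.
have rQ : r * (8 * Q ^+ 2) <= rho ^+ 2.
  have -> : r = rho ^+ 2 * rho `^ (theta^-1 - 2).
    by rewrite -powR_mulrn ?(ltW rho0) // powRDm //; congr (_ `^ _); ring.
  rewrite -mulrA ler_piMr ?exprn_ge0 ?(ltW rho0) // -ler_pdivlMr // mul1r.
  apply: (@le_trans _ _ (((8 * Q ^+ 2)^-1 `^ (theta^-1 - 2)^-1) `^ (theta^-1 - 2))).
    by apply: ge0_ler_powR; rewrite ?nnegrE ?powR_ge0 ?(ltW ti20) ?(ltW rho0) ?(ltW rhoQ).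
  by rewrite -powRrM mulVf ?gt_eqF // powRr1 // invr_ge0 ltW.
pose u := rho `^ (- p^-1); have u0 : 0 < u by exact: powR_gt0.
have up : u `^ p = rho^-1.
  by rewrite /u -powRrM mulNr mulVf ?gt_eqF // powR_inv1 // ltW.
have un0 : n0.+1%:R < u.
  rewrite ltNge; apply/negP => un; move: rhon; apply/negP; rewrite -leNgt powRN -[leRHS]invrK.
  rewrite lef_pV2 ?posrE ?invr_gt0 ?powR_gt0 ?ltr0n // -up.
  by apply: ge0_ler_powR; rewrite ?nnegrE ?(ltW p0) ?(ltW u0).
have u1 : 1 <= u by apply: ltW; apply: le_lt_trans un0; rewrite ler1n.
(* The integers in [m, 2m) exceed u = rho^(-1/p), and there are at least u of them. *)
pose m := (Num.truncn u).+1.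
have /andP[mu um] := truncn_itv (ltW u0); rewrite -/m in um.
have m2u : (m%:R : R) <= 2 * u by rewrite /m -natr1; lra.
have fpP n : n \in iota m m -> [/\ (0 < n)%N, I (fp (2 * n)),
  rho^-1 <= (fp (2 * n))%:R & (fp (2 * n))%:R + 1 <= Q / rho].
  rewrite mem_iota => /andP[mn nm].
  have n0' : (0 < n)%N by exact: leq_trans mn.
  have un : u < n%:R by apply: lt_le_trans um _; rewrite ler_nat.
  have nu : (n%:R : R) < 4 * u.
    apply: (@lt_le_trans _ _ (m + m)%:R); first by rewrite ltr_nat.
    by rewrite natrD; lra.
  have /andP[b1 b2] := floor_pow_itv p (2 * n).
  have h2 : 2 * rho^-1 <= (2 * n)%:R `^ p.
    apply: (@le_trans _ _ ((2 * u) `^ p)).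
      rewrite powRM ?(ltW u0) // up ler_pM2r ?invr_gt0 //.
      by apply: le1r_powR; [rewrite ler1n|exact: ltW].
    by apply: ge0_ler_powR; rewrite ?nnegrE ?(ltW p0) ?mulr_ge0 ?(ltW u0) // natrM ler_pM2l //
      ltW.
  have h8 : (2 * n)%:R `^ p <= 8 `^ p * rho^-1.
    rewrite -up -powRM ?(ltW u0) //.
    by apply: ge0_ler_powR; rewrite ?nnegrE ?(ltW p0) ?mulr_ge0 ?(ltW u0) // natrM; lra.
  split=> //.
  - apply: hn0; apply: (@leq_trans n); last by rewrite leq_pmull.
    by do 2 apply: ltnW; rewrite -(ltr_nat R); exact: lt_trans un0 un.
  - by move: b2; rewrite -natr1; lra.
  - by rewrite /Q mulrDl mul1r; lra.
have [x [Fx x0 xrho]] := power_dense_small p1 dF rho0.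
have hcov := hC x Fx rho rho0 (ltW rho1).
have : \sum_(n <- iota m m) c * (K * (rho ^+ 2 / r) `^ t) <= C * rho `^ (alpha * (1 - theta^-1)).
  apply: (@coverable_separated _ _ _ (fun n => cf_map (fp (2 * n)) @` F) _ _ _ _ _ _ _ _ hcov).
  - exact: iota_uniq.
  - move=> n /fpP[n0' In bl bu] _ [z Fz <-]; split; last exact: (cf_set_map I_pos).
    have /andP[z0 z1] := cf_set_itv Fz.
    have b0 : (0 : R) < (fp (2 * n))%:R by lra.
    have y0 : 0 < cf_map (fp (2 * n)) z by rewrite invr_gt0 addr_gt0.
    have yr : cf_map (fp (2 * n)) z < rho.
      by rewrite /cf_map -[ltRHS]invrK ltf_pV2 ?posrE ?invr_gt0 ?addr_gt0 //; lra.
    by rewrite /ball /= ltr_norml; apply/andP; split; lra.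
  - move=> n n' _ _ nl nl' [z Fz <-] [z' Fz' <-].
    wlog nn' : n n' z z' nl nl' Fz Fz' / (n < n')%N.
      move=> H hlt; have [nn'|nn'|//] := ltngtP n n'; first exact: (H n n' z z').
      by apply/esym; apply: (H n' n z' z) => //; rewrite distrC.
    have [n0' In bl bu] := fpP n nl; have [_ _ bl' bu'] := fpP n' nl'.
    have := fp_gap n0' nn'; rewrite -(ler_nat R) natrD => gap.
    have /andP[z0 z1] := cf_set_itv Fz; have /andP[z0' z1'] := cf_set_itv Fz'.
    set b := fp (2 * n) in bl bu gap *; set b' := fp (2 * n') in bl' bu' gap *.
    have bz0 : 0 < b%:R + z by lra. have bz0' : 0 < b'%:R + z' by lra.
    move=> hlt; exfalso; move: hlt; apply/negP; rewrite -leNgt.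
    apply: le_trans (ler_norm _).
    have -> : cf_map b z - cf_map b' z' = (b'%:R + z' - (b%:R + z)) / ((b%:R + z) * (b'%:R + z')).
      by rewrite /cf_map; field; rewrite !gt_eqF.
    rewrite ler_pdivlMr ?mulr_gt0 //; apply: (@le_trans _ _ 1); last by lra.
    apply: (@le_trans _ _ (2 * r * ((Q / rho) * (Q / rho)))).
      apply: ler_wpM2l; first by rewrite mulr_ge0 // ltW.
      by apply: ler_pM; [exact: ltW|exact: ltW|lra|lra].
    rewrite (_ : _ * _ = 2 * r * Q ^+ 2 / rho ^+ 2); last by field; rewrite gt_eqF.
    by rewrite ler_pdivrMr ?exprn_gt0 // mul1r; have := mulr_gt0 rp Q2; lra.
  move=> n N' /fpP[n0' In bl bu] hN'.
  set b := fp (2 * n) in In bl bu hN'.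
  have b0 := I_pos In; have b0' : (0 : R) < b%:R by rewrite ltr0n.
  have L0 : 0 < (4 * b%:R ^+ 2 : R)^-1 by rewrite invr_gt0 mulr_gt0 // exprn_gt0.
  have F01 z : F z -> 0 <= z <= 1 by move=> /cf_set_itv/andP[? ?]; rewrite !ltW.
  have := coverable_preimage L0 (fun x y Fx Fy => cf_map_dist_ge b0 (F01 x Fx) (F01 y Fy)) hN'.
  rewrite invrK (_ : 2 * r * _ = 8 * r * b%:R ^+ 2); last by ring.
  have bQ : (b%:R : R) ^+ 2 <= Q ^+ 2 / rho ^+ 2.
    by rewrite -expr_div_n; apply: lerXn2r; rewrite ?nnegrE ?divr_ge0 ?(ltW Q0) ?(ltW rho0) //;
      lra.
  have r'0 : 0 < 8 * r * b%:R ^+ 2 by rewrite !mulr_gt0 // exprn_gt0.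
  have r'le : 8 * r * b%:R ^+ 2 <= 8 * Q ^+ 2 * (r / rho ^+ 2).
    rewrite (_ : 8 * Q ^+ 2 * _ = 8 * r * (Q ^+ 2 / rho ^+ 2)); last by ring.
    by rewrite ler_wpM2l // mulr_ge0 // ltW.
  have r'1 : 8 * r * b%:R ^+ 2 <= 1.
    apply: le_trans r'le _; rewrite mulrA ler_pdivrMr ?exprn_gt0 // mul1r; lra.
  move=> /(hc _ _ r'0 r'1); apply: le_trans; rewrite ler_pM2l //.
  have rr0 : 0 <= rho ^+ 2 / r by rewrite divr_ge0 ?exprn_ge0 ?ltW.
  rewrite /K powRN -powRV ?(ltW Q2) // -powRM // ?invr_ge0 ?(ltW Q2) // powRN -powRV ?(ltW r'0)
    //.
  apply: ge0_ler_powR; rewrite ?nnegrE ?(ltW t0) ?invr_ge0 ?(ltW r'0) //.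
    by rewrite mulr_ge0 // invr_ge0 ltW.
  rewrite -[leLHS]invrK lef_pV2 ?posrE //; last first.
    by rewrite invr_gt0 mulr_gt0 ?invr_gt0 // divr_gt0 // exprn_gt0.
  apply: le_trans r'le _; rewrite le_eqVlt; apply/orP; left; apply/eqP.
  by field; rewrite !gt_eqF.
rewrite big_const_seq count_predT size_iota iter_addr_0 => hsum.
rewrite [leRHS]mulrAC ler_pdivlMr ?mulr_gt0 //; apply: le_trans hsum; rewrite -[leRHS]mulr_natl.
have -> : (rho ^+ 2 / r) `^ t = rho `^ (2 * t - t / theta).
  rewrite powRM ?exprn_ge0 ?invr_ge0 ?(ltW rho0) ?(ltW rp) // powRV ?(ltW rp) // -powRN.
  by rewrite -powR_mulrn ?(ltW rho0) // /r -!powRrM powRDm //; congr (_ `^ _); ring.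
have -> : rho `^ (2 * t - p^-1 - t / theta) = u * rho `^ (2 * t - t / theta).
  by rewrite powRDm //; congr (_ `^ _); ring.
rewrite (_ : u * _ * _ = u * (c * (K * rho `^ (2 * t - t / theta)))); last by ring.
by rewrite ler_wpM2r ?mulr_ge0 ?powR_ge0 ?(ltW c0) // ltW.
Qed.

End FirstRegime.

(** * Upper spectrum of P *)

Section SectionUpper.
Context {R : realType}.
Variables (p : R) (I : set nat) (P : set R).
Hypothesis p1 : 1 < p.
Hypothesis I_fin : finite_set (I `+` floor_powers p).
Hypothesis I_pos : forall b, I b -> (0 < b)%N.
Hypothesis hP : ifs_section (cf_ifs I) P.
Let p0 : 0 < p. Proof. exact: lt_trans p1. Qed.
Let pp0 : 0 < p + 1. Proof. by rewrite addr_gt0. Qed.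

(** Maps are indexed by pairs because the classes of a covering are listed in a type with decidable
    equality. *)
Let branch (c : bool * nat) : R -> R := if c.1 then cf_map1 c.2 else cf_map c.2.

Let P_branch y : P y -> exists c, [/\ I c.2, cf_ifs I (branch c) & (branch c @` `[0, 1]) y].
Proof.
move=> /hP.1[S]; rewrite /cf_ifs; case: ifP => I1.
  move=> [[b [Ib b1] <-]|[b Ib <-]] Sy; [exists (false, b)|exists (true, b)]; split=> //=.
    by left; exists b.
  by right; exists b.
by move=> [b Ib <-] Sy; exists (false, b); split=> //=; exists b.
Qed.

Let branch_itv c y : I c.2 -> (branch c @` `[0, 1]) y -> 0 <= y <= (c.2%:R)^-1.
Proof.
move=> Ic [x]; rewrite /= in_itv /= => /andP[x0 x1] <-.
have b0 : (0 : R) < c.2%:R by rewrite ltr0n I_pos.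
rewrite /branch; case: ifP => _; rewrite /cf_map1 /cf_map invr_ge0.
  have i0 : 0 <= (1 + x)^-1 by rewrite invr_ge0 addr_ge0.
  by rewrite addr_ge0 ?(ltW b0) //= lef_pV2 ?posrE ?ltr_wpDr // lerDl.
by rewrite addr_ge0 ?(ltW b0) //= lef_pV2 ?posrE ?ltr_wpDr // lerDl.
Qed.

(** The cut at r^(-p/(p+1)) as for F, but each map now contributes a single point, and at most two
    maps share a digit. *)
Lemma section_coverable : exists2 C : R, 0 < C & forall r, 0 < r -> r <= 1 ->
  coverable P r (C * r `^ (- (p + 1)^-1)).
Proof.
have [C C0 hC] := count_le p1 I_fin.
exists (2 * C + 2) => [|r r0 r1]; first by rewrite addr_gt0 ?mulr_gt0.
set k := p / (p + 1).
have k0 : 0 < k by rewrite divr_gt0.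
have kE : k - 1 = - (p + 1)^-1 by rewrite /k; field; rewrite gt_eqF.
have pi0 : 0 < (p + 1)^-1 by rewrite invr_gt0.
have [|l ls hl] := hC (r `^ (- k)); first by apply: powR_ge1; [rewrite r0|rewrite oppr_le0 ltW].
have rs1 : 1 <= r `^ (- (p + 1)^-1) by apply: powR_ge1; [rewrite r0|rewrite oppr_le0 ltW].
rewrite (mulrDl (2 * C)).
pose cs := [seq (true, b) | b <- l] ++ [seq (false, b) | b <- l].
pose Rel c y := cf_ifs I (branch c) /\ (branch c @` `[0, 1]) y.
apply: (@coverable_cup _ _ [set y | P y /\ exists2 c,
  c \in cs & Rel c y] [set y | 0 <= y <= 0 + r `^ k]).
- move=> y Py; have [c [Ic cS cy]] := P_branch Py; have /andP[y0 yc] := branch_itv Ic cy.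
  have b0 : (0 : R) < c.2%:R by rewrite ltr0n I_pos.
  have [ck|kc] := leP (c.2%:R : R) (r `^ (- k)).
    left; split=> //; exists c => //; rewrite mem_cat; have := hl _ Ic ck.
    by case: c {Ic cS cy yc b0 ck} => -[] b /= bl; apply/orP; [left|right]; exact: map_f.
  right; rewrite /= y0 add0r /=; apply: le_trans yc _.
  by rewrite -[leRHS]invrK lef_pV2 ?posrE ?invr_gt0 ?powR_gt0 // -powRN ltW.
- apply: (@coverable_le _ _ _ (size cs)%:R).
    rewrite size_cat !size_map natrD.
    have -> : r `^ (- (p + 1)^-1) = (r `^ (- k)) `^ p^-1.
      by rewrite -powRrM; congr (_ `^ _); rewrite /k; field; rewrite !gt_eqF.
    by lra.
  apply: (@coverable_classes _ _ cs Rel) => [y [Py]//|c x y _ [Px _] [Py _] [cS cx] [_ cy]].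
  have [z [_ zu]] := hP.2 _ cS.
  by rewrite -(zu x (conj Px cx)) -(zu y (conj Py cy)) subrr normr0.
apply: coverable_le (coverable_itv _ _ _); [|by []|exact: powR_ge0].
have -> : r `^ k / r = r `^ (- (p + 1)^-1).
  by rewrite -kE powRB ?powRr1 ?(ltW r0) // (gt_eqF r0) implybT.
by lra.
Qed.

(** The global count suffices: r <= rho^(1/theta) gives r^(theta-1) <= rho / r, and r^(-1/(p+1)) is
    a power of the left side. *)
Lemma upper_spectrum_section_le theta : 0 < theta -> theta < 1 ->
  (upper_assouad_spectrum_open theta P <= (((1 + p) * (1 - theta))^-1)%:E)%E.
Proof.
move=> t0 t1; rewrite upper_assouad_spectrum_openE; apply: ereal_inf_lbound.
have [C C0 hC] := section_coverable.
exists ((1 + p) * (1 - theta))^-1 => //; exists C => // x Px r rho r0 h1 h2 h3.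
have rho0 : 0 < rho by exact: lt_le_trans (lt_le_trans r0 h1) h2.
have r1 : r <= 1 by exact: le_trans (le_trans h1 h2) h3.
apply: (coverable_sub (E := P)) => [y []//|]; apply: coverable_le (hC r r0 r1).
rewrite ler_pM2l //.
have tp : 0 < 1 - theta by rewrite subr_gt0.
have -> : - (p + 1)^-1 = (theta - 1) * ((1 + p) * (1 - theta))^-1.
  by field; rewrite !gt_eqF // addr_gt0.
rewrite powRrM; apply: ge0_ler_powR; rewrite ?nnegrE ?powR_ge0 ?divr_ge0 ?(ltW rho0) ?(ltW r0) //.
  by rewrite invr_ge0 mulr_ge0 ?(ltW tp) // addr_ge0 // ltW.
rewrite -powRDm // powRN (powRr1 (ltW r0)) ler_pM2r ?invr_gt0 //.
apply: (@le_trans _ _ ((rho `^ theta^-1) `^ theta)).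
  by apply: ge0_ler_powR; rewrite ?nnegrE ?powR_ge0 ?(ltW t0) ?(ltW r0).
by rewrite -powRrM mulVf ?gt_eqF // powRr1 // ltW.
Qed.

End SectionUpper.

(** * Values of the dimensions *)

Section BoxDimension.
Context {R : realType}.
Implicit Types (E : set R) (r s t d h : R).

Let small_right d : 0 < d -> \forall r \near (0 : R)^'+, 0 < r < d.
Proof.
by move=> d0; apply: filterS2 (nbhs_right_gt 0) (nbhs_right_lt d0) => r -> ->.
Qed.

Lemma covering_number_ge0 r E : (0 <= covering_number r E)%E.
Proof. by apply: le_ereal_inf_tmp => _ [n _ <-]; rewrite lee_fin. Qed.

Lemma covering_number_ge r E (L : R) : (forall N, coverable E r N -> L <= N) ->
  (L%:E <= covering_number r E)%E.
Proof.
move=> h; apply: le_ereal_inf_tmp => _ [n [c hc] <-]; rewrite lee_fin; apply: h.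
by apply/covering_number_le; apply: ereal_inf_lbound; exists n => //; exists c.
Qed.

Lemma powR_absorb C a b : 0 < C -> a < b -> exists2 d, 0 < d & d <= 1 /\
  forall r, 0 < r -> r < d -> C * r `^ b <= r `^ a :> R.
Proof.
move=> C0 ab; have ba : 0 < b - a by rewrite subr_gt0.
exists (Num.min 1 (C^-1 `^ (b - a)^-1)).
  by rewrite lt_min ltr01 powR_gt0 // invr_gt0.
split=> [|r r0]; first by rewrite ge_min lexx.
rewrite lt_min => /andP[r1 rC].
have -> : r `^ b = r `^ (b - a) * r `^ a by rewrite powRDm // subrK.
rewrite mulrA ler_piMl ?powR_ge0 // mulrC -ler_pdivlMr // mul1r.
apply: (@le_trans _ _ ((C^-1 `^ (b - a)^-1) `^ (b - a))).
  by apply: ge0_ler_powR; rewrite ?nnegrE ?powR_ge0 ?(ltW ba) ?(ltW r0) ?(ltW rC).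
by rewrite -powRrM mulVf ?gt_eqF // powRr1 // invr_ge0 ltW.
Qed.

Lemma upper_box_dim_le E s : (forall s', s < s' -> exists2 C : R, 0 < C &
    forall r, 0 < r -> r <= 1 -> coverable E r (C * r `^ (- s'))) ->
  (upper_box_dim E <= s%:E)%E.
Proof.
move=> hE; apply/lee_addgt0Pr => e e0.
have [|C C0 hC] := hE (s + e / 2); first by lra.
have [|d d0 [d1 hd]] := @powR_absorb C (- (s + e)) (- (s + e / 2)) C0; first by lra.
apply: le_trans (ereal_inf_lbound _) _; first by exists [set r | 0 < r < d];
  first exact: small_right.
apply: ge_ereal_sup => _ [r /andP[r0 rd] <-].
have r1 := lt_le_trans rd d1.
have lnr : 0 < - ln r by rewrite oppr_gt0 ln_lt0 // r0.
rewrite -EFinD lee_pdivrMr // -EFinM.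
have -> : (s + e) * - ln r = ln (r `^ (- (s + e))) by rewrite ln_powR mulNr mulrN.
rewrite -lne_EFin ?powR_gt0 // lee_lne ?in_itv /= ?leey ?andbT ?covering_number_ge0 ?lee_fin
  ?powR_ge0 //.
by apply/covering_number_le; apply: coverable_le (hC r r0 (ltW r1)); exact: hd.
Qed.

Lemma upper_box_dim_ge E h : 0 < h -> hausdorff_dim E = h%:E -> (h%:E <= upper_box_dim E)%E.
Proof.
move=> h0 hE; apply/lee_subgt0Pr => e e0.
pose t := Num.max (h - e / 2) (h / 2).
have t0 : 0 < t by rewrite lt_max; apply/orP; right; lra.
have th : t < h by rewrite gt_max; apply/andP; split; lra.
have het : h - e < t by rewrite lt_max; apply/orP; left; lra.
have [c c0 hc] := coverable_lower hE t0 th.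
have [||d d0 [d1 hd]] := @powR_absorb c^-1 (- t) (- (h - e)); [by rewrite invr_gt0|lra|].
apply: le_ereal_inf_tmp => _ [V hV <-].
have [r [Vr /andP[r0 rd]]] := filter_ex (filterI hV (small_right d0)).
have r1 := lt_le_trans rd d1.
have lnr : 0 < - ln r by rewrite oppr_gt0 ln_lt0 // r0.
apply: le_trans (ereal_sup_ubound _); last by exists r.
rewrite -EFinB lee_pdivlMr // -EFinM.
have -> : (h - e) * - ln r = ln (r `^ (- (h - e))) by rewrite ln_powR mulNr mulrN.
rewrite -lne_EFin ?powR_gt0 // lee_lne ?in_itv /= ?leey ?andbT ?covering_number_ge0 ?lee_fin
  ?powR_ge0 //.
apply: covering_number_ge => N /(hc r N r0 (ltW r1)); apply: le_trans.
by rewrite -ler_pdivrMl //; exact: hd.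
Qed.

Lemma quasi_assouad_dim_eq1 E k : k < 1 ->
  (forall theta, k < theta -> theta < 1 -> assouad_spectrum_open theta E = 1%:E) ->
  quasi_assouad_dim E = 1%:E.
Proof.
move=> k1 hE; rewrite /quasi_assouad_dim; apply: cvg_lim => //.
apply: cvg_near_cst.
by apply: filterS2 (nbhs_left_gt k1) (nbhs_left_lt 1) => t kt t1; rewrite hE.
Qed.

Lemma hausdorff_dim_nonempty E h : 0 < h -> hausdorff_dim E = h%:E -> E !=set0.
Proof.
move=> h0 hE; apply/set0P/eqP => E0.
have : (hausdorff_dim E <= (h / 2)%:E)%E.
  have h2 : 0 < h / 2 by lra.
  apply: hausdorff_dim_le => [|d e d0 e0]; first exact: ltW.
  have d2 : 0 < d / 2 by rewrite divr_gt0.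
  have dd : 2 * (d / 2) <= d by lra.
  have cE : coverable E (d / 2) 0 by exists [::] => //; rewrite E0.
  apply: le_trans (hausdorff_premeasure_coverable d2 h2 dd cE) _.
  by rewrite mul0r lee_fin ltW.
by rewrite hE lee_fin; lra.
Qed.

End BoxDimension.

(** * The three branches of the spectrum of F *)

Section Values.
Context {R : realType}.
Variables (p h : R) (I : set nat).
Hypothesis p1 : 1 < p.
Hypothesis I_pos : forall b, I b -> (0 < b)%N.
Hypothesis I_fin : finite_set (I `+` floor_powers p).
Hypothesis hE : hausdorff_dim (cf_set I : set R) = h%:E.
Hypothesis h_gt : (p + 1)^-1 < h.
Hypothesis h_lt : h < p^-1.
Implicit Types (theta alpha : R).
Local Notation F := (cf_set I : set R).
Let p0 : 0 < p. Proof. exact: lt_trans p1. Qed.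
Let pp0 : 0 < p + 1. Proof. by rewrite addr_gt0. Qed.
Let h0 : 0 < h. Proof. by apply: lt_trans h_gt; rewrite invr_gt0. Qed.
Let pi1 : p^-1 < 1. Proof. by rewrite invf_lt1. Qed.

Let branch1 theta := h + theta / (p * (1 - theta)) * (1 - p * h).
Let branch2 theta := ((1 + p) * (1 - theta))^-1.

(** The right side is the exponent of 1/rho in (rho / r)^h rho^(h-1/p) for r = rho^(1/theta);
    [branch2E] does the same for r^(-1/(p+1)). *)
Lemma branch1E theta : 0 < theta -> theta < 1 ->
  branch1 theta * (theta^-1 - 1) = h / theta - 2 * h + p^-1.
Proof.
move=> t0 t1; rewrite /branch1; have := p0.
by move=> p0'; field; rewrite !gt_eqF // subr_gt0.
Qed.

Lemma branch2E theta : 0 < theta -> theta < 1 ->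
  branch2 theta * (theta^-1 - 1) = (p + 1)^-1 / theta.
Proof.
move=> t0 t1; rewrite /branch2; have := pp0.
have d : 0 < 1 - theta by rewrite subr_gt0.
by move=> p0'; field; rewrite !gt_eqF // addrC.
Qed.

Lemma spectrum_upper theta : 0 < theta -> theta < 1 ->
  (assouad_spectrum_open theta F <= (Num.max (branch1 theta) (branch2 theta))%:E)%E.
Proof.
move=> t0 t1; apply: assouad_spectrum_open_le => alpha.
rewrite gt_max => /andP[hA1 hA2].
have ti1 : 1 < theta^-1 by rewrite invf_gt1.
have ti0 : 0 < theta^-1 - 1 by rewrite subr_gt0.
have hB1 : h / theta - 2 * h + p^-1 < alpha * (theta^-1 - 1) by rewrite -branch1E // ltr_pM2r.
have hB2 : (p + 1)^-1 / theta < alpha * (theta^-1 - 1) by rewrite -branch2E // ltr_pM2r.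
pose eta := Num.min (alpha * (theta^-1 - 1) - (h / theta - 2 * h + p^-1))
   (alpha * (theta^-1 - 1) - (p + 1)^-1 / theta).
have eta0 : 0 < eta by rewrite lt_min !subr_gt0 hB1.
have etaB1 : eta <= alpha * (theta^-1 - 1) - (h / theta - 2 * h + p^-1) by rewrite ge_min lexx.
have etaB2 : eta <= alpha * (theta^-1 - 1) - (p + 1)^-1 / theta by rewrite ge_min lexx orbT.
(* Half of the slack [eta] pays for replacing h by h + ds, the other half for the factor r^(-e); the
   second entry keeps h + ds below 1/p. *)
pose ds := Num.min (eta * theta / 2) ((p^-1 - h) / 2).
have ds0 : 0 < ds by rewrite lt_min !divr_gt0 ?mulr_gt0 // subr_gt0.
have dsp : ds <= (p^-1 - h) / 2 by rewrite ge_min lexx orbT.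
have dse : ds * theta^-1 <= eta / 2.
  rewrite ler_pdivrMr // mulrAC; rewrite /ds ge_min lexx //.
have hs : h < h + ds by rewrite ltrDl.
have ps : (p + 1)^-1 < h + ds by exact: lt_trans h_gt hs.
have sp : h + ds < p^-1 by move: h_lt dsp; lra.
have e0 : 0 < eta * theta / 2 by rewrite divr_gt0 ?mulr_gt0.
have [C C0 hC] := cf_set_ball_coverable I_pos hE p1 I_fin hs ps sp e0.
exists (2 * C) => [|x Fx rho rho0 rho1]; first by rewrite mulr_gt0.
have rho01 : 0 < rho <= 1 by rewrite rho0.
have rr : rho `^ theta^-1 <= rho.
  by rewrite -[leRHS](powRr1 (ltW rho0)); apply: ger_powR => //; exact: ltW.
apply: coverable_le (hC x rho (rho `^ theta^-1) (powR_gt0 _ rho0) rr rho1).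
set X := rho `^ (alpha * (1 - theta^-1)).
have h1 : rho `^ theta^-1 `^ (- (eta * theta / 2)) * ((rho / rho `^ theta^-1) `^ (h + ds) * rho
  `^ (h + ds - p^-1)) <= X.
  have -> : rho / rho `^ theta^-1 = rho `^ (1 - theta^-1).
    by rewrite -powRN -{1}(powRr1 (ltW rho0)) powRDm.
  rewrite -!powRrM !powRDm //; apply: ger_powR => //.
  have -> : theta^-1 * - (eta * theta / 2) = - (eta / 2) by field; rewrite gt_eqF.
  by nra.
have h2 : rho `^ theta^-1 `^ (- (eta * theta / 2)) * rho `^ theta^-1 `^ (- (p + 1)^-1) <= X.
  rewrite -!powRrM !powRDm //; apply: ger_powR => //.
  have -> : theta^-1 * - (eta * theta / 2) = - (eta / 2) by field; rewrite gt_eqF.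
  by lra.
by rewrite -mulrA mulrDr; nra.
Qed.

Lemma spectrum_lower1 theta : 0 < theta -> theta < 2^-1 ->
  ((branch1 theta)%:E <= assouad_spectrum_open theta F)%E.
Proof.
move=> t0 t2; apply: assouad_spectrum_open_ge => alpha halpha.
have ti2 : 2 < theta^-1 by rewrite -[ltLHS]invrK ltf_pV2 ?posrE ?invr_gt0.
have ti0 : 0 < theta^-1 - 1 by lra.
have t1 : theta < 1 by lra.
rewrite -(ler_pM2r ti0) branch1E // leNgt; apply/negP => hlt.
have Y0 : 0 < theta^-1 - 2 by lra.
(* Solved for t, the bound of [cf_set_spectrum_exponent_le] reads t <= X / (1/theta - 2); a t
   between this quotient and h contradicts it. *)
pose X := alpha * (theta^-1 - 1) - p^-1.
have XY : X / (theta^-1 - 2) < h by rewrite ltr_pdivrMr // /X; lra.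
pose t := (Num.max 0 (X / (theta^-1 - 2)) + h) / 2.
have m0 : 0 <= Num.max 0 (X / (theta^-1 - 2)) by rewrite le_max lexx.
have mX : X / (theta^-1 - 2) <= Num.max 0 (X / (theta^-1 - 2)) by rewrite le_max lexx orbT.
have mh : Num.max 0 (X / (theta^-1 - 2)) < h by rewrite gt_max h0 XY.
have tp : 0 < t by rewrite /t; move: h0; lra.
have th : t < h by rewrite /t; lra.
have := cf_set_spectrum_exponent_le p1 I_fin I_pos hE tp th t0 t2 (hausdorff_dim_nonempty h0 hE)
  halpha.
have : X < t * (theta^-1 - 2) by rewrite -ltr_pdivrMr // /t; lra.
by rewrite /X; lra.
Qed.

Lemma spectrum_lower2 theta : 0 < theta -> theta < 1 ->
  ((Num.min 1 (branch2 theta))%:E <= assouad_spectrum_open theta F)%E.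
Proof.
move=> t0 t1; apply: power_dense_spectrum_ge => //.
apply: power_dense_cf_set => //; exact: hausdorff_dim_nonempty hE.
Qed.

Lemma cf_set_upper_box_dim : upper_box_dim F = h%:E.
Proof.
apply/eqP; rewrite eq_le upper_box_dim_ge // andbT; apply: upper_box_dim_le => s' hs'.
exact: (cf_set_coverable I_pos hE p1 I_fin hs' (lt_trans h_gt hs')).
Qed.

Let theta1 := ((h + h * p - 1) * p) / ((1 + p) * (2 * p * h - 1)).
Let k := p / (1 + p).

Let hp1 : 1 < h * (p + 1). Proof. by rewrite -ltr_pdivrMr // mul1r. Qed.
Let ph1 : p * h < 1. Proof. by rewrite mulrC -ltr_pdivlMr // mul1r. Qed.
Let ph2 : 0 < 2 * p * h - 1. Proof. by move: hp1 p1 h0; nra. Qed.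

Lemma theta1_gt0 : 0 < theta1.
Proof.
rewrite divr_gt0 ?mulr_gt0 ?(addrC 1) //; move: hp1; lra.
Qed.

(** This places the whole first regime where the copies of F are separated; it is equivalent to p >
    1. *)
Lemma theta1_lt_half : theta1 < 2^-1.
Proof.
have pp : 0 < 1 + p by rewrite addrC.
by rewrite ltr_pdivrMr ?mulr_gt0 //; move: p1; lra.
Qed.

Lemma threshold_gt_half : 2^-1 < k.
Proof.
have pp : 0 < 1 + p by rewrite addrC.
by rewrite ltr_pdivlMr //; move: p1; lra.
Qed.

Lemma threshold_lt1 : k < 1.
Proof.
have pp : 0 < 1 + p by rewrite addrC.
by rewrite ltr_pdivrMr // mul1r ltrDr.
Qed.

Lemma theta1_lt_threshold : theta1 < k.
Proof. exact: lt_trans theta1_lt_half threshold_gt_half. Qed.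

(** Shows that [theta1] is the crossing point of the first two branches. *)
Let branch_sub theta : theta < 1 ->
  (branch1 theta - branch2 theta) = (2 * p * h - 1) / (p * (1 - theta)) * (theta1 - theta).
Proof.
move=> t1; rewrite /branch1 /branch2 /theta1; have := pp0; have := ph2; have := p0.
have d : 0 < 1 - theta by rewrite subr_gt0.
move=> a b c; field; rewrite !gt_eqF // addrC //.
Qed.

Lemma branch2_le_branch1 theta : theta < 1 -> theta <= theta1 -> branch2 theta <= branch1 theta.
Proof.
move=> t1 tt; rewrite -subr_ge0 branch_sub // mulr_ge0 ?subr_ge0 // divr_ge0 ?(ltW ph2) //.
by rewrite mulr_ge0 ?(ltW p0) // subr_ge0 ltW.
Qed.

Lemma branch2_lt_branch1 theta : theta < theta1 -> branch2 theta < branch1 theta.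
Proof.
move=> tt; have t1 : theta < 1 by apply: lt_trans tt (lt_trans theta1_lt_threshold threshold_lt1).
rewrite -subr_gt0 branch_sub // mulr_gt0 ?subr_gt0 // divr_gt0 //.
by rewrite mulr_gt0 // subr_gt0.
Qed.

Lemma branch1_le_branch2 theta : theta < 1 -> theta1 <= theta -> branch1 theta <= branch2 theta.
Proof.
move=> t1 tt; rewrite -subr_le0 branch_sub // mulr_ge0_le0 ?subr_le0 // divr_ge0 ?(ltW ph2) //.
by rewrite mulr_ge0 ?(ltW p0) // subr_ge0 ltW.
Qed.

Lemma branch2_le1 theta : theta <= k -> branch2 theta <= 1.
Proof.
move=> tk; have t1 := le_lt_trans tk threshold_lt1.
rewrite /branch2 invf_le1 ?mulr_gt0 ?subr_gt0 ?(addrC 1 p) //.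
by move: tk; rewrite ler_pdivlMr ?(addrC 1 p) //; lra.
Qed.

Lemma branch2_ge1 theta : theta < 1 -> k <= theta -> 1 <= branch2 theta.
Proof.
move=> t1 kt; rewrite /branch2 invf_ge1 ?mulr_gt0 ?subr_gt0 ?(addrC 1 p) //.
by move: kt; rewrite ler_pdivrMr ?(addrC 1 p) //; lra.
Qed.

Lemma spectrum_branch1 theta : 0 <= theta -> theta <= theta1 ->
  assouad_spectrum theta F = (branch1 theta)%:E.
Proof.
rewrite le_eqVlt => /orP[/eqP<- _|t0 tt].
  by rewrite /assouad_spectrum eqxx cf_set_upper_box_dim /branch1 mul0r mul0r addr0.
have t2 := le_lt_trans tt theta1_lt_half; have t1 : theta < 1 by lra.
rewrite /assouad_spectrum gt_eqF // lt_eqF //; apply/eqP; rewrite eq_le spectrum_lower1 // andbT.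
by apply: le_trans (spectrum_upper t0 t1) _; rewrite lee_fin ge_max lexx branch2_le_branch1.
Qed.

Lemma spectrum_branch2 theta : theta1 < theta -> theta < k ->
  assouad_spectrum theta F = (branch2 theta)%:E.
Proof.
move=> tt tk; have t0 := lt_trans theta1_gt0 tt; have t1 := lt_trans tk threshold_lt1.
rewrite /assouad_spectrum gt_eqF // lt_eqF //; apply/eqP; rewrite eq_le; apply/andP; split.
  by apply: le_trans (spectrum_upper t0 t1) _;
    rewrite lee_fin ge_max lexx branch1_le_branch2 // ltW.
by apply: le_trans (spectrum_lower2 t0 t1); rewrite lee_fin le_min lexx andbT branch2_le1 // ltW.
Qed.

Lemma spectrum_open_branch3 theta : k <= theta -> theta < 1 ->
  assouad_spectrum_open theta F = 1%:E.
Proof.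
move=> kt t1; have t0 : 0 < theta by apply: lt_le_trans kt; apply: lt_trans threshold_gt_half;
  rewrite invr_gt0.
apply/eqP; rewrite eq_le; apply/andP; split.
  apply: le_trans (assouad_spectrum_open_le_upper _ t0 t1) _.
  exact: upper_assouad_spectrum_open_le1.
by apply: le_trans (spectrum_lower2 t0 t1); rewrite lee_fin le_min lexx branch2_ge1.
Qed.

Lemma spectrum_branch3 theta : k <= theta -> theta <= 1 -> assouad_spectrum theta F = 1%:E.
Proof.
move=> kt t1; have t0 : 0 < theta by apply: lt_le_trans kt; apply: lt_trans threshold_gt_half;
  rewrite invr_gt0.
rewrite /assouad_spectrum gt_eqF //; case: eqVneq => [_|tn1].
  by apply: (quasi_assouad_dim_eq1 threshold_lt1) => t kt' t1';
    apply: spectrum_open_branch3 => //; exact: ltW.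
by apply: spectrum_open_branch3 => //; rewrite lt_neqAle tn1.
Qed.

End Values.

(** * Phase transitions *)

Section Kinks.
Context {R : realType}.
Implicit Types (f : R -> R) (x a c d k : R).

Let quotient f x k : R := k^-1 * (f (k + x) - f x).

Let derivable_quotient f x : derivable f x 1 <-> cvg (quotient f x k @[k --> 0^']).
Proof.
rewrite /derivable (_ : (fun k : R => k^-1 *: ((f \o shift x) (k *: 1) - f x)) = quotient f x) //.
by apply/funext => k; rewrite /quotient /= /shift /= /GRing.scale /= mulr1.
Qed.

(* All three branches of the spectrum are affine functions of [(1 - t)^-1]. *)
Let branch a c t : R := a + c * (1 - t)^-1.

Let branch_quotient a c x : x < 1 ->
  quotient (branch a c) x k @[k --> 0^'] --> c * ((1 - x)^-1 * (1 - x - 0)^-1).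
Proof.
move=> x1; have x10 : 0 < 1 - x by rewrite subr_gt0.
have h0 : (fun k : R => c * ((1 - x)^-1 * (1 - x - k)^-1)) @ (0 : R) --> c * ((1 - x)^-1 * (1 -
  x - 0)^-1).
  apply: cvgM; first exact: cvg_cst.
  apply: cvgM; first exact: cvg_cst.
  by apply: cvgV; [rewrite subr0 gt_eqF|apply: cvgB; [exact: cvg_cst|exact: cvg_id]].
have h1 : (fun k : R => c * ((1 - x)^-1 * (1 - x - k)^-1)) @ 0^' --> c * ((1 - x)^-1 * (1 - x -
  0)^-1).
  by move=> A /h0; exact: nbhs_dnbhs.
apply: cvg_trans h1; apply: near_eq_cvg; near=> k.
have k0 : k != 0 by near: k; exact: nbhs_dnbhs_neq.
have : `|k| < 1 - x by near: k; exact: dnbhs0_lt.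
rewrite ltr_norml => /andP[_ kx].
rewrite /quotient /branch; field; rewrite k0 !gt_eqF //; lra.
Unshelve. all: by end_near. Qed.

Lemma derivable_branch f x d a c : x < 1 -> 0 < d ->
  (forall y, `|y - x| < d -> f y = branch a c y) -> derivable f x 1.
Proof.
move=> x1 d0 hf; apply/derivable_quotient; apply/cvg_ex.
exists (c * ((1 - x)^-1 * (1 - x - 0)^-1)).
have h := @branch_quotient a c x x1; apply: cvg_trans h; apply: near_eq_cvg; near=> k.
have kd : `|k| < d by near: k; exact: dnbhs0_lt.
by rewrite /quotient !hf ?subrr ?normr0 ?addrK.
Unshelve. all: by end_near. Qed.

(** The one-sided limits of the difference quotient are c w and c' w with w = (1 - x)^(-2), which is
    not 0. *)
Lemma not_derivable_kink f x d a c a' c' : x < 1 -> 0 < d -> c != c' ->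
  (forall y, x - d < y -> y <= x -> f y = branch a c y) ->
  (forall y, x <= y -> y < x + d -> f y = branch a' c' y) -> ~ derivable f x 1.
Proof.
move=> x1 d0 cc' hl hr /derivable_quotient/cvg_ex[l hlim].
have x10 : 0 < 1 - x by rewrite subr_gt0.
pose w := (1 - x)^-1 * (1 - x - 0)^-1.
have w0 : w != 0 by rewrite /w subr0 mulf_neq0 // invr_neq0 // gt_eqF.
have El : l = c * w.
  apply: (@cvg_unique _ (@Rhausdorff R) (quotient f x @ 0^'-)).
    exact: cvg_dnbhs_at_left.
  have := cvg_dnbhs_at_left (@branch_quotient a c x x1).
  apply: cvg_trans; apply: near_eq_cvg; near=> k.
  have k0 : k < 0 by near: k; exact: nbhs_left_lt.
  have kd : - d < k by near: k; apply: nbhs_left_gt; rewrite oppr_lt0.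
  by rewrite /quotient !hl //; lra.
have Er : l = c' * w.
  apply: (@cvg_unique _ (@Rhausdorff R) (quotient f x @ 0^'+)).
    exact: cvg_dnbhs_at_right.
  have := cvg_dnbhs_at_right (@branch_quotient a' c' x x1).
  apply: cvg_trans; apply: near_eq_cvg; near=> k.
  have k0 : 0 < k by near: k; exact: nbhs_right_gt.
  have kd : k < d by near: k; exact: nbhs_right_lt.
  by rewrite /quotient !hr //; lra.
by move/eqP: cc'; apply; apply: (mulIf w0); rewrite -El -Er.
Unshelve. all: by end_near. Qed.

Lemma card_eq_set2 (T : Type) (x y : T) : x <> y -> ([set x; y] #= `I_2)%card.
Proof.
move=> xy; pose f n := if n == 0%N then x else y.
have -> : [set x; y] = f @` `I_2.
  apply/seteqP; split=> [z [->|->]|_ [n n2 <-]]; [by exists 0%N|by exists 1%N|].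
  by rewrite /f; case: eqP => _; [left|right].
apply: inj_card_eq => m n; rewrite !inE /= /f => m2 n2.
by case: m m2 => [|[|//]] _; case: n n2 => [|[|//]] _ //= /esym.
Qed.

End Kinks.

(** * The general upper bound and its maximum *)

Section Bounds.
Context {R : realType}.
Variables (p h : R) (I : set nat) (P : set R).
Hypothesis p1 : 1 < p.
Hypothesis I_pos : forall b, I b -> (0 < b)%N.
Hypothesis I_fin : finite_set (I `+` floor_powers p).
Hypothesis hE : hausdorff_dim (cf_set I : set R) = h%:E.
Hypothesis h_gt : (p + 1)^-1 < h.
Hypothesis h_lt : h < p^-1.
Hypothesis hP : ifs_section (cf_ifs I) P.
Implicit Types (theta phi : R).
Local Notation F := (cf_set I : set R).
Local Notation k := (p / (1 + p)).
Let p0 : 0 < p. Proof. exact: lt_trans p1. Qed.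
Let pp0 : 0 < 1 + p. Proof. by rewrite addr_gt0. Qed.

(** Keeps of the value min(1, 1 / ((1 + p) (1 - phi))) only what the maximisation uses, in a form
    that also holds at phi = 1. *)
Let section_spectrum phi : 0 < phi -> phi <= 1 -> exists a : R,
  [/\ upper_assouad_spectrum phi P = a%:E, a <= 1, (phi^-1 - 1) * a <= phi^-1 / (1 + p) &
    k <= phi -> a = 1].
Proof.
move=> f0; rewrite le_eqVlt => /orP[/eqP->|f1].
  exists 1; split=> //; last by rewrite invr1 subrr mul0r divr_ge0 // ltW.
  rewrite /upper_assouad_spectrum eqxx; apply: (quasi_assouad_dim_eq1 (threshold_lt1 p1)) =>
    t kt t1.
  have t0 : 0 < t by apply: lt_trans kt; rewrite divr_gt0.
  apply/eqP; rewrite eq_le; apply/andP; split.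
    apply: le_trans (assouad_spectrum_open_le_upper _ t0 t1) _.
    exact: upper_assouad_spectrum_open_le1.
  apply: le_trans (power_dense_spectrum_ge p1 (power_dense_section p1 I_fin hP) t0 t1).
  by rewrite lee_fin le_min lexx (branch2_ge1 p1) // ltW.
pose a := Num.min 1 ((1 + p) * (1 - phi))^-1; exists a.
have f1' : 0 < 1 - phi by rewrite subr_gt0.
have fi : 1 < phi^-1 by rewrite invf_gt1.
split.
- rewrite /upper_assouad_spectrum lt_eqF //; apply/eqP; rewrite eq_le; apply/andP; split.
    rewrite /a /Num.min; case: ifP => _.
      exact: upper_assouad_spectrum_open_le1.
    exact: (upper_spectrum_section_le p1 I_fin I_pos hP).
  apply: le_trans (assouad_spectrum_open_le_upper _ f0 f1).
  exact: (power_dense_spectrum_ge p1 (power_dense_section p1 I_fin hP) f0 f1).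
- by rewrite ge_min lexx.
- apply: (@le_trans _ _ ((phi^-1 - 1) * ((1 + p) * (1 - phi))^-1)).
    by rewrite ler_wpM2l ?subr_ge0 ?(ltW fi) // ge_min lexx orbT.
  rewrite le_eqVlt; apply/orP; left; apply/eqP; field.
  by rewrite !gt_eqF.
move=> kf; apply/min_idPl; exact: branch2_ge1.
Qed.

Let spectrum_bound_fin theta phi a : upper_assouad_spectrum phi P = a%:E ->
  spectrum_bound P F theta phi =
    (((phi^-1 - 1) * a + (theta^-1 - phi^-1) * h) / (theta^-1 - 1))%:E.
Proof.
by move=> aE; rewrite /spectrum_bound aE (cf_set_upper_box_dim p1 I_pos I_fin hE) // -!EFinM
  -EFinD.
Qed.

(** In the variable u = 1/phi the numerator is bounded by a function of slope 1 - h > 0 for u <= 1 +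
    1/p and of slope 1/(1+p) - h < 0 beyond; both bounds agree with it at u = 1 + 1/p. *)
Lemma spectrum_bound_max theta : 0 < theta -> theta <= k ->
  is_max [set spectrum_bound P F theta phi | phi in `[theta, 1]] (spectrum_bound P F theta k) /\
  spectrum_bound P F theta k = ((p^-1 + (theta^-1 - (1 + p) / p) * h) / (theta^-1 - 1))%:E.
Proof.
move=> t0 tk; have k0 : 0 < k by rewrite divr_gt0.
have k1 := threshold_lt1 p1; have t1 : theta < 1 by exact: le_lt_trans k1.
have ti : 1 < theta^-1 by rewrite invf_gt1.
have [ak [akE _ _ ak1]] := section_spectrum k0 (ltW k1).
have kV : k^-1 = (1 + p) / p by rewrite invf_div.
have kE : spectrum_bound P F theta k = ((p^-1 + (theta^-1 - (1 + p) / p) * h) / (theta^-1 -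
  1))%:E.
  rewrite (spectrum_bound_fin theta akE) ak1 // kV mulr1; congr (_ %:E).
  by congr (_ / _); congr (_ + _); field; rewrite gt_eqF.
split=> //; split.
  by exists k => //=; rewrite in_itv /= tk ltW.
move=> M [phi /=]; rewrite in_itv /= => /andP[tphi phi1] <-.
have f0 : 0 < phi := lt_le_trans t0 tphi.
have [a [aE a1 ha _]] := section_spectrum f0 phi1.
rewrite (spectrum_bound_fin theta aE) kE lee_fin ler_pM2r ?invr_gt0 ?subr_gt0 //.
have fi : 1 <= phi^-1 by rewrite invf_ge1.
have h1 : h < 1 by apply: lt_trans h_lt _; rewrite invf_lt1.
have pE : (1 + p) / p = p^-1 + 1 by rewrite mulrDl mul1r divff // gt_eqF.
rewrite pE; have [kf|fk] := leP (p^-1 + 1) phi^-1.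
  have ph : (1 + p)^-1 < h by rewrite addrC.
  have e : (p^-1 + 1) / (1 + p) = p^-1 by field; rewrite !gt_eqF.
  have : (phi^-1 - (p^-1 + 1)) * ((1 + p)^-1 - h) <= 0.
    by rewrite mulr_ge0_le0 ?subr_ge0 // subr_le0 ltW.
  by lra.
have : (phi^-1 - 1) * a <= phi^-1 - 1 by rewrite ler_piMr // subr_ge0.
have : 0 <= (p^-1 + 1 - phi^-1) * (1 - h) by rewrite mulr_ge0 // subr_ge0 ltW.
by lra.
Qed.

Lemma section_spectrum_le phi : 0 < phi -> phi < 1 ->
  (upper_assouad_spectrum phi P <= (((1 + p) * (1 - phi))^-1)%:E)%E.
Proof.
move=> f0 f1; rewrite /upper_assouad_spectrum lt_eqF //.
exact: (upper_spectrum_section_le p1 I_fin I_pos hP).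
Qed.

End Bounds.

Local Open Scope card_scope.

Theorem proposition6p3 (R : realType) (p : R) (hp : 1 < p)
  (I : set nat) (I_pos : forall b, I b -> (0 < b)%N)
  (I_fin : finite_set (I `+` floor_powers p))
  (h : R) (hE : hausdorff_dim (cf_set I : set R) = h%:E)
  (h_gt : (p + 1)^-1 < h) (h_lt : h < p^-1) :
  let F : set R := cf_set I in
  let theta1 : R := ((h + h * p - 1) * p) / ((1 + p) * (2 * p * h - 1)) in
  [/\ forall theta : R, 0 <= theta -> theta <= theta1 ->
        assouad_spectrum theta F =
        (h + theta / (p * (1 - theta)) * (1 - p * h))%:E,
      forall theta : R, theta1 < theta -> theta < p / (1 + p) ->
        assouad_spectrum theta F = (((1 + p) * (1 - theta))^-1)%:E,
      forall theta : R, p / (1 + p) <= theta -> theta <= 1 ->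
        assouad_spectrum theta F = 1%E,
      [set theta : R | [/\ 0 < theta, theta < 1 &
        ~ derivable (fun t : R => fine (assouad_spectrum t F)) theta 1]]
        #= `I_2 &
      forall P : set R, ifs_section (cf_ifs I) P ->
      forall theta : R, 0 < theta -> theta < theta1 ->
        (maxe h%:E (upper_assouad_spectrum theta P)
           < assouad_spectrum theta F)%E /\
        exists2 M : \bar R,
          is_max [set spectrum_bound P F theta phi | phi in `[theta, 1]] M &
          (assouad_spectrum theta F < M)%E].
Proof.
move=> F theta1; pose k := p / (1 + p).
have p0 : 0 < p by lra.
have ph1 : p * h < 1 by rewrite mulrC -ltr_pdivlMr // mul1r.
have eq1 := @spectrum_branch1 R p h I hp I_pos I_fin hE h_gt h_lt.
have eq2 := @spectrum_branch2 R p h I hp I_pos I_fin hE h_gt h_lt.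
have eq3 := @spectrum_branch3 R p h I hp I_pos I_fin hE h_gt.
have t1_gt0 : 0 < theta1 := theta1_gt0 hp h_gt.
have t1_lt2 : theta1 < 2^-1 := theta1_lt_half hp h_gt.
have k1 : k < 1 := threshold_lt1 hp.
have t1k : theta1 < k := theta1_lt_threshold hp h_gt.
have k0 : 0 < k := lt_trans t1_gt0 t1k.
split=> //.
- have f1 t : 0 <= t -> t <= theta1 -> fine (assouad_spectrum t F) =
  (h - (1 - p * h) / p) + (1 - p * h) / p * (1 - t)^-1.
    move=> t0 tt; have t1 : 0 < 1 - t by lra.
    by rewrite eq1 //=; field; rewrite !gt_eqF.
  (* The closed interval matters: a kink compares two formulas that both hold at the point
     itself. *)
  have f2 t : theta1 <= t -> t <= k -> fine (assouad_spectrum t F) = 0 + (1 + p)^-1 * (1 - t)^-1.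
    move=> tt tk; have t1 : 0 < 1 - t by rewrite subr_gt0; exact: le_lt_trans k1.
    have pp : 0 < 1 + p by lra.
    rewrite add0r -invfM; have [ttlt|ttge] := ltP theta1 t.
      move: tk; rewrite le_eqVlt => /orP[/eqP->|tk]; last by rewrite eq2.
      rewrite eq3 ?lexx ?(ltW k1) //= /k; field; lra.
    have tE : t = theta1 by apply/eqP; rewrite eq_le ttge.
    have t2 : 0 <= t by rewrite tE ltW.
    have t1' : t < 1 by rewrite -subr_gt0.
    rewrite eq1 //=; apply/eqP; rewrite eq_le; apply/andP; split.
      by apply: (branch1_le_branch2 hp h_gt t1'); rewrite -/theta1.
    exact: (branch2_le_branch1 hp h_gt t1').
  have f3 t : k <= t -> t <= 1 -> fine (assouad_spectrum t F) = 1 + 0 * (1 - t)^-1.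
    by move=> kt t1; rewrite eq3 // mul0r addr0.
  have slope1 : (1 - p * h) / p < (1 + p)^-1.
    have hp1 : 1 < h * (p + 1) by rewrite -ltr_pdivrMr ?mul1r //; lra.
    have pp : 0 < 1 + p by lra.
    by rewrite -[ltRHS]mul1r ltr_pdivrMr // mulrAC ltr_pdivlMr //; nra.
  have slope2 : (1 + p)^-1 != 0 by rewrite gt_eqF // invr_gt0; lra.
  have -> : [set theta : R | [/\ 0 < theta, theta < 1 &
        ~ derivable (fun t : R => fine (assouad_spectrum t F)) theta 1]] = [set theta1; k].
    apply/seteqP; split=> [t [t0 t1 nd]|t [->|->]].
    + have [tt|tt|->] := ltgtP t theta1; last by left.
        exfalso; apply: nd.
        have d0 : 0 < Num.min t (theta1 - t) by rewrite lt_min t0 subr_gt0.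
        apply: (derivable_branch t1 d0) => y;
          rewrite lt_min !ltr_norml => /andP[/andP[? ?] /andP[? ?]].
        by apply: f1; lra.
      have [tk|kt|->] := ltgtP t k; last by right.
        exfalso; apply: nd.
        have d0 : 0 < Num.min (t - theta1) (k - t) by rewrite lt_min !subr_gt0 tt.
        apply: (derivable_branch t1 d0) => y;
          rewrite lt_min !ltr_norml => /andP[/andP[? ?] /andP[? ?]].
        by apply: f2; lra.
      exfalso; apply: nd.
      have d0 : 0 < Num.min (t - k) (1 - t) by rewrite lt_min !subr_gt0 kt.
      apply: (derivable_branch t1 d0) => y;
        rewrite lt_min !ltr_norml => /andP[/andP[? ?] /andP[? ?]].
      by apply: f3; lra.
    + split=> //; first by lra.
      have d0 : 0 < Num.min theta1 (k - theta1) by rewrite lt_min t1_gt0 subr_gt0.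
      have x1 : theta1 < 1 by lra.
      have dm1 : Num.min theta1 (k - theta1) <= theta1 by rewrite ge_min lexx.
      have dm2 : Num.min theta1 (k - theta1) <= k - theta1 by rewrite ge_min lexx orbT.
      have cc : (1 - p * h) / p != (1 + p)^-1 by rewrite lt_eqF.
      apply: (not_derivable_kink x1 d0 cc) => y h1 h2.
        by apply: f1; lra.
      by apply: f2; lra.
    + split=> //.
      have d0 : 0 < Num.min (k - theta1) (1 - k) by rewrite lt_min !subr_gt0 t1k.
      have dm1 : Num.min (k - theta1) (1 - k) <= k - theta1 by rewrite ge_min lexx.
      have dm2 : Num.min (k - theta1) (1 - k) <= 1 - k by rewrite ge_min lexx orbT.
      apply: (not_derivable_kink k1 d0 slope2) => y h1 h2.
        by apply: f2; lra.
      by apply: f3; lra.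
  by apply: card_eq_set2 => e; move: t1k; rewrite e ltxx.
move=> P hP theta t0 tt.
have t1 : theta < 1 by lra.
have tp : 0 < 1 - theta by rewrite subr_gt0.
rewrite eq1 ?(ltW t0) ?(ltW tt) //; split.
  rewrite gt_max; apply/andP; split.
    by rewrite lte_fin ltrDl mulr_gt0 ?divr_gt0 ?mulr_gt0 // subr_gt0.
  apply: le_lt_trans (section_spectrum_le hp I_pos I_fin hP t0 t1) _.
  by rewrite lte_fin; exact: (branch2_lt_branch1 hp h_gt tt).
have tk : theta <= p / (1 + p) by exact: ltW (lt_trans tt t1k).
have [hM ME] := spectrum_bound_max hp I_pos I_fin hE h_gt h_lt hP t0 tk.
exists (spectrum_bound P F theta k) => //; rewrite ME lte_fin.
have ti : 0 < theta^-1 - 1 by rewrite subr_gt0 invf_gt1.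
rewrite ltr_pdivlMr // (branch1E h hp t0 t1).
have -> : (1 + p) / p = p^-1 + 1 by field; rewrite gt_eqF.
have h0 : 0 < h by apply: lt_trans h_gt; rewrite invr_gt0; lra.
have pi1 : 0 < 1 - p^-1 by rewrite subr_gt0 invf_lt1.
(* The two numerators differ by h (1 - 1/p). *)
have := mulr_gt0 h0 pi1; lra.
Qed.
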